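(* Define a morphism of $\mathcal{O}$-modules $\mathcal{A}\colon\mathcal{K}\to\mathcal{R}$ by mapping $V\in\mathcal{K}$ to the unique $F\in\mathcal{R}$ for which $$F_\lambda=\frac{1}{w(\lambda)}\bigl(V^+_\lambda-V^-_\lambda\bigr)\qquad\text{for all }\lambda>0,$$ where $V^\pm_\lambda=\lim_{\varepsilon\to0+}V_{\lambda\pm i\varepsilon}$. This is a morphism of algebraic families of $(\mathfrak{g},K)$-modules, and an isomorphism on $\ell=0$ isotypical components (that is, on $K$-fixed parts).
   Context: Fix a real constant $\gamma>0$. Put $\mathbb{R}^3_0=\mathbb{R}^3\setminus\{0\}$, $r=\|x\|$, $T=-\Delta-2\gamma/r$, and $\mathcal{O}=\mathbb{C}[T]$ (viewed as polynomial functions of $\lambda\in\mathbb{C}$). Let $L_1=x_2\partial_3-x_3\partial_2$, $L_2=x_3\partial_1-x_1\partial_3$, $L_3=x_1\partial_2-x_2\partial_1$, and let the Runge-Lenz operators be $R_1=\sqrt{-1}(L_3\partial_2-L_2\partial_3-\partial_1+\gamma x_1/r)$, $R_2=\sqrt{-1}(L_1\partial_3-L_3\partial_1-\partial_2+\gamma x_2/r)$, $R_3=\sqrt{-1}(L_2\partial_1-L_1\partial_2-\partial_3+\gamma x_3/r)$. All commute with $T$ as differential operators on $\mathbb{R}^3_0$. $\mathfrak{g}$ is the $\mathcal{O}$-linear span of the $L_i,R_i$, a Lie algebra over $\mathcal{O}$ under the commutator, free on these six elements. $K=O(3)$ (or its complexification) acts on $\mathbb{R}^3_0$ by $A\colon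 v\mapsto\det(A)^{-1}Av$, hence on functions and by conjugation on $\mathfrak{g}$. An algebraic family of $(\mathfrak{g},K)$-modules is a free $\mathcal{O}$-module with a locally finite-dimensional $K$-action by $\mathcal{O}$-module automorphisms and a compatible $\mathcal{O}$-linear $\mathfrak{g}$-action; morphisms are $\mathcal{O}$-linear, $K$- and $\mathfrak{g}$-equivariant maps. $T$ is also regarded as the self-adjoint operator on $L^2(\mathbb{R}^3)$ with domain $\mathrm{dom}(T)=\mathcal{H}^2(\mathbb{R}^3)$, whose spectrum is $\mathrm{Spec}(T)=\{-\gamma^2/n^2:n=1,2,\dots\}\cup[0,\infty)$. For $\lambda\in\mathbb{C}$, $\mathrm{Sol}(\lambda)=\{\psi\in C^\infty(\mathbb{R}^3_0):\psi\ K\text{-finite},\ T\psi=\lambda\psi\}$. $F_{\ell,\lambda}$ is the unique solution of $r^2\psi''+2r\psi'-\ell(\ell+1)\psi+2\gamma r\psi+\lambda r^2\psi=0$ extending to an entire function of $r$ with $F_{\ell,\lambda}(r)=r^\ell+\text{higher-order terms}$. $\mathrm{RegSol}(\lambda)$ is the span of the functions $F_{\ell,\lambda}(r)Y_\ell$, $Y_\ell$ a spherical harmonic of degree $\ell$, $\ell\ge0$. $\mathcal{R}$ is the complex vector space of sections $\lambda\mapsto F_\lambda\in\mathrm{RegSol}(\lambda)$ ($\lambda\in\mathbb{C}$) spanned by $\lambda\mapsto p(\lambda)F_{\ell,\lambda}Y_\ell$ with $p$ polynomial. The Wronskian form on $\mathrm{Sol}(\lambda)$ is $\mathrm{Wr}(\varphi,\psi)=\frac1{4\pi}\int_{S^2}r^2\bigl(\frac{\partial\varphi}{\partial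 r}\psi-\varphi\frac{\partial\psi}{\partial r}\bigr)d\mathrm{Area}$ (independent of $r$). $\mathrm{Sol}_\infty(\lambda)$ is the space of those $\psi\in\mathrm{Sol}(\lambda)$ for which $\sigma\psi\in\mathrm{dom}(T)$ for some cutoff $\sigma$ at $\infty$, meaning a smooth function on $\mathbb{R}^3$ (vanishing near $0$ where needed so that $\sigma\psi$ makes sense) that is identically $1$ outside a compact set. $\mathcal{K}$ (Kodaira-type solutions) is the complex vector space spanned by functions $(\lambda,x)\mapsto V_\lambda(x)$ on $[\mathbb{C}\setminus\mathrm{Spec}(T)]\times\mathbb{R}^3_0$ such that $V_\lambda\in\mathrm{Sol}_\infty(\lambda)$ for all $\lambda\notin\mathrm{Spec}(T)$, and such that for every $F\in\mathcal{R}$ the function $\lambda\mapsto\mathrm{Wr}(F_\lambda,V_\lambda)$ is polynomial on $\mathbb{C}\setminus\mathrm{Spec}(T)$. On $\mathcal{R}$ and $\mathcal{K}$, $\mathcal{O}$ acts by multiplication by polynomials in $\lambda$, and $\mathfrak{g}$ and $K$ act pointwise in $\lambda$ through their actions on functions on $\mathbb{R}^3_0$; both are algebraic families of $(\mathfrak{g},K)$-modules in this way. Let $V_0\in\mathcal{K}$ be the family of $K$-invariant functions with $\mathrm{Wr}(V_{0,\lambda},F_{0,\lambda})=1$ for every $\lambda\notin\mathrm{Spec}(T)$, and for $\lambda>0$ let $w(\lambda)=\mathrm{Wr}(V^+_{0,\lambda},V^-_{0,\lambda})$, where $V^\pm_{0,\lambda}=\lim_{\varepsilon\to0+}V_{0,\lambda\pm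 i\varepsilon}$; $w(\lambda)$ is nowhere zero. For every $V\in\mathcal{K}$ and $\lambda>0$ the limits $V^\pm_\lambda$ exist in $C^\infty(\mathbb{R}^3_0)$ (uniform convergence on compact sets of all derivatives), and there is a unique $F\in\mathcal{R}$ with $V^+_\lambda-V^-_\lambda=w(\lambda)F_\lambda$ for all $\lambda>0$. *)

(* Defs.v *)
From HB Require Import structures.
From mathcomp Require Import all_boot all_order all_algebra.
From mathcomp Require Import complex.
From mathcomp Require Import all_classical all_reals all_analysis.

Set Implicit Arguments.
Unset Strict Implicit.
Unset Printing Implicit Defensive.

Import Order.TTheory GRing.Theory Num.Theory.
Import numFieldNormedType.Exports.

Local Open Scope classical_set_scope.
Local Open Scope ring_scope.
Local Open Scope complex_scope.

(* Complex numbers are R[i]; the alias R[i]^o carries the module structure over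
   R[i] and the usual topology.
   A function on R^3 minus the origin is represented by its extension by 0 at
   the origin, and a family over the complement of a set of parameters by its
   extension by 0 on that set, so that Leibniz equality is equality of the
   original objects. *)
Definition fn (R : realType) := 'cV[R]_3 -> R[i]^o.
Definition sect (R : realType) := R[i] -> fn R.

Section Functions.
Variable R : realType.
Local Notation C := R[i].
Implicit Types (f g : fn R) (x : 'cV[R]_3).

HB.instance Definition _ := GRing.Lmodule.on (fn R).
HB.instance Definition _ := GRing.Lmodule.on (sect R).

Definition cspan (E : lmodType C) (G : set E) : set E :=
  [set v | exists (n : nat) (c : 'I_n -> C) (g : 'I_n -> E),
     (forall i, G (g i)) /\ v = \sum_i c i *: g i].

(* The Euclidean norm; `|x| would be the sup norm. *)
Definition rad x : R := Num.sqrt (\sum_i x i 0 ^+ 2).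

Definition off0 (f : 'cV[R]_3 -> C) : fn R :=
  fun x => if x == 0 then 0 else f x.

(* Partial derivatives of complex-valued functions of real variables are taken
   componentwise. *)
Definition pd (i : 'I_3) f : fn R := fun x =>
  ('D_(delta_mx i 0) (fun y => complex.Re (f y)) x)
  +i* ('D_(delta_mx i 0) (fun y => complex.Im (f y)) x).

Definition pds (s : seq 'I_3) f : fn R := foldr pd f s.

Definition smooth_on (U : set 'cV[R]_3) f : Prop :=
  forall (s : seq 'I_3) x, U x ->
    differentiable (fun y => complex.Re (pds s f y)) x /\
    differentiable (fun y => complex.Im (pds s f y)) x.

(* C^oo(R^3_0) *)
Definition Cinf0 : set (fn R) :=
  [set f : fn R | f 0 = 0 /\ smooth_on [set x | x != 0] f].

(* u t --> l in C^oo(R^3_0) as t --> 0+ *)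
Definition cvg_Cinf0 (u : R -> fn R) (l : fn R) : Prop :=
  Cinf0 l /\
  forall (s : seq 'I_3) (Q : set 'cV[R]_3), compact Q -> ~ Q 0 ->
  forall e : R, 0 < e ->
    \forall t \near (0 : R)^'+,
      forall x, Q x -> `|pds s (u t) x - pds s l x| < e%:C.

Definition laplacian f : fn R := fun x => \sum_i pd i (pd i f) x.

Definition cint d (X : measurableType d) (mu : {measure set X -> \bar R}) (D : set X)
    (h : X -> C) : C :=
  (Rintegral mu D (fun t => complex.Re (h t)))
  +i* (Rintegral mu D (fun t => complex.Im (h t))).

End Functions.

Section Sobolev.
Variable R : realType.
Implicit Types (f g : fn R).

Local Notation leb := (@lebesgue_measure R).
Local Notation R3 := (measurableTypeR R * measurableTypeR R * measurableTypeR R)%type.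
Definition leb3 := ((leb \x leb) \x leb)%E.
Definition pt3 (t : R3) : 'cV[R]_3 :=
  \col_(i < 3) [:: t.1.1; t.1.2; t.2]`_i.

Definition L2 : set (fn R) :=
  [set f : fn R | [/\ measurable_fun [set: R3]
       (fun t => complex.Re (f (pt3 t)) : measurableTypeR R),
     measurable_fun [set: R3]
       (fun t => complex.Im (f (pt3 t)) : measurableTypeR R)
     & (\int[leb3]_t ((complex.Re (f (pt3 t))) ^+ 2 +
                      (complex.Im (f (pt3 t))) ^+ 2)%:E < +oo)%E]].

Definition int3 f : R[i] := cint leb3 setT (fun t => f (pt3 t)).

Definition test_function (phi : fn R) : Prop :=
  smooth_on setT phi /\
  exists2 Q : set 'cV[R]_3, compact Q & forall x, ~ Q x -> phi x = 0.

Definition weak_derivative (s : seq 'I_3) f g : Prop :=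
  forall phi, test_function phi ->
    int3 (fun x => f x * pds s phi x) =
    (-1) ^+ size s * int3 (fun x => g x * phi x).

(* The Sobolev space H^2(R^3), the domain of T. *)
Definition H2 : set (fn R) :=
  [set f : fn R | L2 f /\ forall s : seq 'I_3, (size s <= 2)%N ->
     exists2 g, L2 g & weak_derivative s f g].

End Sobolev.

Section Operators.
Variables (R : realType) (gamma : R).
Local Notation C := R[i].
Implicit Types (f g : fn R) (x : 'cV[R]_3).

Definition opT f : fn R := off0 (fun x =>
  - laplacian f x - (2 * gamma / rad x)%:C * f x).

(* Indices live in Z/3, so i, i + 1, i + 2 are in cyclic order. *)
Definition opL (i : 'I_3) f : fn R := off0 (fun x =>
  (x (i + 1) 0)%:C * pd (i + 2) f x - (x (i + 2) 0)%:C * pd (i + 1) f x).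

Definition opRL (i : 'I_3) f : fn R := off0 (fun x =>
  'i%C * (opL (i + 2) (pd (i + 1) f) x - opL (i + 1) (pd (i + 2) f) x
          - pd i f x + (gamma * x i 0 / rad x)%:C * f x)).

(* p(T) *)
Definition polyT (p : {poly C}) f : fn R :=
  \sum_(k < size p) p`_k *: iter k opT f.

(* The Lie algebra g, as a space of operators. *)
Definition gLie : set (fn R -> fn R) :=
  [set X | exists p q : 'I_3 -> {poly C},
     X = fun f => \sum_i (polyT (p i) (opL i f) + polyT (q i) (opRL i f))].

Definition O3 : set 'M[R]_3 := [set A | A *m A^T = 1%:M].

Definition kpt (A : 'M[R]_3) x : 'cV[R]_3 := (\det A)^-1 *: (A *m x).

Definition kact (A : 'M[R]_3) f : fn R := fun x => f (kpt (invmx A) x).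

Definition kconj (A : 'M[R]_3) (X : fn R -> fn R) : fn R -> fn R :=
  fun f => kact A (X (kact (invmx A) f)).

Definition kactS (A : 'M[R]_3) (V : sect R) : sect R := fun z => kact A (V z).

Definition gactS (X : fn R -> fn R) (V : sect R) : sect R := fun z => X (V z).

Definition Oscale (p : {poly C}) (V : sect R) : sect R :=
  fun z => p.[z] *: V z.

Definition Kfinite (E : lmodType C) (act : 'M[R]_3 -> E -> E) (v : E) : Prop :=
  exists (n : nat) (e : 'I_n -> E), forall A, O3 A ->
    exists c : 'I_n -> C, act A v = \sum_i c i *: e i.

Definition free_Omodule (M : set (sect R)) : Prop :=
  exists B : set (sect R),
    [/\ B `<=` M,
        forall V, M V -> exists (n : nat) (p : 'I_n -> {poly C})
          (b : 'I_n -> sect R),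
          (forall i, B (b i)) /\ V = \sum_i Oscale (p i) (b i)
      & forall (n : nat) (p : 'I_n -> {poly C}) (b : 'I_n -> sect R),
          injective b -> (forall i, B (b i)) ->
          \sum_i Oscale (p i) (b i) = 0 -> forall i, p i = 0].

(* A set of sections is an algebraic family of (g,K)-modules for the pointwise
   operations.  The bracket of g is the commutator of operators, so that its
   compatibility with the action holds by construction. *)
Record algebraic_family (M : set (sect R)) : Prop := AlgebraicFamily {
  family0 : M 0;
  familyD : forall V W, M V -> M W -> M (V + W);
  familyZ : forall p V, M V -> M (Oscale p V);
  family_free : free_Omodule M;
  familyK : forall A V, O3 A -> M V -> M (kactS A V);
  familyK_additive : forall A V W, O3 A -> M V -> M W ->
    kactS A (V + W) = kactS A V + kactS A W;
  familyK_linear : forall A p V, O3 A -> M V ->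
    kactS A (Oscale p V) = Oscale p (kactS A V);
  familyK_finite : forall V, M V -> @Kfinite (sect R) kactS V;
  familyg : forall X V, gLie X -> M V -> M (gactS X V);
  familyg_additive : forall X V W, gLie X -> M V -> M W ->
    gactS X (V + W) = gactS X V + gactS X W;
  familyg_linear : forall X p V, gLie X -> M V ->
    gactS X (Oscale p V) = Oscale p (gactS X V);
  familyg_Olinear : forall X p V, gLie X -> M V ->
    gactS (polyT p \o X) V = Oscale p (gactS X V);
  family_compatible : forall A X V, O3 A -> gLie X -> M V ->
    gactS (kconj A X) (kactS A V) = kactS A (gactS X V)
}.

Record family_morphism (M N : set (sect R)) (h : sect R -> sect R) : Prop :=
  FamilyMorphism {
  morphism_maps : forall V, M V -> N (h V);
  morphismD : forall V W, M V -> M W -> h (V + W) = h V + h W;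
  morphismZ : forall p V, M V -> h (Oscale p V) = Oscale p (h V);
  morphismK : forall A V, O3 A -> M V -> h (kactS A V) = kactS A (h V);
  morphismg : forall X V, gLie X -> M V -> h (gactS X V) = gactS X (h V)
}.

Definition Kfixed (M : set (sect R)) : set (sect R) :=
  [set V | M V /\ forall A, O3 A -> kactS A V = V].

End Operators.

Section Solutions.
Variables (R : realType) (gamma : R).
Local Notation C := R[i].
Implicit Types (f g : fn R) (x : 'cV[R]_3) (z : C).

(* Spec(T); in R[i], 0 <= z means that z is real and nonnegative. *)
Definition SpecT : set C :=
  [set z | exists2 n : nat, (0 < n)%N & z = (- (gamma ^+ 2 / n%:R ^+ 2))%:C]
  `|` [set z | 0 <= z].

Definition Sol z : set (fn R) :=
  [set f : fn R | [/\ Cinf0 f, @Kfinite R (fn R) (@kact R) f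
             & opT gamma f = z *: f]].

Definition rderiv (h : R -> C) (r : R) : C :=
  (derive1 (fun t => complex.Re (h t)) r) +i*
  (derive1 (fun t => complex.Im (h t)) r).

(* h extends to an entire function (an everywhere convergent power series) with
   leading term r^l, and solves the radial equation. *)
Definition is_radial (l : nat) z (h : R -> C) : Prop :=
  (exists a : nat -> C,
     [/\ forall k, (k < l)%N -> a k = 0, a l = 1,
         forall y : C, cvgn [series (a k * y ^+ k : C^o)]_k
       & forall r : R, h r = limn [series (a k * r%:C ^+ k : C^o)]_k]) /\
  forall r : R, 0 < r ->
    (r ^+ 2)%:C * rderiv (rderiv h) r + (2 * r)%:C * rderiv h r
    - (l * l.+1)%:R * h r + (2 * gamma * r)%:C * h r
    + z * (r ^+ 2)%:C * h r = 0.

(* F_{l,z}, the unique such solution *)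
Definition Frad (l : nat) z : R -> C^o := xget 0 [set h | is_radial l z h].

(* Homogeneous harmonic polynomials of degree l; their restrictions to the
   sphere are the spherical harmonics of degree l. *)
Definition harmonic_poly (l : nat) : set (fn R) :=
  [set P | (exists c : {ffun 'I_3 -> 'I_l.+1} -> C, forall x,
     P x = \sum_(m : {ffun 'I_3 -> 'I_l.+1} | (\sum_j m j == l)%N)
             c m * (\prod_j x j 0 ^+ m j)%:C)
   /\ forall x, laplacian P x = 0].

(* The function F_{l,z}(r) Y, with Y the restriction of P to the sphere. *)
Definition regfn (l : nat) z (P : fn R) : fn R :=
  off0 (fun x => Frad l z (rad x) * P ((rad x)^-1 *: x)).

(* F_z lies in the span RegSol(z) of the functions F_{l,z} Y for every z. *)
Definition Rfam : set (sect R) :=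
  cspan [set F : sect R | exists (p : {poly C}) (l : nat) (P : fn R),
    harmonic_poly l P /\ F = fun z => p.[z] *: regfn l z P].

Definition radial_derivative f : fn R :=
  fun x => \sum_i (x i 0 / rad x)%:C * pd i f x.

Definition sphere_pt (theta phi : R) : 'cV[R]_3 :=
  \col_(i < 3) [:: sin theta * cos phi; sin theta * sin phi; cos theta]`_i.

(* The sphere is parametrized by polar angle theta and azimuth phi, with
   dArea = sin theta dtheta dphi. *)
Definition Wr_at (r : R) f g : C :=
  ((4 * pi)^-1)%:C *
  cint lebesgue_measure `[0, pi] (fun theta =>
    cint lebesgue_measure `[0, 2 * pi] (fun phi =>
      let x := r *: sphere_pt theta phi in
      (r ^+ 2 * sin theta)%:C *
        (radial_derivative f x * g x - f x * radial_derivative g x))).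

(* On Sol z, Wr_at does not depend on r > 0. *)
Definition Wr f g : C := Wr_at 1 f g.

Definition cutoff (sigma : fn R) : Prop :=
  [/\ smooth_on setT sigma, \forall x \near (0 : 'cV[R]_3), sigma x = 0
    & exists2 Q : set 'cV[R]_3, compact Q & forall x, ~ Q x -> sigma x = 1].

Definition Sol_infty z : set (fn R) :=
  [set f : fn R | Sol z f /\
     exists2 sigma, cutoff sigma & H2 ((fun x => sigma x * f x) : fn R)].

Definition Kod : set (sect R) :=
  cspan [set V : sect R | [/\ forall z, SpecT z -> V z = 0,
     forall z, ~ SpecT z -> Sol_infty z (V z)
   & forall F, Rfam F -> exists p : {poly C},
       forall z, ~ SpecT z -> Wr (F z) (V z) = p.[z]]].

Definition Vplus (V : sect R) (lam : R) : fn R :=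
  fun x => lim (V (lam +i* eps) x @[eps --> (0 : R)^'+]).

Definition Vminus (V : sect R) (lam : R) : fn R :=
  fun x => lim (V (lam -i* eps) x @[eps --> (0 : R)^'+]).

(* w(lambda); V0 is the spherical family normalized against F_0 *)
Definition wronskian_factor (V0 : sect R) (lam : R) : C :=
  Wr (Vplus V0 lam) (Vminus V0 lam).

Definition is_jump (V0 V F : sect R) : Prop :=
  Rfam F /\ forall lam : R, 0 < lam ->
    F lam%:C = (wronskian_factor V0 lam)^-1 *: (Vplus V lam - Vminus V lam).

(* The map A : V |-> the unique F with is_jump V0 V F. *)
Definition jump_map (V0 V : sect R) : sect R :=
  xget (0 : sect R) [set F | is_jump V0 V F].

End Solutions.

(* Main.v *)
(* The boundary values V^+ and V^- are limits in C^oo, hence they commute with the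
   operators L_i and R_i; as g is generated by these over O, the jump is equivariant.

   A K-invariant function is radial, and two solutions of the radial equation have
   constant Wronskian, so a K-fixed V in the Kodaira family satisfies
   V_z = Wr(V_z, F_{0,z}) V_{0,z} - Wr(V_z, V_{0,z}) F_{0,z}, where q(z) = Wr(V_z, F_{0,z})
   is polynomial in z.  The difference V - q V_0 is a multiple of F_{0,z} for every z, so
   its Wronskian with every regular family vanishes; this survives truncation to a single
   parameter z_1, which yields an element killed by the polynomial z - z_1.  The Kodaira
   family being free over O, that element is 0, so V = q V_0.  On the regular side,
   averaging over spheres kills the harmonics of positive degree, so the K-fixed sections
   are the q F_0.

   Finally, F_{0,z}(1) and F_{0,z}'(1) are continuous in z (the Frobenius coefficients are
   Lipschitz in z with factorial decay), so the normalization of V_0 passes to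
   Wr(V_0^+, F_0) = 1.  If the jump of V_0 is p F_0, then V_0^- = V_0^+ - w p F_0 and
   w = Wr(V_0^+, V_0^-) = - w p, whence p = -1. *)
Require Import Defs.
From HB Require Import structures.
From mathcomp Require Import all_boot all_order all_algebra.
From mathcomp Require Import complex.
From mathcomp Require Import all_classical all_reals all_analysis.
From mathcomp Require Import measurable_realfun.
From mathcomp Require Import ring lra.
Set Implicit Arguments.
Unset Strict Implicit.
Unset Printing Implicit Defensive.
Import Order.TTheory GRing.Theory Num.Theory.
Import numFieldNormedType.Exports.
Local Open Scope classical_set_scope.
Local Open Scope ring_scope.
Local Open Scope complex_scope.
(* Unqualified, rad would be the radical of a form. *)
Local Notation rad := Defs.rad.

(** Off the spectrum a decaying radial solution is classically unique up to a factor because F_0 is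
    not square-integrable at infinity, a fact that rests on asymptotics of Whittaker functions.
    Truncation to one parameter avoids this: [Kod] asks for no regularity in the parameter beyond
    polynomial Wronskians, so a difference proportional to F_0 would produce torsion.

    The price is the Sobolev part. A member of [Kod] is only a combination of generators, and its
    value at a point can become the value of a new generator only if [Sol_infty] is closed under
    combinations. Two summands may come with different cutoffs, so H^2 has to be stable under
    multiplication by cutoffs.

    The sphere integral is defined through the polar angles, hence the averages of harmonic
    polynomials come from recursions between trigonometric moments. The Frobenius series is
    developed for l = 0; in other degrees the smoothness of [Frad] suffices. *)

Lemma cReD (R : realType) (x y : R[i]) : complex.Re (x + y) = complex.Re x + complex.Re y.
Proof. by case: x y => [a b] [c d]. Qed.

Lemma cImD (R : realType) (x y : R[i]) : complex.Im (x + y) = complex.Im x + complex.Im y.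
Proof. by case: x y => [a b] [c d]. Qed.

Lemma cReN (R : realType) (x : R[i]) : complex.Re (- x) = - complex.Re x.
Proof. by case: x. Qed.

Lemma cImN (R : realType) (x : R[i]) : complex.Im (- x) = - complex.Im x.
Proof. by case: x. Qed.

Lemma cReM (R : realType) (x y : R[i]) :
  complex.Re (x * y) = complex.Re x * complex.Re y - complex.Im x * complex.Im y.
Proof. by case: x y => [a b] [c d]. Qed.

Lemma cImM (R : realType) (x y : R[i]) :
  complex.Im (x * y) = complex.Re x * complex.Im y + complex.Im x * complex.Re y.
Proof. by case: x y => [a b] [c d]. Qed.

Lemma complex_eqP (R : realType) (x y : R[i]) :
  complex.Re x = complex.Re y -> complex.Im x = complex.Im y -> x = y.
Proof. by case: x y => [a b] [c d] /= -> ->. Qed.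

Definition ReIm (R : realType) := (@cReD R, @cImD R, @cReN R, @cImN R, @cReM R, @cImM R).

Lemma cRe_sum (R : realType) I (r : seq I) (P : pred I) (F : I -> R[i]) :
  complex.Re (\sum_(i <- r | P i) F i) = \sum_(i <- r | P i) complex.Re (F i).
Proof. exact: (big_morph _ (@cReD R) erefl). Qed.

Lemma cIm_sum (R : realType) I (r : seq I) (P : pred I) (F : I -> R[i]) :
  complex.Im (\sum_(i <- r | P i) F i) = \sum_(i <- r | P i) complex.Im (F i).
Proof. exact: (big_morph _ (@cImD R) erefl). Qed.

Lemma Re_le_norm (R : realType) (x : R[i]) : `|complex.Re x|%:C <= `|x|.
Proof. exact: normc_ge_Re. Qed.

Lemma Im_le_norm (R : realType) (x : R[i]) : `|complex.Im x|%:C <= `|x|.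
Proof.
case: x => a b; rewrite normc_def/= lecR -sqrtr_sqr ler_sqrt ?lerDr ?sqr_ge0//.
by rewrite addr_ge0// sqr_ge0.
Qed.

Lemma norm_le_ReIm (R : realType) (x : R[i]) :
  `|x| <= (`|complex.Re x| + `|complex.Im x|)%:C.
Proof.
rewrite {1}[x]complexE (le_trans (ler_normD _ _))// rmorphD/= lerD//.
  by rewrite normc_def/= expr0n/= addr0 sqrtr_sqr.
by rewrite normrM !normc_def/= !expr0n/= !addr0 add0r expr1n sqrtr1 mul1r sqrtr_sqr.
Qed.

(** Derivatives and integrals are defined componentwise, whereas convergence in [R[i]^o] refers to
    the complex norm; this equivalence lets every limit be computed in the components. *)
Lemma cvgC (R : realType) (T : Type) (F : set_system T) {FF : Filter F}
    (f : T -> R[i]^o) (l : R[i]) :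
  f @ F --> (l : R[i]^o) <->
  (complex.Re (f x) @[x --> F] --> complex.Re l) /\
  (complex.Im (f x) @[x --> F] --> complex.Im l).
Proof.
split.
  move/cvgrPdist_lt => h; split; apply/cvgrPdist_lt => e e0.
    have := h e%:C; rewrite ltcR => /(_ e0); apply: filterS => x xe.
    by rewrite -ltcR (le_lt_trans _ xe)// -cReN -cReD Re_le_norm.
  have := h e%:C; rewrite ltcR => /(_ e0); apply: filterS => x xe.
  by rewrite -ltcR (le_lt_trans _ xe)// -cImN -cImD Im_le_norm.
move=> [/cvgrPdist_lt h1 /cvgrPdist_lt h2]; apply/cvgrPdist_lt => -[e e'].
(* In [R[i]] the relation 0 < e forces the imaginary part of e to vanish, so only real radii
   occur. *)
rewrite ltcE/= => /andP[/eqP-> e0].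
have e20 : 0 < e / 2 by rewrite divr_gt0.
near=> x.
rewrite (le_lt_trans (norm_le_ReIm _))// ltcR cReD cImD cReN cImN [e]splitr ltrD//.
  by near: x; exact: h1.
by near: x; exact: h2.
Unshelve. all: by end_near. Qed.

Lemma cvgCD (R : realType) (T : Type) (F : set_system T) {FF : Filter F}
    (f g : T -> R[i]^o) (a b : R[i]^o) :
  f @ F --> a -> g @ F --> b -> (f x + g x : R[i]^o) @[x --> F] --> (a + b : R[i]^o).
Proof.
move=> /cvgC[fr fi] /cvgC[gr gi]; apply/cvgC; split.
  by rewrite cReD; under eq_fun do rewrite cReD; exact: cvgD.
by rewrite cImD; under eq_fun do rewrite cImD; exact: cvgD.
Qed.

Lemma cvgCM (R : realType) (T : Type) (F : set_system T) {FF : Filter F}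
    (f g : T -> R[i]^o) (a b : R[i]^o) :
  f @ F --> a -> g @ F --> b -> (f x * g x : R[i]^o) @[x --> F] --> (a * b : R[i]^o).
Proof.
move=> /cvgC[fr fi] /cvgC[gr gi]; apply/cvgC; split.
  have -> : (fun x => complex.Re (f x * g x : R[i]^o)) = fun x =>
    complex.Re (f x) * complex.Re (g x) - complex.Im (f x) * complex.Im (g x).
    by apply/funext => x; rewrite -cReM.
  have -> : complex.Re (a * b : R[i]^o) =
    complex.Re a * complex.Re b - complex.Im a * complex.Im b by rewrite -cReM.
  by apply: cvgB; exact: cvgM.
have -> : (fun x => complex.Im (f x * g x : R[i]^o)) = fun x =>
  complex.Re (f x) * complex.Im (g x) + complex.Im (f x) * complex.Re (g x).
  by apply/funext => x; rewrite -cImM.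
have -> : complex.Im (a * b : R[i]^o) =
  complex.Re a * complex.Im b + complex.Im a * complex.Re b by rewrite -cImM.
by apply: cvgD; exact: cvgM.
Qed.

Lemma cvgC_cst (R : realType) (T : Type) (F : set_system T) {FF : Filter F} (a : R[i]^o) :
  (fun=> a) @ F --> a.
Proof. exact: cvg_cst. Qed.

Lemma cvgCB (R : realType) (T : Type) (F : set_system T) {FF : Filter F}
    (f g : T -> R[i]^o) (a b : R[i]^o) :
  f @ F --> a -> g @ F --> b -> (f x - g x : R[i]^o) @[x --> F] --> (a - b : R[i]^o).
Proof.
move=> /cvgC[fr fi] /cvgC[gr gi]; apply/cvgC; split.
  rewrite cReD cReN; under eq_fun do rewrite cReD cReN; exact: cvgB.
rewrite cImD cImN; under eq_fun do rewrite cImD cImN; exact: cvgB.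
Qed.

Lemma cvg_seqC (R : realType) (f : nat -> R[i]^o) :
  cvgn f <-> cvgn (@complex.Re R \o f) /\ cvgn (@complex.Im R \o f).
Proof.
split.
  by move/cvgC => [h1 h2]; split; [apply: (cvgP _ h1)|apply: (cvgP _ h2)].
move=> [h1 h2]; apply: (cvgP ((limn (@complex.Re R \o f) +i* limn (@complex.Im R \o f)) : R[i]^o)).
by apply/cvgC; split.
Qed.

(** The differential of [f] also fits the first-order expansion of [g], because the two remainders
    agree near 0; uniqueness of the differential identifies it with that of [g]. *)
Lemma near_eq_differentiable (R : numFieldType) (V W : normedModType R)
    (f g : V -> W) (x : V) :
  (\forall y \near x, f y = g y) -> differentiable f x -> differentiable g x.
Proof.
move=> fg /diff_locallyP[dfc /eqaddoP fo].
have go : g \o shift x = cst (g x) + 'd f x +o_ (0 : V) id.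
  have fg0 : \forall h \near (0 : V), f (h + x) = g (h + x).
    by move: fg; rewrite (near_shift 0 x); apply: filterS => h; rewrite /= subr0.
  apply/eqaddoP => e e0; apply: filterS2 fg0 (fo _ e0) => h fgh.
  suff -> : (g \o shift x - (cst (g x) + 'd f x)) h =
            (f \o shift x - (cst (f x) + 'd f x)) h by [].
  by rewrite /GRing.add /= /GRing.opp /= fgh (nbhs_singleton fg).
have dgE := diff_unique dfc go.
by apply/diff_locallyP; rewrite dgE.
Qed.

Definition cdiff (R : realType) (f : fn R) x :=
  differentiable (fun y => complex.Re (f y)) x /\
  differentiable (fun y => complex.Im (f y)) x.

Lemma ReM_fun (R : realType) (f g : fn R) :
  (fun y => complex.Re (f y * g y)) =
  (fun y => complex.Re (f y) * complex.Re (g y) - complex.Im (f y) * complex.Im (g y)).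
Proof. by apply/funext => y; rewrite -cReM. Qed.

Lemma ImM_fun (R : realType) (f g : fn R) :
  (fun y => complex.Im (f y * g y)) =
  (fun y => complex.Re (f y) * complex.Im (g y) + complex.Im (f y) * complex.Re (g y)).
Proof. by apply/funext => y; rewrite -cImM. Qed.

(** * Componentwise differential calculus *)

Section PartialDerivatives.
Variable R : realType.
Implicit Types (f g : fn R) (x : 'cV[R]_3) (i : 'I_3) (s : seq 'I_3).

Lemma near_cdiff f g x : (\forall y \near x, f y = g y) -> cdiff f x -> cdiff g x.
Proof.
move=> fg [fr fi]; split; [move: fr|move: fi];
  by apply: near_eq_differentiable; apply: filterS fg => y ->.
Qed.

Lemma near_pd f g x i : (\forall y \near x, f y = g y) -> pd i f x = pd i g x.
Proof.
move=> fg; rewrite /pd; congr (_ +i* _); apply: near_eq_derive;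
  by apply: filterS fg => y ->.
Qed.

Lemma cdiff_cst (a : R[i]) x : cdiff (fun=> a) x.
Proof. by split; exact: differentiable_cst. Qed.

Lemma cdiffD f g x : cdiff f x -> cdiff g x -> cdiff (f + g) x.
Proof.
move=> [f1 f2] [g1 g2]; split.
  under eq_fun do rewrite fctE cReD; exact: differentiableD.
under eq_fun do rewrite fctE cImD; exact: differentiableD.
Qed.

Lemma cdiffM f g x : cdiff f x -> cdiff g x -> cdiff (fun y => f y * g y) x.
Proof.
move=> [f1 f2] [g1 g2]; split.
  rewrite /= ReM_fun.
  by apply: differentiableB; apply: differentiableM.
rewrite /= ImM_fun.
by apply: differentiableD; apply: differentiableM.
Qed.

Lemma cdiffZ (a : R[i]) f x : cdiff f x -> cdiff (a *: f) x.
Proof. exact/cdiffM/cdiff_cst. Qed.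

Lemma pd_cst (a : R[i]) i x : pd i (fun=> a) x = 0.
Proof. by rewrite /pd !derive_cst. Qed.

Lemma pdD f g i x : cdiff f x -> cdiff g x -> pd i (f + g) x = pd i f x + pd i g x.
Proof.
move=> [f1 f2] [g1 g2]; rewrite /pd.
have -> : (fun y => complex.Re ((f + g) y)) =
    (fun y => complex.Re (f y)) + (fun y => complex.Re (g y)).
  by apply/funext => y; exact: cReD.
have -> : (fun y => complex.Im ((f + g) y)) =
    (fun y => complex.Im (f y)) + (fun y => complex.Im (g y)).
  by apply/funext => y; exact: cImD.
have D h y : differentiable (h : 'cV[R]_3 -> R) y -> derivable h y (delta_mx i 0).
  exact: diff_derivable.
by rewrite (deriveD (D _ _ f1) (D _ _ g1)) (deriveD (D _ _ f2) (D _ _ g2)).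
Qed.

Lemma pdM f g i x : cdiff f x -> cdiff g x ->
  pd i (fun y => f y * g y) x = pd i f x * g x + f x * pd i g x.
Proof.
move=> [f1 f2] [g1 g2].
have D h y : differentiable (h : 'cV[R]_3 -> R) y -> derivable h y (delta_mx i 0).
  exact: diff_derivable.
have E1 (a b c d p q u v : R) : a * p + b * q - (c * u + d * v) =
  q * b - v * d + (a * p - c * u).
  by ring.
have E2 (a b c d p q u v : R) : a * p + b * q + (c * u + d * v) =
  q * b + v * d + (a * p + c * u).
  by ring.
apply: complex_eqP; rewrite /pd !ReIm/=.
  rewrite /= ReM_fun.
  rewrite deriveB; [|by apply: derivableM; exact: D|by apply: derivableM; exact: D].
  rewrite !deriveM; [|exact: D..].
  exact: E1.
rewrite /= ImM_fun.
rewrite deriveD; [|by apply: derivableM; exact: D|by apply: derivableM; exact: D].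
rewrite !deriveM; [|exact: D..].
exact: E2.
Qed.

Lemma pdZ (a : R[i]) f i x : cdiff f x -> pd i (a *: f) x = a * pd i f x.
Proof.
by move=> fx; rewrite (pdM _ (cdiff_cst a x) fx) pd_cst mul0r add0r.
Qed.

(** The identity is proved on an open set, since it must hold near a point before it can be
    differentiated once more. *)
Lemma pdsZD (U : set 'cV[R]_3) (a : R[i]) f g s x : open U ->
  smooth_on U f -> smooth_on U g -> U x ->
  pds s (a *: f + g) x = a * pds s f x + pds s g x.
Proof.
move=> oU Uf Ug; elim: s x => [//|i s ih] x Ux /=.
rewrite (@near_pd _ (a *: pds s f + pds s g)); last first.
  by apply: filterS (open_nbhs_nbhs (conj oU Ux)) => y /ih.
by rewrite pdD ?pdZ//; try apply: cdiffZ; [exact: Uf|exact: Uf|exact: Ug].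
Qed.

Lemma smooth_onZD (U : set 'cV[R]_3) (a : R[i]) f g : open U ->
  smooth_on U f -> smooth_on U g -> smooth_on U (a *: f + g).
Proof.
move=> oU Uf Ug s x Ux; apply: (@near_cdiff (a *: pds s f + pds s g)).
  apply: filterS (open_nbhs_nbhs (conj oU Ux)) => y Uy.
  by rewrite (pdsZD _ _ oU).
by apply: cdiffD; [apply: cdiffZ; exact: Uf|exact: Ug].
Qed.

Lemma open_neq0 : open [set x : 'cV[R]_3 | x != 0].
Proof.
have -> : [set x : 'cV[R]_3 | x != 0] = ~` [set 0].
  by apply/seteqP; split => x /=; [move/eqP|move/eqP].
apply: closed_openC; apply: accessible_closed_set1; apply: hausdorff_accessible.
exact: norm_hausdorff.
Qed.

Lemma Cinf0ZD (a : R[i]) f g : Cinf0 f -> Cinf0 g -> Cinf0 (a *: f + g).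
Proof.
move=> [f0 sf] [g0 sg]; split; last exact: smooth_onZD open_neq0 sf sg.
by rewrite !fctE f0 g0 scaler0 addr0.
Qed.

Lemma Cinf0_0 : @Cinf0 R 0.
Proof.
split=> // s x _.
have -> : pds s 0 = (fun=> 0) :> fn R.
  elim: s => [//|i s /= ->]; apply/funext => y; exact: pd_cst.
exact: cdiff_cst.
Qed.

Lemma cdiff_continuous f x : cdiff f x -> {for x, continuous f}.
Proof.
move=> [f1 f2]; apply/(@cvgC _ _ (nbhs x)); split.
  by have := @differentiable_continuous _ _ _ _ _ f1.
by have := @differentiable_continuous _ _ _ _ _ f2.
Qed.

Lemma smooth_pd (U : set 'cV[R]_3) f i : smooth_on U f -> smooth_on U (pd i f).
Proof.
move=> sf s x Ux; have := sf (rcons s i) x Ux.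
by rewrite /pds foldr_rcons.
Qed.

End PartialDerivatives.

(** Rounding the second variable down to a multiple of 1/(n+1) gives functions that converge to [f]
    pointwise by continuity. Applied to one coordinate at a time, this makes continuous functions of
    three variables measurable for the product sigma-algebra. *)
Lemma caratheodory_measurable d (T : measurableType d) (R : realType)
    (f : T -> R -> R) :
  (forall y, measurable_fun setT (f ^~ y)) ->
  (forall t, continuous (f t)) ->
  measurable_fun setT (fun p : T * measurableTypeR R => f p.1 p.2).
Proof.
move=> mf cf.
pose g n (y : R) : R := Rfloor (y * n.+1%:R) / n.+1%:R.
have gl n y : g n y <= y.
  by rewrite ler_pdivrMr ?ltr0n// Rfloor_le.
have gu n y : y < g n y + n.+1%:R^-1.
  by rewrite /g -[X in _ + X]mul1r -mulrDl ltr_pdivlMr ?ltr0n// lt_succ_Rfloor.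
have mg n : measurable_fun setT (g n : measurableTypeR R -> measurableTypeR R).
  apply: nondecreasing_measurable => // x y xy.
  by rewrite ler_pM2r ?invr_gt0 ?ltr0n// le_Rfloor// ler_wpM2r.
have cg y : g ^~ y @ \oo --> y.
  apply: (@squeeze_cvgr _ _ _ _ (fun n => y - n.+1%:R^-1) (cst y)).
  - by near=> n; rewrite gl lerBlDr ltW.
  - rewrite -[X in _ --> X]subr0; apply: cvgB; first exact: cvg_cst.
    exact: cvg_harmonic.
  - exact: cvg_cst.
apply: (@measurable_fun_cvg _ _ _ _ (fun n p => f p.1 (g n p.2))); last first.
  move=> [t y] _ /=; apply: (@cvg_comp _ _ _ (g ^~ y) (f t)); first exact: cg.
  exact: cf.
(* The rounded variable takes rational values only, so the preimage is a countable union of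
   rectangles. *)
move=> n _ /= Y mY; rewrite setTI.
have -> : (fun p : T * measurableTypeR R => f p.1 (g n p.2)) @^-1` Y =
   \bigcup_(q : rat) ((f ^~ (ratr q) @^-1` Y) `*` (g n @^-1` [set ratr q])).
  apply/seteqP; split => [[t y] /= Yf|[t y] [q _ [/= Yf gq]]]; last first.
    by rewrite /= gq.
  have /RintP[z zE] := isint_Rfloor (y * n.+1%:R).
  have E : ratr (z%:~R / n.+1%:R) = g n y.
    by rewrite (rmorphM (@ratr R)) (fmorphV (@ratr R)) /= ratr_int ratr_nat /g zE.
  by exists (z%:~R / n.+1%:R) => //=; rewrite E; split.
apply: bigcupT_measurable_rat => q; apply: measurableX.
  by rewrite -[X in measurable X]setTI; exact: mf.
by rewrite -[X in measurable X]setTI; exact: mg.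
Unshelve. all: by end_near. Qed.

(** * Sobolev space and solutions square-integrable at infinity *)

Section MeasurabilityR3.
Variable R : realType.
Local Notation R1 := (measurableTypeR R).
Local Notation R3 := (measurableTypeR R * measurableTypeR R * measurableTypeR R)%type.

Definition vec3 (a b c : R) : 'cV[R]_3 :=
  a *: delta_mx 0 0 + b *: delta_mx 1 0 + c *: delta_mx (1 + 1) 0.

Lemma pt3E (t : R3) : pt3 t = vec3 t.1.1 t.1.2 t.2.
Proof.
apply/matrixP => i j; rewrite !mxE (ord1 j).
by case: i => [[|[|[|//]]] ilt] /=; rewrite ?eqxx ?andbT ?mulr1 ?mulr0 ?addr0 ?add0r.
Qed.

Lemma continuous_pt3_measurable (f : 'cV[R]_3 -> R) : continuous f ->
  measurable_fun setT (fun t : R3 => f (pt3 t)).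
Proof.
move=> cf.
have cZ (v : 'cV[R]_3) : continuous (fun a : R => a *: v).
  by move=> a; apply: cvgZr_tmp; exact: cvg_id.
rewrite (_ : (fun t => _) = fun t : R3 => (fun p c => f (vec3 p.1 p.2 c)) t.1 t.2).
  apply: (@caratheodory_measurable _ (R1 * R1)%type R
     (fun p c => f (vec3 p.1 p.2 c))).
    move=> c; apply: (@caratheodory_measurable _ R1 R
     (fun a b => f (vec3 a b c))).
      move=> b; apply: continuous_measurable_fun => a.
      apply: (@cvg_comp _ _ _ (fun a => vec3 a b c) f); last exact: cf.
      by rewrite /vec3; do 2 (apply: cvgD; last exact: cvg_cst); exact: cZ.
    move=> a b; apply: (@cvg_comp _ _ _ (fun b => vec3 a b c) f); last exact: cf.
    rewrite /vec3; apply: cvgD; last exact: cvg_cst.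
    by apply: cvgD; [exact: cvg_cst|exact: cZ].
  move=> p c; apply: (@cvg_comp _ _ _ (fun c => vec3 p.1 p.2 c) f); last exact: cf.
  by rewrite /vec3; apply: cvgD; [exact: cvg_cst|exact: cZ].
by apply/funext => t; rewrite pt3E.
Qed.

End MeasurabilityR3.

(** * Smooth functions, test functions and multipliers *)

Section TestFunctions.
Variable R : realType.
Implicit Types (f g : fn R) (x : 'cV[R]_3) (i : 'I_3) (s : seq 'I_3).

(** Smoothness graded by the order of differentiation: the product rule trades one derivative of a
    product for products of lower order, which calls for an induction on [n] with both factors
    varying. *)
Fixpoint smooth_upto n f : Prop :=
  (forall x, cdiff f x) /\
  if n is m.+1 then forall i, smooth_upto m (pd i f) else True.

Lemma smooth_uptoP f : smooth_on setT f <-> forall n, smooth_upto n f.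
Proof.
split.
  move=> sf n; elim: n f sf => [|n ih] f sf.
    by split => // x; exact: sf [::] x I.
  split => [x|i]; first exact: sf [::] x I.
  exact/ih/smooth_pd.
move=> sf s x _; have := sf (size s); elim/last_ind: s f x {sf} => [|s i ih] f x.
  by case=> h _; exact: h.
by rewrite size_rcons => -[_ /(_ i)] /ih; rewrite /pds foldr_rcons.
Qed.

Lemma smooth_uptoW n f : smooth_upto n.+1 f -> smooth_upto n f.
Proof.
by elim: n f => [|n ih] f [? h]; split=> // i; exact: ih.
Qed.

Lemma smooth_uptoD n f g : smooth_upto n f -> smooth_upto n g -> smooth_upto n (f + g).
Proof.
elim: n f g => [|n ih] f g [df hf] [dg hg]; first by
  split=> // x; exact: cdiffD.
split => [x|i]; first exact: cdiffD.
have -> : pd i (f + g) = pd i f + pd i g by apply/funext => x; exact: pdD.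
exact: ih (hf i) (hg i).
Qed.

Lemma smooth_uptoM n f g : smooth_upto n f -> smooth_upto n g ->
  smooth_upto n (fun x => f x * g x).
Proof.
elim: n f g => [|n ih] f g sf sg; have [df hf] := sf; have [dg hg] := sg.
  by split=> // x; exact: cdiffM.
split=> [x|i]; first exact: cdiffM.
have -> : pd i (fun x => f x * g x) = (fun x => pd i f x * g x) + (fun x => f x * pd i g x).
  by apply/funext => x; exact: pdM.
apply: smooth_uptoD; apply: ih => //; try exact: smooth_uptoW.
  exact: hf.
exact: hg.
Qed.

Lemma smoothM f g : smooth_on setT f -> smooth_on setT g ->
  smooth_on setT (fun x => f x * g x).
Proof.
by move=> /smooth_uptoP sf /smooth_uptoP sg; apply/smooth_uptoP => n; exact: smooth_uptoM.
Qed.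

Lemma smooth_cst (a : R[i]) : smooth_on setT ((fun=> a) : fn R).
Proof.
have h b s : pds s (fun=> b) = fun=> (if s is [::] then b else 0) :> R[i]^o.
  case/lastP: s => [//|s i].
  rewrite /pds foldr_rcons; have -> : pd i (fun=> b) = fun=> 0 :> R[i]^o.
    by apply/funext => y; exact: pd_cst.
  have -> : (if rcons s i is [::] then b else 0) = 0 by case: s.
  by elim: s => [//|j s /= ->]; apply/funext => y; exact: pd_cst.
by move=> s x _; rewrite h; exact: cdiff_cst.
Qed.

Lemma smooth_cdiff f x : smooth_on setT f -> cdiff f x.
Proof. by move=> sf; exact: sf [::] x I. Qed.

Lemma pd_smoothM f g i : smooth_on setT f -> smooth_on setT g ->
  pd i (fun x => f x * g x) = (fun x => pd i f x * g x + f x * pd i g x).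
Proof. by move=> sf sg; apply/funext => x; apply: pdM; exact: smooth_cdiff. Qed.

Lemma pd_supp f (a : R[i]) (Q : set 'cV[R]_3) i : compact Q ->
  (forall x, ~ Q x -> f x = a) -> forall x, ~ Q x -> pd i f x = 0.
Proof.
move=> cQ fQ x Qx; rewrite (@near_pd _ _ (fun=> a)) ?pd_cst//.
have oQ : open (~` Q) by apply: closed_openC; apply: compact_closed cQ; exact: norm_hausdorff.
by apply: filterS (open_nbhs_nbhs (conj oQ Qx)) => y /fQ.
Qed.

Lemma test_pd f i : test_function f -> test_function (pd i f).
Proof.
move=> [sf [Q cQ fQ]]; split; first exact: smooth_pd.
by exists Q => //; exact: pd_supp cQ fQ.
Qed.

Lemma test_pds f s : test_function f -> test_function (pds s f).
Proof. by move=> tf; elim: s => [//|i s ih]; exact: test_pd. Qed.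

Lemma testM f g : smooth_on setT f -> test_function g ->
  test_function (fun x => f x * g x).
Proof.
move=> sf [sg [Q cQ gQ]]; split; first exact: smoothM.
by exists Q => // x /gQ ->; rewrite mulr0.
Qed.

Lemma compact_sup (Q : set 'cV[R]_3) (h : 'cV[R]_3 -> R) : compact Q ->
  continuous h -> exists M, forall x, Q x -> `|h x| <= M.
Proof.
move=> cQ ch; have [Q0|/set0P/negP/negPn/eqP->] := pselect (Q !=set0); last first.
  by exists 0.
have [|c _ hc] := @compact_EVT_max _ R (fun x => `|h x|) Q Q0 cQ.
  apply: continuous_subspaceT => x.
  by apply: (@cvg_comp _ _ _ h Num.norm); [exact: ch|exact: norm_continuous].
by exists `|h c| => x Qx; apply: hc; rewrite inE.
Qed.

Definition cbounded f := exists M : R, forall x,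
  `|complex.Re (f x)| <= M /\ `|complex.Im (f x)| <= M.

Lemma Re_continuous f : smooth_on setT f -> continuous (fun x => complex.Re (f x)).
Proof.
by move=> sf x; have := @differentiable_continuous _ _ _ _ _ (smooth_cdiff x sf).1.
Qed.

Lemma Im_continuous f : smooth_on setT f -> continuous (fun x => complex.Im (f x)).
Proof.
by move=> sf x; have := @differentiable_continuous _ _ _ _ _ (smooth_cdiff x sf).2.
Qed.

Lemma smooth_bounded f (a : R[i]) (Q : set 'cV[R]_3) : smooth_on setT f ->
  compact Q -> (forall x, ~ Q x -> f x = a) -> cbounded f.
Proof.
move=> sf cQ fQ.
have [M1 h1] := compact_sup cQ (Re_continuous sf).
have [M2 h2] := compact_sup cQ (Im_continuous sf).
exists (`|M1| + `|M2| + `|complex.Re a| + `|complex.Im a|) => x.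
have A (u v w z : R) : u <= `|u| + `|v| + `|w| + `|z|.
  by rewrite (le_trans (ler_norm u))// -!addrA lerDl !addr_ge0.
have [Qx|/fQ ->] := pselect (Q x); last first.
  have := normr_ge0 M1; have := normr_ge0 M2; have := normr_ge0 (complex.Re a).
  by have := normr_ge0 (complex.Im a); move=> ? ? ? ?; split; lra.
have := normr_ge0 M1; have := normr_ge0 M2; have := normr_ge0 (complex.Re a).
have := normr_ge0 (complex.Im a); have := h1 _ Qx; have := h2 _ Qx.
by have := ler_norm M1; have := ler_norm M2; move=> ? ? ? ? ? ? ? ?; split; lra.
Qed.

(** The multipliers that preserve L^2 and H^2. Cutoffs belong to this class, being constant outside
    a compact set, and so do constants. *)
Definition tame f := smooth_on setT f /\ forall s, cbounded (pds s f).

Lemma tame_pd f i : tame f -> tame (pd i f).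
Proof.
move=> [sf bf]; split; first exact: smooth_pd.
by move=> s; have := bf (rcons s i); rewrite /pds foldr_rcons.
Qed.

Lemma tame_cutoff f (a : R[i]) (Q : set 'cV[R]_3) : smooth_on setT f ->
  compact Q -> (forall x, ~ Q x -> f x = a) -> tame f.
Proof.
move=> sf cQ fQ; split => // s.
suff [b fb] : exists b : R[i], forall x, ~ Q x -> pds s f x = b.
  apply: smooth_bounded cQ fb; elim: s {fQ} => [//|i s ih]; exact: smooth_pd.
case: s => [|i s]; first by exists a.
exists 0; elim: s i => [|j s ih] i; first exact: pd_supp cQ fQ.
exact: pd_supp cQ (ih j).
Qed.

Lemma tame_cst (a : R[i]) : tame (fun=> a).
Proof.
apply: (@tame_cutoff _ a set0) => //; first exact: smooth_cst.
exact: compact0.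
Qed.

End TestFunctions.

(** * Square-integrable real functions *)

Section SquareIntegrable.
Context d (T : measurableType d) (R : realType) (mu : {measure set T -> \bar R}).
Implicit Types f g : T -> R.

Definition sqi f := measurable_fun setT f /\
  mu.-integrable setT (EFin \o (fun t => f t ^+ 2)).

Lemma integrable_funD (D : set T) f g : measurable D ->
  mu.-integrable D (EFin \o f) -> mu.-integrable D (EFin \o g) ->
  mu.-integrable D (EFin \o (fun t => f t + g t)).
Proof. by move=> mD fi gi; exact: eq_integrable (integrableD mD fi gi). Qed.

Lemma integrable_funB (D : set T) f g : measurable D ->
  mu.-integrable D (EFin \o f) -> mu.-integrable D (EFin \o g) ->
  mu.-integrable D (EFin \o (fun t => f t - g t)).
Proof. by move=> mD fi gi; exact: eq_integrable (integrableB mD fi gi). Qed.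

(** Since (f + g)^2 and (f - g)^2 are nonnegative, f^2 + g^2 dominates |f g|. *)
Lemma sqi_integrableM f g : sqi f -> sqi g ->
  mu.-integrable setT (EFin \o (fun t => f t * g t)).
Proof.
move=> [mf f2] [mg g2].
apply: (le_integrable measurableT _ _ (integrableD measurableT f2 g2)).
  by apply/measurable_EFinP; exact: measurable_funM.
move=> t _ /=; rewrite lee_fin [leRHS]ger0_norm ?addr_ge0 ?sqr_ge0//.
rewrite ler_norml; have := sqr_ge0 (f t + g t); have := sqr_ge0 (f t - g t).
have := sqr_ge0 (f t); have := sqr_ge0 (g t).
by move=> *; apply/andP; split; nra.
Qed.

Lemma sqiD f g : sqi f -> sqi g -> sqi (fun t => f t + g t).
Proof.
move=> sf sg; have [mf f2] := sf; have [mg g2] := sg.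
split; first exact: measurable_funD.
have -> : EFin \o (fun t => (f t + g t) ^+ 2) =
    ((EFin \o (fun t => f t ^+ 2)) \+ (EFin \o (fun t => f t * g t))) \+
    ((EFin \o (fun t => g t ^+ 2)) \+ (EFin \o (fun t => f t * g t))).
  by apply/funext => t /=; rewrite -!EFinD; congr EFin; ring.
by do 2 (apply: integrableD => //); exact: sqi_integrableM.
Qed.

Lemma sqiM_bounded f g (M : R) : measurable_fun setT f -> (forall t, `|f t| <= M) ->
  sqi g -> sqi (fun t => f t * g t).
Proof.
move=> mf fM [mg g2]; split; first exact: measurable_funM.
have := integrableZl measurableT (M ^+ 2) g2; apply: le_integrable => //.
  by apply/measurable_EFinP; apply: measurable_funX; exact: measurable_funM.
move=> t _ /=; rewrite lee_fin -exprMn !normrX lerXn2r ?nnegrE// !normrM.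
by rewrite ler_wpM2r// (le_trans (fM t))// ler_norm.
Qed.

Lemma sqiN f : sqi f -> sqi (fun t => - f t).
Proof.
move=> sf; have -> : (fun t => - f t) = (fun t => (cst (-1) t) * f t).
  by apply/funext => t; rewrite mulN1r.
by apply: (@sqiM_bounded _ _ `|-1|) => //; exact: measurable_cst.
Qed.

Lemma sqi_supp f (B : set T) (M : R) : measurable B -> (mu B < +oo)%E ->
  measurable_fun setT f -> (forall t, `|f t| <= M) -> (forall t, ~ B t -> f t = 0) ->
  sqi f.
Proof.
move=> mB muB mf fM fB; split => //.
have M0 : mu.-integrable setT (EFin \o \1_B).
  apply/integrableP; split; first by apply/measurable_EFinP; exact: measurable_indic.
  rewrite (eq_integral (fun x => (\1_B x)%:E)); last first.
    by move=> t _; rewrite /= ger0_norm.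
  by rewrite integral_indic// setIT.
have := integrableZl measurableT (M ^+ 2) M0; apply: le_integrable => //.
  by apply/measurable_EFinP; exact: measurable_funX.
move=> t _ /=; rewrite lee_fin indicE.
have [/set_mem Bt|/negP nB] := boolP (t \in B); last first.
  by rewrite fB ?expr0n/= ?mulr0 ?normr0// => Bt; apply: nB; rewrite inE.
by rewrite mulr1 !normrX lerXn2r ?nnegrE// (le_trans (fM t))// ler_norm.
Qed.

End SquareIntegrable.

Section Pairing.
Variable R : realType.
Implicit Types (f g u : fn R).
Local Notation R3 := (measurableTypeR R * measurableTypeR R * measurableTypeR R)%type.
Local Notation mu3 := (@leb3 R : {measure set R3 -> \bar R}).
Local Notation sq3 := (@sqi _ R3 R mu3).

Lemma L2E f : L2 f <-> sq3 (fun t => complex.Re (f (pt3 t))) /\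
   sq3 (fun t => complex.Im (f (pt3 t))).
Proof.
split.
  move=> [mr mi fin].
  have m2 : measurable_fun setT (fun t : R3 => (complex.Re (f (pt3 t))) ^+ 2 +
                      (complex.Im (f (pt3 t))) ^+ 2).
    by apply: measurable_funD; exact: measurable_funX.
  have h : (mu3).-integrable setT (EFin \o (fun t : R3 => (complex.Re (f (pt3 t))) ^+ 2 +
                      (complex.Im (f (pt3 t))) ^+ 2)).
    apply/integrableP; split; first exact/measurable_EFinP.
    under eq_integral => t _ do
      rewrite /= ger0_norm ?addr_ge0 ?sqr_ge0//.
    exact: fin.
  split; split => //; move: h; apply: le_integrable => //;
    try (by apply/measurable_EFinP; exact: measurable_funX);
    move=> t _ /=; rewrite lee_fin !ger0_norm ?addr_ge0 ?sqr_ge0//.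
    by rewrite lerDl sqr_ge0.
  by rewrite lerDr sqr_ge0.
move=> [[mr r2] [mi i2]]; split => //.
exact: integrable_lty (integrableD measurableT r2 i2).
Qed.

Lemma L2D f g : L2 f -> L2 g -> L2 (f + g).
Proof.
move=> /L2E[fr fi] /L2E[gr gi]; apply/L2E; split.
  under eq_fun do rewrite fctE cReD; exact: sqiD.
under eq_fun do rewrite fctE cImD; exact: sqiD.
Qed.

Lemma ReM_pt (f g : fn R) : (fun t : R3 => complex.Re (f (pt3 t) * g (pt3 t))) =
  (fun t => complex.Re (f (pt3 t)) * complex.Re (g (pt3 t)) +
     - (complex.Im (f (pt3 t)) * complex.Im (g (pt3 t)))).
Proof. by apply/funext => t; rewrite -cReM. Qed.

Lemma ImM_pt (f g : fn R) : (fun t : R3 => complex.Im (f (pt3 t) * g (pt3 t))) =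
  (fun t => complex.Re (f (pt3 t)) * complex.Im (g (pt3 t)) +
     complex.Im (f (pt3 t)) * complex.Re (g (pt3 t))).
Proof. by apply/funext => t; rewrite -cImM. Qed.

Lemma L2M f g : smooth_on setT f -> cbounded f -> L2 g -> L2 (fun x => f x * g x).
Proof.
move=> sf [M fM] /L2E[gr gi].
have mr := continuous_pt3_measurable (Re_continuous sf).
have mi := continuous_pt3_measurable (Im_continuous sf).
have br (t : R3) := (fM (pt3 t)).1.
have bi (t : R3) := (fM (pt3 t)).2.
apply/L2E; split; [rewrite ReM_pt|rewrite ImM_pt]; apply: sqiD; try apply: sqiN;
  (exact: sqiM_bounded mr br _ || exact: sqiM_bounded mi bi _).
Qed.

(** The function is bounded, and its support lies in a box of finite volume whose sides come from
    the bounds of the three coordinates on the compact set. *)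
Lemma L2_test f : test_function f -> L2 f.
Proof.
move=> [sf [Q cQ fQ]].
have mr := continuous_pt3_measurable (Re_continuous sf).
have mi := continuous_pt3_measurable (Im_continuous sf).
have [M fM] := smooth_bounded sf cQ fQ.
have ccoord (i : 'I_3) : continuous (fun x : 'cV[R]_3 => x i 0).
  by move=> x; have := @differentiable_continuous _ _ _ _ _ (@differentiable_coord R 3 1 x i 0).
have [K0 hK0] := compact_sup cQ (ccoord 0).
have [K1 hK1] := compact_sup cQ (ccoord 1).
have [K2 hK2] := compact_sup cQ (ccoord (1 + 1)).
pose I K : set (measurableTypeR R) := `[- K, K]%classic.
pose B : set R3 := (I K0 `*` I K1) `*` I K2.
have mI K : measurable (I K) by exact: measurable_itv.
have fI K : (lebesgue_measure (I K) < +oo)%E.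
  by rewrite /I lebesgue_measure_itv/=; case: ifP => _; rewrite ?ltry// -EFinB ltry.
have mB : measurable B by apply: measurableX => //; exact: measurableX.
have muB : (mu3 B < +oo)%E.
  have -> : mu3 B = (lebesgue_measure (I K0) * lebesgue_measure (I K1) *
      lebesgue_measure (I K2))%E.
    have h := @product_measure1E _ _ _ _ R
      (@lebesgue_measure R \x @lebesgue_measure R)%E (@lebesgue_measure R)
      (I K0 `*` I K1) (I K2) (measurableX (mI K0) (mI K1)) (mI K2).
    apply: etrans h _; congr (_ * _)%E.
    exact: product_measure1E.
  by rewrite -ge0_fin_numE ?mule_ge0// !fin_numM// ge0_fin_numE.
have fB (t : R3) : ~ B t -> f (pt3 t) = 0.
  move=> nB; apply: fQ => Qt; apply: nB; rewrite /B /I /=.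
  have := hK0 _ Qt; have := hK1 _ Qt; have := hK2 _ Qt.
  by rewrite !mxE/= !ler_norml !in_itv/=.
apply/L2E; split.
  apply: (@sqi_supp _ _ _ _ _ B M) => // t; first exact: (fM _).1.
  by move=> /fB ->.
apply: (@sqi_supp _ _ _ _ _ B M) => // t; first exact: (fM _).2.
by move=> /fB ->.
Qed.

(** Bilinear, without complex conjugation, to match the integrals in [weak_derivative]. *)
Definition pair3 f g : R[i] := int3 (fun x => f x * g x).

Lemma pair3D f g h : L2 f -> L2 g -> L2 h ->
  pair3 f (g + h) = pair3 f g + pair3 f h.
Proof.
move=> /L2E[fr fi] /L2E[gr gi] /L2E[hr hi].
rewrite /pair3 /int3 /cint.
have A1 := sqi_integrableM fr gr. have A2 := sqi_integrableM fi gi.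
have A3 := sqi_integrableM fr hr. have A4 := sqi_integrableM fi hi.
have A5 := sqi_integrableM fr gi. have A6 := sqi_integrableM fi gr.
have A7 := sqi_integrableM fr hi. have A8 := sqi_integrableM fi hr.
rewrite !ReM_pt !ImM_pt.
apply: complex_eqP => /=.
  rewrite -RintegralD//=.
  - apply: eq_Rintegral => t _; rewrite fctE cReD cImD; ring.
  - exact: integrable_funB measurableT A1 A2.
  - exact: integrable_funB measurableT A3 A4.
rewrite -RintegralD//=.
- apply: eq_Rintegral => t _; rewrite fctE cReD cImD; ring.
- exact: integrable_funD measurableT A5 A6.
- exact: integrable_funD measurableT A7 A8.
Qed.

End Pairing.

(** * Weak derivatives of products *)

Section SobolevAlgebra.
Variable R : realType.
Implicit Types (f g u tau phi : fn R).

Lemma pair3C f g : pair3 f g = pair3 g f.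
Proof. by congr int3; apply/funext => x; rewrite mulrC. Qed.

Lemma pair3A tau u f :
  pair3 (fun x => tau x * u x) f = pair3 u (fun x => tau x * f x).
Proof. by congr int3; apply/funext => x; rewrite mulrCA mulrA. Qed.

Lemma weak_derivativeP s u v : weak_derivative s u v <->
  forall phi, test_function phi -> pair3 u (pds s phi) = (-1) ^+ size s * pair3 v phi.
Proof. by []. Qed.

Lemma weak_derivative1P i u ui : weak_derivative [:: i] u ui <->
  forall phi, test_function phi -> pair3 u (pd i phi) = - pair3 ui phi.
Proof.
by split=> h phi tphi; have := h phi tphi; rewrite -[(-1) ^+ _]/(-1 : R[i]) mulN1r.
Qed.

Lemma weak_derivative2P i j u uij : weak_derivative [:: i; j] u uij <->
  forall phi, test_function phi -> pair3 u (pd i (pd j phi)) = pair3 uij phi.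
Proof.
have E : (-1) ^+ size [:: i; j] = 1 :> R[i] by rewrite -signr_odd.
by split=> h phi tphi; have := h phi tphi; rewrite E mul1r.
Qed.

Local Opaque pair3.

Lemma pair3_D f g h : L2 f -> L2 g -> L2 h ->
  pair3 (f + g) h = pair3 f h + pair3 g h.
Proof. by move=> Lf Lg Lh; rewrite pair3C pair3D// pair3C [pair3 h g]pair3C. Qed.

Lemma L2_0 : @L2 R 0.
Proof.
apply: L2_test; split; first exact: smooth_cst.
by exists set0; first exact: compact0.
Qed.

Lemma pair30 f : L2 f -> pair3 f 0 = 0.
Proof.
move=> Lf; have := pair3D Lf L2_0 L2_0; rewrite addr0 => /eqP.
by rewrite -subr_eq subrr => /eqP.
Qed.

Lemma L2N f : L2 f -> L2 (- f).
Proof.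
move=> Lf; have -> : - f = (fun x => (-1) * f x).
  by apply/funext => x; rewrite mulN1r.
have [s b] := tame_cst (-1 : R[i]); exact: L2M s (b [::]) Lf.
Qed.

Lemma pair3N f g : L2 f -> L2 g -> pair3 f (- g) = - pair3 f g.
Proof.
move=> Lf Lg; have := pair3D Lf Lg (L2N Lg); rewrite subrr pair30// => /esym/eqP.
by rewrite addrC addr_eq0 => /eqP.
Qed.

Lemma L2_tameM tau f : tame tau -> L2 f -> L2 (fun x => tau x * f x).
Proof. by move=> [st bt]; exact: L2M st (bt [::]). Qed.

Lemma H2D f g : H2 f -> H2 g -> H2 (f + g).
Proof.
move=> [Lf wf] [Lg wg]; split; first exact: L2D.
move=> s ss; have [f' Lf' /weak_derivativeP wf'] := wf s ss; have [g' Lg' /weak_derivativeP wg'] := wg s ss.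
exists (f' + g'); first exact: L2D.
apply/weak_derivativeP => phi tphi; have Lphi := L2_test tphi.
have Ls := L2_test (test_pds s tphi).
by rewrite (pair3_D Lf Lg Ls) (pair3_D Lf' Lg' Lphi) wf'// wg'// mulrDr.
Qed.

Lemma seq_le2 T (s : seq T) : (size s <= 2)%N ->
  [\/ s = [::], exists i, s = [:: i] | exists i j, s = [:: i; j]].
Proof.
case: s => [|i [|j [|//]]] _; first by constructor 1.
  by constructor 2; exists i.
by constructor 3; exists i, j.
Qed.

Lemma pair3_4 u a b c e : L2 u -> L2 a -> L2 b -> L2 c -> L2 e ->
  pair3 u ((a - b) + (- c + e)) = pair3 u a - pair3 u b - pair3 u c + pair3 u e.
Proof.
move=> Lu La Lb Lc Le; have Lb' := L2N Lb; have Lc' := L2N Lc.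
rewrite (pair3D Lu (L2D La Lb') (L2D Lc' Le)) (pair3D Lu La Lb') (pair3D Lu Lc' Le).
by rewrite (pair3N Lu Lb) (pair3N Lu Lc) !addrA.
Qed.

Lemma pair3_D4 u a b c e : L2 u -> L2 a -> L2 b -> L2 c -> L2 e ->
  pair3 ((a + b) + (c + e)) u = pair3 a u + pair3 b u + (pair3 c u + pair3 e u).
Proof.
move=> Lu La Lb Lc Le; by rewrite (pair3_D (L2D La Lb) (L2D Lc Le) Lu) (pair3_D La Lb Lu) (pair3_D Lc Le Lu).
Qed.

Lemma pd_smoothD f g k : smooth_on setT f -> smooth_on setT g ->
  pd k (f + g) = pd k f + pd k g.
Proof. by move=> sf sg; apply/funext => x; apply: pdD; exact: smooth_cdiff. Qed.

(** In each term on the right the derivatives act on a whole product of [phi] with [tau] or one of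
    its derivatives, hence on a test function when [phi] is one; this is the form to which the weak
    derivatives of [u] apply in [H2_tameM]. The order in [pd j (pd i tau)] is chosen so that no two
    partial derivatives have to be exchanged. *)
Lemma leibniz2 tau phi i j : smooth_on setT tau -> smooth_on setT phi ->
  (fun x => tau x * pd i (pd j phi) x) =
   (pd i (pd j (fun x => tau x * phi x)) - pd i (fun x => pd j tau x * phi x)) +
   (- pd j (fun x => pd i tau x * phi x) + (fun x => pd j (pd i tau) x * phi x)).
Proof.
move=> st sphi; have sj := smooth_pd j st; have si := smooth_pd i st.
have -> : pd j (fun x => tau x * phi x) =
    (fun x => pd j tau x * phi x) + (fun x => tau x * pd j phi x).
  by rewrite pd_smoothM.
rewrite pd_smoothD; [|exact: smoothM sj sphi|exact: smoothM st (smooth_pd j sphi)].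
rewrite (pd_smoothM i st (smooth_pd j sphi)) (pd_smoothM j si sphi).
have E (t ti tji p pj pij X : R[i]) : t * pij =
  X + (ti * pj + t * pij) - X + (- (tji * p + ti * pj) + tji * p) by ring.
by apply/funext => x; exact: E.
Qed.

(** The Leibniz rule for weak derivatives up to order two: [u] is tested against the products of
    [phi] with [tau] and its derivatives, which are again test functions. *)
Lemma H2_tameM tau u : tame tau -> H2 u -> H2 (fun x => tau x * u x).
Proof.
move=> tt [Lu wu]; split; first exact: L2_tameM.
have st := tt.1.
move=> s /seq_le2[->|[i ->]|[i [j ->]]].
- exists (fun x => tau x * u x); first exact: L2_tameM.
  by move=> phi _; rewrite /= expr0 mul1r.
- have [ui Li /weak_derivative1P wi] := wu [:: i] isT.
  have ti := tame_pd i tt.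
  have L1 := L2_tameM tt Li; have L2' := L2_tameM ti Lu.
  exists ((fun x => tau x * ui x) + (fun x => pd i tau x * u x)); first exact: L2D.
  apply/weak_derivative1P => phi tphi; have Lphi := L2_test tphi.
  have Ld := L2_test (test_pd i tphi).
  rewrite (pair3_D L1 L2' Lphi) !pair3A opprD -(wi _ (testM st tphi)).
  rewrite (pd_smoothM i st tphi.1).
  by rewrite (pair3D Lu (L2_tameM ti Lphi) (L2_tameM tt Ld)) addrAC subrr add0r.
have [uij Lij /weak_derivative2P wij] := wu [:: i; j] isT.
have [ui Li /weak_derivative1P wi] := wu [:: i] isT.
have [uj Lj /weak_derivative1P wj] := wu [:: j] isT.
have ti := tame_pd i tt; have tj := tame_pd j tt; have tji := tame_pd j ti.
have M1 := L2_tameM tt Lij; have M2 := L2_tameM tj Li.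
have M3 := L2_tameM ti Lj; have M4 := L2_tameM tji Lu.
exists (((fun x => tau x * uij x) + (fun x => pd j tau x * ui x)) +
   ((fun x => pd i tau x * uj x) + (fun x => pd j (pd i tau) x * u x))).
  by apply: L2D; exact: L2D.
apply/weak_derivative2P => phi tphi.
have Lphi := L2_test tphi.
rewrite (pair3_D4 Lphi M1 M2 M3 M4) !pair3A (leibniz2 i j st tphi.1).
rewrite (pair3_4 Lu (L2_test (test_pd i (test_pd j (testM st tphi))))
  (L2_test (test_pd i (testM tj.1 tphi))) (L2_test (test_pd j (testM ti.1 tphi)))
  (L2_tameM tji Lphi)).
have key (a b c e a' b' c' : R[i]) : a = a' -> b = - b' -> c = - c' ->
  a - b - c + e = a' + b' + (c' + e) by move=> -> -> ->; ring.
exact: key (wij _ (testM st tphi)) (wi _ (testM tj.1 tphi)) (wj _ (testM ti.1 tphi)).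
Qed.

Lemma cutoffM s1 s2 : @cutoff R s1 -> cutoff s2 -> cutoff (fun x => s1 x * s2 x).
Proof.
move=> [sm1 n1 [Q1 c1 h1]] [sm2 n2 [Q2 c2 h2]]; split.
- exact: smoothM.
- by apply: filterS n1 => x ->; rewrite mul0r.
exists (Q1 `|` Q2); first exact: compactU.
by move=> x nQ; rewrite h1 ?h2 ?mulr1// => q; apply: nQ; [right|left].
Qed.

Lemma cutoff_tame s : @cutoff R s -> tame s.
Proof. by move=> [sm _ [Q cQ h]]; exact: tame_cutoff sm cQ h. Qed.

End SobolevAlgebra.

(** * Linearity of the operators and of the solution spaces *)

Section LinearOperators.
Variables (R : realType) (gamma : R).
Implicit Types (f g : fn R) (x : 'cV[R]_3) (i : 'I_3) (s : seq 'I_3) (z : R[i]).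

Lemma off0E (h : 'cV[R]_3 -> R[i]) x : x != 0 -> off0 h x = h x.
Proof. by rewrite /off0 => /negPf ->. Qed.

Lemma off0_0 (h : 'cV[R]_3 -> R[i]) : off0 h 0 = 0.
Proof. by rewrite /off0 eqxx. Qed.

(** Off the origin the three kinds of operators are fixed pointwise combinations of the derivatives
    [pds s f]; their linearity, and the passage to limits for [opL] and [opRL], reduce to the same
    facts about [pds]. *)
Lemma opTE f x : x != 0 -> opT gamma f x =
  - (\sum_i pds [:: i; i] f x) - (2 * gamma / rad x)%:C * f x.
Proof. exact: off0E. Qed.

Lemma opLE i f x : x != 0 -> opL i f x =
  (x (i + 1) 0)%:C * pds [:: i + 2] f x - (x (i + 2) 0)%:C * pds [:: i + 1] f x.
Proof. exact: off0E. Qed.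

Lemma opRLE i f x : x != 0 -> opRL gamma i f x =
  'i%C * ((x (i + 2 + 1) 0)%:C * pds [:: i + 2 + 2; i + 1] f x
     - (x (i + 2 + 2) 0)%:C * pds [:: i + 2 + 1; i + 1] f x
     - ((x (i + 1 + 1) 0)%:C * pds [:: i + 1 + 2; i + 2] f x
     - (x (i + 1 + 2) 0)%:C * pds [:: i + 1 + 1; i + 2] f x)
     - pds [:: i] f x + (gamma * x i 0 / rad x)%:C * f x).
Proof. by move=> x0; rewrite /opRL off0E// !opLE. Qed.

Lemma Cinf0_pdsZD (a : R[i]) f g s x : Cinf0 f -> Cinf0 g -> x != 0 ->
  pds s (a *: f + g) x = a * pds s f x + pds s g x.
Proof. by move=> [_ sf] [_ sg] x0; rewrite (pdsZD _ _ (@open_neq0 R) sf sg). Qed.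

Lemma opTZD (a : R[i]) f g : Cinf0 f -> Cinf0 g ->
  opT gamma (a *: f + g) = a *: opT gamma f + opT gamma g.
Proof.
move=> sf sg; apply/funext => x; have [->|x0] := eqVneq x 0.
  by rewrite !fctE /opT !off0_0 scaler0 addr0.
have S : \sum_i pds [:: i; i] (a *: f + g) x =
    a * (\sum_i pds [:: i; i] f x) + \sum_i pds [:: i; i] g x.
  rewrite mulr_sumr -big_split/=; apply: eq_bigr => i _; exact: (Cinf0_pdsZD a [:: i; i] sf sg x0).
have -> : (a *: opT gamma f + opT gamma g) x = a * opT gamma f x + opT gamma g x by [].
rewrite (opTE (a *: f + g) x0) (opTE f x0) (opTE g x0) S.
have E (p q c u v : R[i]) : - (a * p + q) - c * (a * u + v) =
  a * (- p - c * u) + (- q - c * v) by ring.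
exact: E.
Qed.

Lemma opLZD i (a : R[i]) f g : Cinf0 f -> Cinf0 g ->
  opL i (a *: f + g) = a *: opL i f + opL i g.
Proof.
move=> sf sg; apply/funext => x; have [->|x0] := eqVneq x 0.
  by rewrite !fctE /opL !off0_0 scaler0 addr0.
rewrite !fctE !opLE// !Cinf0_pdsZD//.
have E (c c' u v u' v' : R[i]) : c * (a * u + v) - c' * (a * u' + v') =
  a * (c * u - c' * u') + (c * v - c' * v') by ring.
exact: E.
Qed.

Lemma opRLZD i (a : R[i]) f g : Cinf0 f -> Cinf0 g ->
  opRL gamma i (a *: f + g) = a *: opRL gamma i f + opRL gamma i g.
Proof.
move=> sf sg; apply/funext => x; have [->|x0] := eqVneq x 0.
  by rewrite !fctE /opRL !off0_0 scaler0 addr0.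
rewrite !fctE !opRLE// !Cinf0_pdsZD//.
have E (k c1 c2 c3 c4 c5 u1 u2 u3 u4 u5 u6 v1 v2 v3 v4 v5 v6 : R[i]) :
  k * (c1 * (a * u1 + v1) - c2 * (a * u2 + v2) - (c3 * (a * u3 + v3) - c4 * (a * u4 + v4))
    - (a * u5 + v5) + c5 * (a * u6 + v6)) =
  a * (k * (c1 * u1 - c2 * u2 - (c3 * u3 - c4 * u4) - u5 + c5 * u6)) +
  k * (c1 * v1 - c2 * v2 - (c3 * v3 - c4 * v4) - v5 + c5 * v6) by ring.
exact: E.
Qed.

Lemma KfiniteZD (a : R[i]) f g : @Kfinite R (fn R) (@kact R) f ->
  @Kfinite R (fn R) (@kact R) g -> @Kfinite R (fn R) (@kact R) (a *: f + g).
Proof.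
move=> [n [e he]] [m [e' he']].
exists (n + m)%N, (fun k => match fintype.split k with inl j => e j | inr j => e' j end).
move=> A OA; have [c hc] := he A OA; have [c' hc'] := he' A OA.
exists (fun k => match fintype.split k with inl j => a * c j | inr j => c' j end).
rewrite big_split_ord/=.
have -> : kact A (a *: f + g) = a *: kact A f + kact A g by [].
rewrite hc hc' scaler_sumr; congr (_ + _); apply: eq_bigr => k _.
  by rewrite -[lshift m k]/(unsplit (inl k)) unsplitK scalerA.
by rewrite -[rshift n k]/(unsplit (inr k)) unsplitK.
Qed.

Lemma Kfinite0 : @Kfinite R (fn R) (@kact R) 0.
Proof. by exists 0%N, (fun=> 0) => A _; exists (fun=> 0); rewrite big_ord0. Qed.

Lemma opT0 : opT gamma 0 = 0.
Proof.
have := @opTZD 1 0 0 (@Cinf0_0 R) (@Cinf0_0 R).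
by rewrite !scale1r addr0 => /eqP; rewrite -subr_eq subrr => /eqP.
Qed.

Lemma SolZD (a : R[i]) z f g : Sol gamma z f -> Sol gamma z g ->
  Sol gamma z (a *: f + g).
Proof.
move=> [sf kf tf] [sg kg tg]; split.
- exact: Cinf0ZD.
- exact: KfiniteZD.
- by rewrite opTZD// tf tg scalerDr !scalerA mulrC.
Qed.

Lemma Sol0 z : Sol gamma z 0.
Proof.
by split; [exact: Cinf0_0|exact: Kfinite0|rewrite opT0 scaler0].
Qed.

(* A product of two cutoffs serves for both functions, since multiplication by a
   cutoff preserves H^2. *)
Lemma Sol_inftyZD (a : R[i]) z f g : Sol_infty gamma z f -> Sol_infty gamma z g ->
  Sol_infty gamma z (a *: f + g).
Proof.
move=> [sf [s1 c1 h1]] [sg [s2 c2 h2]]; split; first exact: SolZD.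
exists (fun x => s1 x * s2 x); first exact: cutoffM.
have -> : (fun x => s1 x * s2 x * (a *: f + g) x) =
   (fun x => a * (s2 x * (s1 x * f x))) + (fun x => s1 x * (s2 x * g x)) :> fn R.
  have E (s s' u v : R[i]) : s * s' * (a * u + v) = a * (s' * (s * u)) + s * (s' * v).
    by ring.
  by apply/funext => x; exact: E.
apply: H2D; last by apply: H2_tameM h2; exact: cutoff_tame.
apply: (@H2_tameM _ (fun=> a)); first exact: tame_cst.
by apply: H2_tameM h1; exact: cutoff_tame.
Qed.

(** The empty sum is excluded: for 0 to lie in [Sol_infty gamma z] some cutoff must exist, and it is
    a member [f k] that supplies one. *)
Lemma Sol_infty_sum z n (c : 'I_n -> R[i]) (f : 'I_n -> fn R) : (0 < n)%N ->
  (forall k, Sol_infty gamma z (f k)) -> Sol_infty gamma z (\sum_k c k *: f k).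
Proof.
case: n c f => // n c f _ sf; elim: n c f sf => [|n ih] c f sf.
  rewrite big_ord1.
  (* The closure property concerns a f + g with both functions in the space; choosing g = f instead
     of g = 0 avoids presupposing that 0 belongs to it. *)
  have -> : c ord0 *: f ord0 = (c ord0 - 1) *: f ord0 + f ord0.
    by rewrite -[X in _ + X]scale1r -scalerDl subrK.
  exact: Sol_inftyZD.
rewrite big_ord_recl; apply: Sol_inftyZD => //.
exact: ih.
Qed.

End LinearOperators.

(** * Spherical means of harmonic polynomials *)

Section DoubleIntegral.
Variable R : realType.
Implicit Types (f F : R -> R) (u v : R -> R -> R).
Local Notation mu := (@lebesgue_measure R).

Lemma Rintegral_FTC F f (a b : R) : a < b -> continuous f ->
  (forall x : R, is_derive x (1 : R) F (f x)) ->
  \int[mu]_(x in `[a, b]) f x = F b - F a.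
Proof.
move=> ab cf dF.
have cF : continuous F.
  by move=> x; apply: differentiable_continuous; apply/derivable1_diffP; apply: ex_derive.
rewrite /Rintegral (@continuous_FTC2 _ f F)//.
- exact: continuous_subspaceT.
- split => [x _||]; first exact: ex_derive.
    by apply: cvg_at_right_filter; exact: cF.
  by apply: cvg_at_left_filter; exact: cF.
- by move=> x _; rewrite derive1E derive_val.
Qed.

Lemma continuous_segment_integrable f (a b : R) : continuous f ->
  mu.-integrable `[a, b] (EFin \o f).
Proof.
move=> cf; apply: continuous_compact_integrable; first exact: segment_compact.
exact: continuous_subspaceT.
Qed.

Definition jcont u := continuous (fun p : R * R => u p.1 p.2).

Lemma jcont1 u (t : R) : jcont u -> continuous (u t).
Proof.
move=> cu p; apply: (@continuous_comp _ _ _ (fun p : R => (t, p)) (fun p : R * R => u p.1 p.2)).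
  by apply: (@cvg_pair _ _ _ (nbhs p) (nbhs t) (nbhs p)) => /=; [exact: cvg_cst|exact: cvg_id].
exact: (cu (t, p)).
Qed.

Lemma jcont2 u (p : R) : jcont u -> continuous (u ^~ p).
Proof.
move=> cu t; apply: (@continuous_comp _ _ _ (fun t : R => (t, p)) (fun p : R * R => u p.1 p.2)).
  by apply: (@cvg_pair _ _ _ (nbhs t) (nbhs t) (nbhs p)) => /=; [exact: cvg_id|exact: cvg_cst].
exact: (cu (t, p)).
Qed.

(** Dominated convergence with a constant bound, [u] being bounded on the compact rectangle
    [t-1, t+1] x [a, b]. This gives the integrability needed for the outer integral. *)
Lemma jcont_inner u (a b : R) : jcont u ->
  continuous (fun t => \int[mu]_(p in `[a, b]) u t p).
Proof.
move=> cu t.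
have cQ : compact (`[t - 1, t + 1] `*` `[a, b] : set (R * R)).
  by apply: compact_setX; exact: segment_compact.
have [M hM] : exists M : R, forall s p : R, s \in `[t - 1, t + 1] -> p \in `[a, b] ->
    `|u s p| <= M.
  have /compact_bounded[M [_ mrt]] : compact ((fun p : R * R => u p.1 p.2) @`
     (`[t - 1, t + 1] `*` `[a, b])).
    by apply: continuous_compact => //; exact: continuous_subspaceT.
  exists (`|M| + 1) => s p si pi; apply: (mrt (`|M| + 1)).
    by rewrite (le_lt_trans (ler_norm _))// ltrDl.
  by exists (s, p).
have := @continuity_under_integral R _ (measurableTypeR R) mu u `[a, b]%classic (measurable_itv _) (t - 1) (t + 1).
have iu s : mu.-integrable `[a, b] (EFin \o u s).
  exact: continuous_segment_integrable (jcont1 cu).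
move=> /(_ (fun s _ => iu s)).
have ae : {ae mu, forall y, `[a, b]%classic y -> {in `]t - 1, t + 1[%classic, continuous (u ^~ y)}}.
  by apply: aeW => y _ s _; exact: jcont2.
move=> /(_ ae (fun=> M)).
have iM : mu.-integrable `[a, b] (EFin \o (fun=> M)).
  by apply: continuous_segment_integrable => x; exact: cvg_cst.
move=> /(_ iM).
have ae2 x : `]t - 1, t + 1[%classic x ->
   {ae mu, forall y, `[a, b]%classic y -> `|u x y| <= M}.
  move=> xI; apply: aeW => y yI; apply: hM; last by [].
  exact: subset_itv_oo_cc xI.
move=> /(_ ae2) /(_ t); apply.
by rewrite inE/= in_itv/= ltrBlDr !ltrDl ltr01.
Qed.

Definition dint u : R :=
  \int[mu]_(t in `[0, pi]) \int[mu]_(p in `[0, 2 * pi]) u t p.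

Lemma dintD u v : jcont u -> jcont v -> dint (fun t p => u t p + v t p) = dint u + dint v.
Proof.
move=> cu cv; rewrite /dint.
under eq_Rintegral => t _.
  rewrite RintegralD//; [|exact: continuous_segment_integrable (jcont1 cu)
    |exact: continuous_segment_integrable (jcont1 cv)].
  over.
rewrite RintegralD//; exact: continuous_segment_integrable (jcont_inner _).
Qed.

Lemma dintZ (k : R) u : jcont u -> dint (fun t p => k * u t p) = k * dint u.
Proof.
move=> cu; rewrite /dint.
under eq_Rintegral => t _.
  rewrite RintegralZl//; last exact: continuous_segment_integrable (jcont1 cu).
  over.
rewrite RintegralZl//; exact: continuous_segment_integrable (jcont_inner _).
Qed.

Lemma dint_sep f g : continuous f -> continuous g ->
  dint (fun t p => f t * g p) =
  (\int[mu]_(t in `[0, pi]) f t) * (\int[mu]_(p in `[0, 2 * pi]) g p).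
Proof.
move=> cf cg; rewrite /dint.
under eq_Rintegral => t _.
  rewrite RintegralZl//; last exact: continuous_segment_integrable.
  over.
by rewrite RintegralZr//; exact: continuous_segment_integrable.
Qed.

End DoubleIntegral.

(** * Recursions for trigonometric moments *)

Section TrigMoments.
Variable R : realType.
Local Notation mu := (@lebesgue_measure R).

Definition polar_moment (s c : nat) : R :=
  \int[mu]_(t in `[0, pi]) (sin t ^+ s * cos t ^+ c).
Definition azimuth_moment (a b : nat) : R :=
  \int[mu]_(t in `[0, 2 * pi]) (cos t ^+ a * sin t ^+ b).

Lemma continuous_sincos (a b : nat) : continuous (fun t : R => sin t ^+ a * cos t ^+ b).
Proof.
move=> t; apply: cvgM.
  by apply: (@cvg_comp _ _ _ sin (fun x => x ^+ a)); [exact: continuous_sin|exact: exprn_continuous].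
by apply: (@cvg_comp _ _ _ cos (fun x => x ^+ b)); [exact: continuous_cos|exact: exprn_continuous].
Qed.

Lemma is_deriveM_fun (f g : R -> R) (x a b : R) :
  is_derive x (1 : R) f a -> is_derive x (1 : R) g b ->
  is_derive x (1 : R) (fun y => f y * g y) (a * g x + f x * b).
Proof.
move=> df dg; apply: is_derive_eq (is_deriveM df dg) _.
by rewrite /GRing.scale/= addrC [g x * a]mulrC.
Qed.

Lemma is_deriveX_fun (f : R -> R) n (x a : R) : is_derive x (1 : R) f a ->
  is_derive x (1 : R) (fun y => f y ^+ n) (n%:R * f x ^+ n.-1 * a).
Proof.
move=> df; have := is_deriveX n df.
by have -> : f ^+ n = (fun y => f y ^+ n) by apply/funext => y; rewrite exprfctE.
Qed.

Lemma is_deriveZ_fun (f : R -> R) (k x a : R) : is_derive x (1 : R) f a ->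
  is_derive x (1 : R) (fun y => k * f y) (k * a).
Proof. by move=> df; exact: (is_deriveZ k df). Qed.

Lemma is_deriveB_fun (f g : R -> R) (x a b : R) :
  is_derive x (1 : R) f a -> is_derive x (1 : R) g b ->
  is_derive x (1 : R) (fun y => f y - g y) (a - b).
Proof. by move=> df dg; exact: is_deriveB df dg. Qed.

(** When [a] or [b] is 0 the truncated predecessor is harmless, because its coefficient vanishes. *)
Lemma is_derive_sincos (a b : nat) (t : R) :
  is_derive t (1 : R) (fun t : R => sin t ^+ a * cos t ^+ b)
    (a%:R * (sin t ^+ a.-1 * cos t ^+ b.+1) - b%:R * (sin t ^+ a.+1 * cos t ^+ b.-1)).
Proof.
have := is_deriveM_fun (is_deriveX_fun a (is_derive_sin t)) (is_deriveX_fun b (is_derive_cos t)).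
by move=> h; apply: is_derive_eq h _; rewrite !exprS; ring.
Qed.

Lemma Rintegral_lin3 (a b k1 k2 k3 : R) (f g h : R -> R) :
  continuous f -> continuous g -> continuous h ->
  \int[mu]_(t in `[a, b]) (k1 * f t + k2 * g t - k3 * h t) =
  k1 * \int[mu]_(t in `[a, b]) f t + k2 * \int[mu]_(t in `[a, b]) g t
  - k3 * \int[mu]_(t in `[a, b]) h t.
Proof.
move=> cf cg ch.
have cZ (k : R) (u : R -> R) : continuous u -> continuous (fun t : R => k * u t).
  by move=> cu t; apply: cvgM; [exact: cvg_cst|exact: cu].
have I (u : R -> R) : continuous u -> mu.-integrable `[a, b] (EFin \o u).
  exact: continuous_segment_integrable.
rewrite RintegralB//; last 2 first.
- apply: I => t; apply: cvgD; exact: cZ.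
- by apply: I; exact: cZ.
rewrite RintegralD//; try (by apply: I; exact: cZ).
by rewrite !RintegralZl//; exact: I.
Qed.

(** The function G is sin t times the derivative of sin^s t cos^c t, as in the polar part of the
    spherical Laplacian; the identity says that G' has integral 0 over [0, pi]. *)
Lemma polar_moment_rec (s c : nat) :
  ((s + c) * (s + c).+1)%:R * polar_moment s.+1 c =
  (s * s)%:R * polar_moment s.-1 c + (c * c.-1)%:R * polar_moment s.+1 c.-2.
Proof.
pose G (t : R) := s%:R * (sin t ^+ s * cos t ^+ c.+1) - c%:R * (sin t ^+ s.+2 * cos t ^+ c.-1).
pose g (t : R) := (s * s)%:R * (sin t ^+ s.-1 * cos t ^+ c)
  + (c * c.-1)%:R * (sin t ^+ s.+1 * cos t ^+ c.-2)
  - ((s + c) * (s + c).+1)%:R * (sin t ^+ s.+1 * cos t ^+ c).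
have dG t : is_derive t (1 : R) G (g t).
  have := is_deriveB_fun (is_deriveZ_fun s%:R (is_derive_sincos s c.+1 t))
    (is_deriveZ_fun c%:R (is_derive_sincos s.+2 c.-1 t)).
  move=> h; apply: is_derive_eq h _; rewrite /g/=.
  have c2 : cos t ^+ 2 = 1 - sin t ^+ 2 by rewrite -(cos2Dsin2 t) addrK.
  have s2 : sin t ^+ 2 = 1 - cos t ^+ 2 by rewrite -(cos2Dsin2 t) addrC addKr.
  have -> : cos t ^+ c.+2 = cos t ^+ c - cos t ^+ c * sin t ^+ 2.
    by rewrite -addn2 exprD c2 mulrBr mulr1.
  have -> : sin t ^+ s.+3 = sin t ^+ s.+1 - sin t ^+ s.+1 * cos t ^+ 2.
    by rewrite -addn2 exprD s2 mulrBr mulr1.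
  (* Small exponents are separated so that the truncated predecessors become honest ones. *)
  case: s {G g} => [|s]; case: c => [|[|c]];
    rewrite /= ?mul0n ?muln0 ?add0n ?addn0 ?natrM -?natr1 ?natrD -?natr1 ?exprS ?expr0; ring.
have cg : continuous g.
  have cZ (k : R) a b : continuous (fun t : R => k * (sin t ^+ a * cos t ^+ b)).
    by move=> t; apply: cvgM; [exact: cvg_cst|exact: continuous_sincos].
  move=> t; apply: cvgB; last exact: cZ.
  by apply: cvgD; exact: cZ.
have := Rintegral_FTC (pi_gt0 R) cg dG.
(* Both terms of G carry a positive power of sin, except the first one for s = 0, whose coefficient
   is then 0. *)
have -> : G pi - G 0 = 0.
  rewrite /G sinpi sin0; case: (s) => [|k]; first by rewrite !expr0n/= !(mul0r, mulr0) subrr.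
  by rewrite !expr0n/= !(mul0r, mulr0) subrr.
rewrite Rintegral_lin3; try exact: continuous_sincos.
by move=> /eqP; rewrite subr_eq0 => /eqP <-.
Qed.

Lemma continuous_cossin (a b : nat) : continuous (fun t : R => cos t ^+ a * sin t ^+ b).
Proof. by under eq_fun do rewrite mulrC; exact: continuous_sincos. Qed.

(** Here G is the derivative of cos^a t sin^b t, and the integral of its own derivative over a full
    period vanishes. *)
Lemma azimuth_moment_rec (a b : nat) :
  ((a + b) * (a + b))%:R * azimuth_moment a b =
  (a * a.-1)%:R * azimuth_moment a.-2 b + (b * b.-1)%:R * azimuth_moment a b.-2.
Proof.
pose G (t : R) := b%:R * (sin t ^+ b.-1 * cos t ^+ a.+1) - a%:R * (sin t ^+ b.+1 * cos t ^+ a.-1).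
pose g (t : R) := (a * a.-1)%:R * (cos t ^+ a.-2 * sin t ^+ b)
  + (b * b.-1)%:R * (cos t ^+ a * sin t ^+ b.-2)
  - ((a + b) * (a + b))%:R * (cos t ^+ a * sin t ^+ b).
have dG t : is_derive t (1 : R) G (g t).
  have := is_deriveB_fun (is_deriveZ_fun b%:R (is_derive_sincos b.-1 a.+1 t))
    (is_deriveZ_fun a%:R (is_derive_sincos b.+1 a.-1 t)).
  move=> h; apply: is_derive_eq h _; rewrite /g/=.
  have c2 : cos t ^+ 2 = 1 - sin t ^+ 2 by rewrite -(cos2Dsin2 t) addrK.
  have s2 : sin t ^+ 2 = 1 - cos t ^+ 2 by rewrite -(cos2Dsin2 t) addrC addKr.
  have -> : cos t ^+ a.+2 = cos t ^+ a - cos t ^+ a * sin t ^+ 2.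
    by rewrite -addn2 exprD c2 mulrBr mulr1.
  have -> : sin t ^+ b.+2 = sin t ^+ b - sin t ^+ b * cos t ^+ 2.
    by rewrite -addn2 exprD s2 mulrBr mulr1.
  case: a {G g} => [|[|a]]; case: b => [|[|b]];
    rewrite /= ?mul0n ?muln0 ?add0n ?addn0 ?natrM -?natr1 ?natrD -?natr1 ?exprS ?expr0; ring.
have cg : continuous g.
  have cZ (k : R) m n : continuous (fun t : R => k * (cos t ^+ m * sin t ^+ n)).
    by move=> t; apply: cvgM; [exact: cvg_cst|exact: continuous_cossin].
  move=> t; apply: cvgB; last exact: cZ.
  by apply: cvgD; exact: cZ.
have pi2 : 0 < 2 * pi :> R by rewrite mulr_gt0// pi_gt0.
have := Rintegral_FTC pi2 cg dG.
have -> : G (2 * pi) - G 0 = 0.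
  by rewrite /G (mulr_natl pi 2) sin2pi sin0 cos2pi cos0 subrr.
rewrite Rintegral_lin3; try exact: continuous_cossin.
by move=> /eqP; rewrite subr_eq0 => /eqP <-.
Qed.

End TrigMoments.

Section DirectionalDerivative.
Variable R : realType.

Lemma derive_line (f : 'cV[R]_3 -> R) (x v : 'cV[R]_3) :
  'D_v f x = 'D_1 (fun h : R => f (h *: v + x)) 0.
Proof.
rewrite /derive.
have -> // : (fun h : R => h^-1 *: ((f \o shift x) (h *: v) - f x)) =
  (fun h : R => h^-1 *: (((fun h : R => f (h *: v + x)) \o shift 0) (h *: 1) - f (0 *: v + x))).
by apply/funext => h; rewrite /= addr0 scale0r add0r [h *: 1]mulr1.
Qed.

Lemma derive_line_eq (f : 'cV[R]_3 -> R) (x v : 'cV[R]_3) (g : R -> R) (a : R) :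
  (forall h, f (h *: v + x) = g h) -> is_derive (0 : R) (1 : R) g a -> 'D_v f x = a.
Proof.
move=> fg dg; rewrite derive_line.
have -> : (fun h : R => f (h *: v + x)) = g by apply/funext.
by have [_ ->] := dg.
Qed.

End DirectionalDerivative.

Section Monomials.
Variable R : realType.
Implicit Types (f : fn R) (m : 'I_3 -> nat) (i j : 'I_3).

Definition mon m : fn R := fun x => (\prod_j x j 0 ^+ m j)%:C.

Definition decr i m : 'I_3 -> nat := fun j => if j == i then (m j).-1 else m j.

Lemma cdiff_real (h : 'cV[R]_3 -> R) x : differentiable h x -> cdiff (fun y => (h y)%:C) x.
Proof. by move=> dh; split => //=; exact: differentiable_cst. Qed.

Lemma cdiff_mon m x : cdiff (mon m) x.
Proof.
apply: cdiff_real.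
elim: (index_enum 'I_3) => [|j r ih].
  under eq_fun do rewrite big_nil; exact: differentiable_cst.
under eq_fun do rewrite big_cons.
apply: differentiableM ih.
have -> : (fun y : 'cV[R]_3 => y j 0 ^+ m j) = (fun y : 'cV[R]_3 => y j 0) ^+ m j.
  by apply/funext => y; rewrite exprfctE.
case: (m j) => [|n]; first by rewrite expr0; exact: differentiable_cst.
apply: differentiableX; exact: differentiable_coord.
Qed.

Lemma pd_real i (h : 'cV[R]_3 -> R) x : pd i (fun y => (h y)%:C) x = ('D_(delta_mx i 0) h x)%:C.
Proof. by rewrite /pd /= derive_cst. Qed.

Lemma pd_mon i m : pd i (mon m) = (m i)%:R *: mon (decr i m).
Proof.
apply/funext => x; rewrite /mon pd_real.
pose C := \prod_(j | j != i) x j 0 ^+ m j.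
have line h : \prod_j (h *: delta_mx i 0 + x) j 0 ^+ m j = (h + x i 0) ^+ m i * C.
  rewrite (bigD1 i)//= !mxE !eqxx mulr1; congr (_ * _).
  by apply: eq_bigr => j /negPf ji; rewrite !mxE ji mulr0 add0r.
have d1 : is_derive (0 : R) (1 : R) (fun h : R => h + x i 0) 1.
  by have := is_deriveD (is_derive_id (0 : R) (1 : R)) (is_derive_cst (x i 0) (0 : R) (1 : R)); rewrite addr0.
have d2 : is_derive (0 : R) (1 : R) (fun h : R => (h + x i 0) ^+ m i * C)
    ((m i)%:R * (x i 0 ^+ (m i).-1 * C)).
  have := is_deriveM_fun (is_deriveX_fun (m i) d1) (is_derive_cst C (0 : R) (1 : R)).
  by move=> h; apply: is_derive_eq h _; rewrite /cst /= add0r; ring.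
rewrite (derive_line_eq line d2).
rewrite fctE (bigD1 i)//= /decr eqxx rmorphM/= rmorph_nat; congr (_ * _%:C).
by congr (_ * _); apply: eq_bigr => j /negPf ->.
Qed.

Lemma pd_sum (I : Type) (r : seq I) (P : pred I) (c : I -> R[i]) (F : I -> fn R) i :
  (forall k x, cdiff (F k) x) ->
  pd i (\sum_(k <- r | P k) c k *: F k) = \sum_(k <- r | P k) c k *: pd i (F k).
Proof.
move=> dF; apply/funext => x.
have h : cdiff (\sum_(k <- r | P k) c k *: F k) x /\
   pd i (\sum_(k <- r | P k) c k *: F k) x = (\sum_(k <- r | P k) c k *: pd i (F k)) x.
  elim: r => [|k r [d e]].
    by rewrite !big_nil; split; [exact: cdiff_cst|exact: pd_cst].
  rewrite !big_cons; case: (P k) => //.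
  split; first by apply: cdiffD => //; exact: cdiffZ.
  by rewrite pdD// ?pdZ// ?e//; exact: cdiffZ.
by case: h.
Qed.

Lemma cdiff_sum (I : Type) (r : seq I) (P : pred I) (c : I -> R[i]) (F : I -> fn R) x :
  (forall k x, cdiff (F k) x) -> cdiff (\sum_(k <- r | P k) c k *: F k) x.
Proof.
move=> dF; elim: r => [|k r ih]; first by rewrite big_nil; exact: cdiff_cst.
by rewrite big_cons; case: (P k) => //; apply: cdiffD => //; exact: cdiffZ.
Qed.

Definition hpoly (l : nat) (c : {ffun 'I_3 -> 'I_l.+1} -> R[i]) : fn R :=
  \sum_(m : {ffun 'I_3 -> 'I_l.+1} | (\sum_j m j == l)%N) c m *: mon (fun j => m j).

(** Harmonicity is expanded monomial by monomial, into the combination that appears on the right of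
    [smean_mon_laplacian]. *)
Lemma harmonic_polyP l (P : fn R) : harmonic_poly l P -> exists c,
  P = @hpoly l c /\ forall x,
   \sum_(m : {ffun 'I_3 -> 'I_l.+1} | (\sum_j m j == l)%N)
     c m * (\sum_i (m i * (m i).-1)%:R * mon (decr i (decr i (fun j => m j))) x) = 0.
Proof.
move=> [[c Pc] lapP]; exists c.
have PE : P = @hpoly l c.
  by apply/funext => x; rewrite Pc /hpoly fct_sumE.
split=> // x; transitivity (laplacian P x); last exact: lapP.
rewrite /laplacian PE.
under [RHS]eq_bigr => i _.
  rewrite /hpoly pd_sum; last by move=> k y; exact: cdiff_mon.
  under eq_bigr do rewrite pd_mon scalerA.
  rewrite pd_sum; last by move=> k y; exact: cdiff_mon.
  rewrite fct_sumE.
  under eq_bigr do rewrite pd_mon !fctE /decr eqxx -/(decr i _).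
  over.
rewrite [RHS]exchange_big/=; apply: eq_bigr => m _.
rewrite mulr_sumr; apply: eq_bigr => i _.
by rewrite natrM /GRing.scale/= -!mulrA.
Qed.

Lemma mon_homog m (t : R) x : mon m (t *: x) = (t ^+ (\sum_j m j))%:C * mon m x.
Proof.
rewrite /mon -rmorphM/=; congr (_ %:C).
rewrite expr_sum -big_split/=; apply: eq_bigr => j _.
by rewrite !mxE exprMn.
Qed.

Lemma hpoly_homog l c (t : R) x : @hpoly l c (t *: x) = (t ^+ l)%:C * hpoly c x.
Proof.
rewrite /hpoly !fct_sumE mulr_sumr; apply: eq_bigr => m /eqP ml.
by rewrite !fctE mon_homog ml /GRing.scale/= mulrCA.
Qed.

Lemma cdiff_hpoly l c x : cdiff (@hpoly l c) x.
Proof. by apply: cdiff_sum => k y; exact: cdiff_mon. Qed.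

End Monomials.

Section SphereIntegral.
Variable R : realType.
Implicit Types (h : R -> R -> R[i]) (f g : fn R).
Local Notation mu := (@lebesgue_measure R).

Definition sint h : R[i] :=
  cint mu `[0, pi] (fun t => cint mu `[0, 2 * pi] (fun p => h t p)).

Definition jcontC h := jcont (fun t p => complex.Re (h t p)) /\
  jcont (fun t p => complex.Im (h t p)).

Lemma sintE h : sint h = dint (fun t p => complex.Re (h t p)) +i*
  dint (fun t p => complex.Im (h t p)).
Proof. by []. Qed.

Lemma eq_sint h h' : (forall t p, h t p = h' t p) -> sint h = sint h'.
Proof. by move=> hh; congr sint; apply/funext => t; apply/funext => p. Qed.

Lemma jcontD (u v : R -> R -> R) : jcont u -> jcont v -> jcont (fun t p => u t p + v t p).
Proof. by move=> cu cv p; apply: cvgD; [exact: cu|exact: cv]. Qed.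

Lemma jcontN (u : R -> R -> R) : jcont u -> jcont (fun t p => - u t p).
Proof. by move=> cu p; apply: cvgN; exact: cu. Qed.

Lemma jcontM (u v : R -> R -> R) : jcont u -> jcont v -> jcont (fun t p => u t p * v t p).
Proof. by move=> cu cv p; apply: cvgM; [exact: cu|exact: cv]. Qed.

Lemma jcont_cst (k : R) : jcont (fun _ _ => k).
Proof. by move=> p; exact: cvg_cst. Qed.

Lemma jcontC_D h h' : jcontC h -> jcontC h' -> jcontC (fun t p => h t p + h' t p).
Proof.
move=> [hr hi] [hr' hi']; split.
  rewrite (_ : (fun t p => _) = fun t p => complex.Re (h t p) + complex.Re (h' t p)).
    exact: jcontD.
  by apply/funext => t; apply/funext => p; rewrite cReD.
rewrite (_ : (fun t p => _) = fun t p => complex.Im (h t p) + complex.Im (h' t p)).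
  exact: jcontD.
by apply/funext => t; apply/funext => p; rewrite cImD.
Qed.

Lemma jcontC_M h h' : jcontC h -> jcontC h' -> jcontC (fun t p => h t p * h' t p).
Proof.
move=> [hr hi] [hr' hi']; split.
  rewrite (_ : (fun t p => _) = fun t p => complex.Re (h t p) * complex.Re (h' t p) +
    - (complex.Im (h t p) * complex.Im (h' t p))).
    by apply: jcontD; [exact: jcontM|apply: jcontN; exact: jcontM].
  by apply/funext => t; apply/funext => p; rewrite cReM.
rewrite (_ : (fun t p => _) = fun t p => complex.Re (h t p) * complex.Im (h' t p) +
    complex.Im (h t p) * complex.Re (h' t p)).
  by apply: jcontD; exact: jcontM.
by apply/funext => t; apply/funext => p; rewrite cImM.
Qed.

Lemma jcontC_cst (k : R[i]) : jcontC (fun _ _ => k).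
Proof. by split; exact: jcont_cst. Qed.

Lemma sintD h h' : jcontC h -> jcontC h' ->
  sint (fun t p => h t p + h' t p) = sint h + sint h'.
Proof.
move=> [hr hi] [hr' hi']; rewrite !sintE; apply: complex_eqP; rewrite ?cReD ?cImD/=.
  rewrite -(dintD hr hr'); congr dint.
  by apply/funext => t; apply/funext => p; rewrite cReD.
rewrite -(dintD hi hi'); congr dint.
by apply/funext => t; apply/funext => p; rewrite cImD.
Qed.

Lemma sintZ (k : R[i]) h : jcontC h -> sint (fun t p => k * h t p) = k * sint h.
Proof.
move=> [hr hi].
have cZ (a : R) (u : R -> R -> R) : jcont u -> jcont (fun t p => a * u t p).
  by move=> cu; apply: jcontM => //; exact: jcont_cst.
rewrite !sintE; apply: complex_eqP; rewrite ?cReM ?cImM/=.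
  rewrite -mulNr -(dintZ _ hr) -(dintZ _ hi) -(dintD (cZ _ _ hr) (cZ _ _ hi)).
  by congr dint; apply/funext => t; apply/funext => p; rewrite cReM mulNr.
rewrite -(dintZ _ hi) -(dintZ _ hr) -(dintD (cZ _ _ hi) (cZ _ _ hr)).
by congr dint; apply/funext => t; apply/funext => p; rewrite cImM.
Qed.

Lemma dint0 : dint (fun _ _ => 0 : R) = 0.
Proof.
have h := @dintZ R 0 _ (@jcont_cst 0); rewrite [RHS]mul0r in h.
rewrite -[RHS]h; congr dint.
by apply/funext => t; apply/funext => p; rewrite mul0r.
Qed.

Lemma sint_cst0 : sint (fun _ _ => 0) = 0.
Proof.
apply: etrans (etrans (sintZ 0 (jcontC_cst 0)) (mul0r _)).
by apply: eq_sint => t p; rewrite mul0r.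
Qed.

Lemma jcontC_sum (I : Type) (r : seq I) (P : pred I) (F : I -> R -> R -> R[i]) :
  (forall k, P k -> jcontC (F k)) -> jcontC (fun t p => \sum_(k <- r | P k) F k t p).
Proof.
move=> cF; elim: r => [|k r ih].
  rewrite (_ : (fun t p => _) = fun _ _ => 0); first exact: jcontC_cst.
  by apply/funext => t; apply/funext => p; rewrite big_nil.
have [Pk|nPk] := boolP (P k).
  rewrite (_ : (fun t p => _) = fun t p => F k t p + \sum_(k <- r | P k) F k t p).
    by apply: jcontC_D => //; exact: cF.
  by apply/funext => t; apply/funext => p; rewrite big_cons Pk.
rewrite (_ : (fun t p => _) = fun t p => \sum_(k <- r | P k) F k t p) //.
by apply/funext => t; apply/funext => p; rewrite big_cons (negPf nPk).
Qed.

Lemma sint_sum (I : Type) (r : seq I) (P : pred I) (F : I -> R -> R -> R[i]) :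
  (forall k, P k -> jcontC (F k)) ->
  sint (fun t p => \sum_(k <- r | P k) F k t p) = \sum_(k <- r | P k) sint (F k).
Proof.
move=> cF; elim: r => [|k r ih].
  rewrite big_nil; apply: etrans sint_cst0.
  by apply: eq_sint => t p; rewrite big_nil.
rewrite big_cons; case: ifPn => [Pk|nPk]; rewrite -ih.
  rewrite -sintD; [|exact: cF|exact: jcontC_sum].
  by apply: eq_sint => t p; rewrite big_cons Pk.
by apply: eq_sint => t p; rewrite big_cons (negPf nPk).
Qed.

Lemma sphere_ptE (t p : R) : sphere_pt t p = vec3 (sin t * cos p) (sin t * sin p) (cos t).
Proof.
apply/matrixP => i j; rewrite !mxE (ord1 j).
by case: i => [[|[|[|//]]] ilt] /=; rewrite ?eqxx ?andbT ?mulr1 ?mulr0 ?addr0 ?add0r.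
Qed.

Lemma sum3 (V : nmodType) (F : 'I_3 -> V) : \sum_i F i = F 0 + F 1 + F (1 + 1).
Proof.
rewrite !big_ord_recr big_ord0/= add0r; congr (F _ + F _ + F _); exact: val_inj.
Qed.

Lemma rad_sphere (t p : R) : rad (sphere_pt t p) = 1.
Proof.
rewrite /rad sum3 !mxE/=.
have -> : (sin t * cos p) ^+ 2 + (sin t * sin p) ^+ 2 + cos t ^+ 2 =
    sin t ^+ 2 * (cos p ^+ 2 + sin p ^+ 2) + cos t ^+ 2 by ring.
by rewrite cos2Dsin2 mulr1 addrC cos2Dsin2 sqrtr1.
Qed.

Lemma rad0 : rad (0 : 'cV[R]_3) = 0.
Proof. by rewrite /rad big1 ?sqrtr0// => i _; rewrite mxE expr0n. Qed.

Lemma sphere_neq0 (t p : R) : sphere_pt t p != 0.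
Proof.
apply/eqP => h; have := rad_sphere t p; rewrite h rad0 => /esym/eqP.
by rewrite oner_eq0.
Qed.

Lemma jcont_sphere (F : 'cV[R]_3 -> R) : (forall x, x != 0 -> {for x, continuous F}) ->
  jcont (fun t p => F (sphere_pt t p)).
Proof.
move=> cF q.
apply: (@continuous_comp _ _ _ (fun q : R * R => sphere_pt q.1 q.2) F); last first.
  by apply: cF; exact: sphere_neq0.
have -> : (fun q : R * R => sphere_pt q.1 q.2) =
  (fun q => vec3 (sin q.1 * cos q.2) (sin q.1 * sin q.2) (cos q.1)).
  by apply/funext => ?; rewrite sphere_ptE.
have c1 (k : R -> R) : continuous k -> {for q, continuous (fun q : R * R => k q.1)}.
  by move=> ck; apply: continuous_comp; [exact: cvg_fst|exact: ck].
have c2 (k : R -> R) : continuous k -> {for q, continuous (fun q : R * R => k q.2)}.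
  by move=> ck; apply: continuous_comp; [exact: cvg_snd|exact: ck].
rewrite /vec3; apply: cvgD; [apply: cvgD|]; apply: cvgZr_tmp.
- by apply: cvgM; [exact: (c1 _ (@continuous_sin R))|exact: (c2 _ (@continuous_cos R))].
- by apply: cvgM; [exact: (c1 _ (@continuous_sin R))|exact: (c2 _ (@continuous_sin R))].
- exact: (c1 _ (@continuous_cos R)).
Qed.

Lemma Re_cvgC (T : Type) (F : set_system T) {FF : Filter F} (f : T -> R[i]^o) (l : R[i]^o) :
  f @ F --> l -> complex.Re (f x) @[x --> F] --> complex.Re l.
Proof. by move=> /cvgC[]. Qed.

Lemma Im_cvgC (T : Type) (F : set_system T) {FF : Filter F} (f : T -> R[i]^o) (l : R[i]^o) :
  f @ F --> l -> complex.Im (f x) @[x --> F] --> complex.Im l.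
Proof. by move=> /cvgC[]. Qed.

Lemma jcontC_sphere f : (forall x, x != 0 -> {for x, continuous f}) ->
  jcontC (fun t p => f (sphere_pt t p)).
Proof.
move=> cf; split; apply: (@jcont_sphere (fun x => _ (f x))) => x x0.
  exact: (Re_cvgC (cf x x0)).
exact: (Im_cvgC (cf x x0)).
Qed.

Lemma jcontC_sin : jcontC (fun t p => (sin t)%:C).
Proof.
split => /=; last exact: jcont_cst.
by move=> q; apply: (@continuous_comp _ _ _ fst sin); [exact: cvg_fst|exact: continuous_sin].
Qed.

(** Not normalized: the value at the constant 1 is 4 pi. *)
Definition smean f : R[i] := sint (fun t p => (sin t)%:C * f (sphere_pt t p)).

Lemma smean_jcont f : (forall x, x != 0 -> {for x, continuous f}) ->
  jcontC (fun t p => (sin t)%:C * f (sphere_pt t p)).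
Proof. by move=> cf; apply: jcontC_M; [exact: jcontC_sin|exact: jcontC_sphere]. Qed.

Lemma smean_sum (I : Type) (r : seq I) (P : pred I) (c : I -> R[i]) (F : I -> fn R) :
  (forall k, P k -> forall x, x != 0 -> {for x, continuous (F k)}) ->
  smean (fun x => \sum_(k <- r | P k) c k * F k x) = \sum_(k <- r | P k) c k * smean (F k).
Proof.
move=> cF; transitivity (sint (fun t p => \sum_(k <- r | P k) c k * ((sin t)%:C * F k (sphere_pt t p)))).
  apply: eq_sint => t p; rewrite mulr_sumr; apply: eq_bigr => k _.
  by rewrite mulrCA.
rewrite sint_sum; last first.
  by move=> k Pk; apply: jcontC_M; [exact: jcontC_cst|exact: smean_jcont (cF k Pk)].
by apply: eq_bigr => k Pk; rewrite sintZ//; exact: smean_jcont (cF k Pk).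
Qed.

(** A monomial separates in the polar angles; the factor sin of the area element raises the first
    exponent by one. *)
Lemma smean_mon (m : 'I_3 -> nat) : smean (mon m) =
  (polar_moment R (m 0 + m 1).+1 (m (1 + 1)) * azimuth_moment R (m 0) (m 1))%:C.
Proof.
rewrite /smean sintE; congr (_ +i* _).
  rewrite -dint_sep; [|exact: continuous_sincos|exact: continuous_cossin].
  congr dint; apply/funext => t; apply/funext => p.
  rewrite /mon -rmorphM/= !big_ord_recr big_ord0/= !mxE/=.
  have -> : m (widen_ord (leqnSn 2) (widen_ord (leqnSn 1) ord_max)) = m 0.
    by congr m; exact: val_inj.
  have -> : m (widen_ord (leqnSn 2) ord_max) = m 1 by congr m; exact: val_inj.
  have -> : m ord_max = m (1 + 1) by congr m; exact: val_inj.
  by rewrite mul1r !exprMn exprS exprD; ring.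
apply: etrans dint0; congr dint.
by apply/funext => t; apply/funext => p; rewrite /mon -rmorphM.
Qed.

(* On the sphere, l(l+1) times a homogeneous polynomial of degree l has the same
   integral as its Laplacian; on monomials this is integration by parts in the
   two angles. *)
Lemma smean_mon_laplacian (m : 'I_3 -> nat) (l : nat) : (\sum_j m j)%N = l ->
  (l * l.+1)%:R * smean (mon m) =
  \sum_i (m i * (m i).-1)%:R * smean (mon (decr i (decr i m))).
Proof.
rewrite sum3 sum3 => <-.
set a := m 0; set b := m 1; set c := m (1 + 1).
have E0 : decr 0 (decr 0 m) 0 = a.-2 by [].
have rn n : n%:R = (n%:R : R)%:C :> R[i] by rewrite rmorph_nat.
rewrite -[(a + b + c)%R]/(a + b + c)%N !smean_mon /decr/= -/a -/b -/c !rn -!(rmorphM (real_complex R)) -!(rmorphD (real_complex R)); congr (_ %:C).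
(* For s = a + b the polar recursion produces the factor (a + b)^2, which is the one that the
   azimuthal recursion resolves; the three terms obtained in this way are the three second
   derivatives. *)
rewrite mulrA polar_moment_rec mulrDl.
have := azimuth_moment_rec R a b.
set A := azimuth_moment R a b => hA.
have e1 : ((a + b) * (a + b))%:R * polar_moment R (a + b).-1 c * A =
  polar_moment R (a + b).-1 c * ((a * a.-1)%:R * azimuth_moment R a.-2 b +
     (b * b.-1)%:R * azimuth_moment R a b.-2).
  by rewrite -hA; ring.
rewrite e1 mulrDr; congr (_ + _ + _).
- by case: (a) => [|[|k]]; rewrite ?mul0n ?muln0 ?mul0r ?mulr0 ?mul0r//= mulrCA.
- case: (b) => [|[|k]]; rewrite ?mul0n ?muln0 ?mul0r ?mulr0 ?mul0r//=.
  by rewrite !addnS /= mulrCA.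
- by rewrite mulrA.
Qed.

(** The integral times l(l+1) is the integral of the Laplacian, which is 0, and l(l+1) is nonzero
    for l > 0. *)
Lemma smean_harmonic l (P : fn R) : harmonic_poly l P -> (0 < l)%N -> smean P = 0.
Proof.
move=> hP l0; have [c [-> lap0]] := harmonic_polyP hP.
have cm (m : {ffun 'I_3 -> 'I_l.+1}) (x : 'cV[R]_3) : {for x, continuous (mon (fun j => m j) : fn R)}.
  exact: cdiff_continuous (cdiff_mon _ _).
have -> : hpoly c = fun x => \sum_(m : {ffun 'I_3 -> 'I_l.+1} | (\sum_j m j == l)%N)
     c m * mon (fun j => m j) x.
  by apply/funext => x; rewrite /hpoly fct_sumE.
rewrite smean_sum; last by move=> k _ x _; exact: cm.
have ll : (l * l.+1)%:R != 0 :> R[i] by rewrite pnatr_eq0 muln_eq0 negb_or -lt0n l0.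
apply: (mulfI ll); rewrite mulr0 mulr_sumr.
have cm2 (m : {ffun 'I_3 -> 'I_l.+1}) k (x : 'cV[R]_3) :
   {for x, continuous (mon (decr k (decr k (fun j => m j))) : fn R)}.
  exact: cdiff_continuous (cdiff_mon _ _).
transitivity (\sum_(m : {ffun 'I_3 -> 'I_l.+1} | (\sum_j m j == l)%N)
  c m * smean (fun x => \sum_i (m i * (m i).-1)%:R * mon (decr i (decr i (fun j => m j))) x)).
  apply: eq_bigr => m /eqP ml; rewrite mulrCA; congr (_ * _).
  by rewrite (smean_mon_laplacian ml) smean_sum// => k _ x _; exact: cm2.
rewrite -smean_sum; last first.
  move=> m _ x _.
  have -> : (fun x => \sum_i (m i * (m i).-1)%:R * mon (decr i (decr i (fun j => m j))) x) =
     \sum_i (m i * (m i).-1)%:R *: mon (decr i (decr i (fun j => m j))) :> fn R.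
    by apply/funext => y; rewrite fct_sumE.
  by apply: cdiff_continuous; apply: cdiff_sum => k y; exact: cdiff_mon.
apply: etrans sint_cst0; apply: eq_sint => t p.
by rewrite lap0 mulr0.
Qed.

End SphereIntegral.

(** * Radial functions and the Wronskian form *)

Section RadialFunctions.
Variable R : realType.
Implicit Types (f g : fn R) (h : R -> R[i]) (x : 'cV[R]_3) (i : 'I_3).

Lemma rad_sqr x : rad x ^+ 2 = \sum_i x i 0 ^+ 2.
Proof. by rewrite /rad sqr_sqrtr// sumr_ge0// => i _; rewrite sqr_ge0. Qed.

Lemma sumsq_gt0 x : x != 0 -> 0 < \sum_i x i 0 ^+ 2.
Proof.
move=> x0; rewrite lt_neqAle sumr_ge0 ?andbT; last by move=> i _; rewrite sqr_ge0.
apply: contra x0 => /eqP/esym/eqP; rewrite psumr_eq0; last by move=> i _; rewrite sqr_ge0.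
move=> /allP h; apply/eqP/matrixP => i j; rewrite (ord1 j) mxE; apply/eqP.
by have := h i (mem_index_enum _); rewrite /= sqrf_eq0.
Qed.

Lemma rad_gt0 x : x != 0 -> 0 < rad x.
Proof. by move=> x0; rewrite /rad sqrtr_gt0 sumsq_gt0. Qed.

Lemma differentiable_sumsq x : differentiable (fun y : 'cV[R]_3 => \sum_i y i 0 ^+ 2) x.
Proof.
have -> : (fun y : 'cV[R]_3 => \sum_i y i 0 ^+ 2) = \sum_(i < 3) (fun y : 'cV[R]_3 => y i 0) ^+ 2.
  by apply/funext => y; rewrite fct_sumE; apply: eq_bigr => i _; rewrite exprfctE.
apply: differentiable_sum => i; apply: differentiableX; exact: differentiable_coord.
Qed.

Lemma differentiable_rad x : x != 0 -> differentiable (@rad R) x.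
Proof.
move=> x0; apply: (@differentiable_comp _ _ _ _ (fun y : 'cV[R]_3 => \sum_i y i 0 ^+ 2) Num.sqrt).
  exact: differentiable_sumsq.
apply/derivable1_diffP; apply: ex_derive; apply: is_derive1_sqrt; exact: sumsq_gt0.
Qed.

Lemma is_derive_line_sum x i : is_derive (0 : R) (1 : R)
  (fun t : R => \sum_j (t *: delta_mx i 0 + x) j 0 ^+ 2) (2 * x i 0).
Proof.
pose C := \sum_(j | j != i) x j 0 ^+ 2.
have -> : (fun t : R => \sum_j (t *: delta_mx i 0 + x) j 0 ^+ 2) =
    (fun t => (t + x i 0) ^+ 2 + C).
  apply/funext => t; rewrite (bigD1 i)//= !mxE !eqxx mulr1; congr (_ + _).
  by apply: eq_bigr => j /negPf ji; rewrite !mxE ji mulr0 add0r.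
have d1 : is_derive (0 : R) (1 : R) (fun h : R => h + x i 0) 1.
  by have := is_deriveD (is_derive_id (0 : R) (1 : R)) (is_derive_cst (x i 0) (0 : R) (1 : R)); rewrite addr0.
have h := is_deriveD (is_deriveX_fun 2 d1) (is_derive_cst C (0 : R) (1 : R)).
by apply: is_derive_eq h _; rewrite /= add0r expr1 mulr1 addr0.
Qed.

Lemma is_derive_line_rad x i : x != 0 -> is_derive (0 : R) (1 : R)
  (fun t : R => rad (t *: delta_mx i 0 + x)) (x i 0 / rad x).
Proof.
move=> x0.
have E : \sum_j (0 *: delta_mx i 0 + x) j 0 ^+ 2 = \sum_j x j 0 ^+ 2.
  by rewrite scale0r add0r.
have ds : is_derive ((fun t : R => \sum_j (t *: delta_mx i 0 + x) j 0 ^+ 2) 0) (1 : R)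
    Num.sqrt (2 * Num.sqrt (\sum_j x j 0 ^+ 2))^-1.
  by rewrite /= E; apply: is_derive1_sqrt; exact: sumsq_gt0.
have h := @is_derive1_comp _ _ _ _ _ _ ds (is_derive_line_sum x i).
apply: is_derive_eq h _; rewrite -/(rad x).
have : rad x != 0 by rewrite gt_eqF// rad_gt0.
by move=> ?; field.
Qed.

Definition rfun h : fn R := off0 (fun x => h (rad x)).

Definition rderivable h (r : R) :=
  derivable (fun t => complex.Re (h t)) r (1 : R) /\
  derivable (fun t => complex.Im (h t)) r (1 : R).

Lemma near_neq0 x : x != 0 -> \forall y \near x, y != 0.
Proof. by move=> x0; apply: (open_nbhs_nbhs (conj (@open_neq0 R) _)). Qed.

Lemma near_off0 (k : 'cV[R]_3 -> R[i]) x : x != 0 ->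
  \forall y \near x, k y = off0 k y.
Proof. by move=> x0; apply: filterS (near_neq0 x0) => y y0; rewrite off0E. Qed.

Lemma cdiff_off0 (k : fn R) x : x != 0 -> cdiff k x -> cdiff (off0 k) x.
Proof. by move=> x0; apply: near_cdiff; exact: near_off0. Qed.

Lemma pd_off0 (k : fn R) x i : x != 0 -> pd i (off0 k) x = pd i k x.
Proof.
by move=> x0; apply: near_pd; apply: filterS (near_off0 k x0) => y ->.
Qed.

Lemma cdiff_rad h x : x != 0 -> rderivable h (rad x) -> cdiff (fun y => h (rad y)) x.
Proof.
move=> x0 [/derivable1_diffP d1 /derivable1_diffP d2]; split.
  exact: (@differentiable_comp _ _ _ _ (@rad R) (fun t => complex.Re (h t)) x (differentiable_rad x0) d1).
exact: (@differentiable_comp _ _ _ _ (@rad R) (fun t => complex.Im (h t)) x (differentiable_rad x0) d2).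
Qed.

Lemma cdiff_rfun h x : x != 0 -> rderivable h (rad x) -> cdiff (rfun h) x.
Proof. by move=> x0 dh; apply: cdiff_off0 => //; exact: cdiff_rad. Qed.

Lemma derive_comp_rad (u : R -> R) x i : x != 0 -> derivable u (rad x) (1 : R) ->
  'D_(delta_mx i 0) (fun y => u (rad y)) x = x i 0 / rad x * derive1 u (rad x).
Proof.
move=> x0 du.
have du' : is_derive (rad (0 *: delta_mx i 0 + x)) (1 : R) u (derive1 u (rad x)).
  rewrite scale0r add0r derive1E; exact: derivableP.
have h := @is_derive1_comp _ u (fun t : R => rad (t *: delta_mx i 0 + x)) _ _ _ du'
  (is_derive_line_rad i x0).
by rewrite (derive_line_eq _ h)// mulrC.
Qed.

Lemma pd_rfun h x i : x != 0 -> rderivable h (rad x) ->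
  pd i (rfun h) x = (x i 0 / rad x)%:C * rderiv h (rad x).
Proof.
move=> x0 [d1 d2]; rewrite /rfun pd_off0// /pd /rderiv.
rewrite (derive_comp_rad i x0 d1) (derive_comp_rad i x0 d2).
by apply: complex_eqP; rewrite ?cReM ?cImM/= mul0r ?subr0 ?addr0.
Qed.

Lemma sum_dir x : x != 0 -> \sum_i (x i 0 / rad x)%:C * (x i 0 / rad x)%:C = 1 :> R[i].
Proof.
move=> x0; have r0 : rad x != 0 by rewrite gt_eqF// rad_gt0.
transitivity ((\sum_i x i 0 ^+ 2 / rad x ^+ 2)%:C : R[i]).
  rewrite rmorph_sum; apply: eq_bigr => i _; rewrite -rmorphM/=; congr (_ %:C).
  by field.
by rewrite -mulr_suml -rad_sqr divff ?expf_neq0.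
Qed.

Lemma rd_rfun h x : x != 0 -> rderivable h (rad x) ->
  radial_derivative (rfun h) x = rderiv h (rad x).
Proof.
move=> x0 dh; rewrite /radial_derivative.
under eq_bigr do rewrite (pd_rfun _ x0 dh) mulrA.
by rewrite -mulr_suml sum_dir// mul1r.
Qed.

Lemma cdiff_dir x i : x != 0 -> cdiff (fun y => (y i 0 / rad y)%:C) x.
Proof.
move=> x0; apply: cdiff_real; apply: differentiableM.
  exact: differentiable_coord.
by apply: differentiableV; [exact: differentiable_rad|rewrite gt_eqF// rad_gt0].
Qed.

Lemma pd_dir x i : x != 0 ->
  pd i (fun y => (y i 0 / rad y)%:C) x = ((rad x)^-1 - x i 0 ^+ 2 / rad x ^+ 3)%:C.
Proof.
move=> x0; rewrite pd_real; congr (_ %:C).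
have r0 : rad x != 0 by rewrite gt_eqF// rad_gt0.
have d1 : is_derive (0 : R) (1 : R) (fun h : R => h + x i 0) 1.
  by have := is_deriveD (is_derive_id (0 : R) (1 : R)) (is_derive_cst (x i 0) (0 : R) (1 : R)); rewrite addr0.
have r0' : (fun t : R => rad (t *: delta_mx i 0 + x)) 0 != 0.
  by rewrite /= scale0r add0r.
have h := is_deriveM_fun d1 (@is_deriveV R (fun t : R => rad (t *: delta_mx i 0 + x)) 0 _ 1 r0'
  (is_derive_line_rad i x0)).
rewrite (derive_line_eq _ h); last by move=> t; rewrite !mxE !eqxx mulr1.
by rewrite scale0r !add0r mul1r -[_ *: (_ / _)]/(_ * (_ / _)); field.
Qed.

Lemma laplacian_rfun h x : x != 0 -> (forall r, 0 < r -> rderivable h r) ->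
  (forall r, 0 < r -> rderivable (rderiv h) r) ->
  laplacian (rfun h) x = rderiv (rderiv h) (rad x) + (2 / rad x)%:C * rderiv h (rad x).
Proof.
move=> x0 d1 d2; rewrite /laplacian; have r0 := rad_gt0 x0.
have E i : pd i (pd i (rfun h)) x =
    (x i 0 / rad x)%:C * (x i 0 / rad x)%:C * rderiv (rderiv h) (rad x) +
    ((rad x)^-1 - x i 0 ^+ 2 / rad x ^+ 3)%:C * rderiv h (rad x).
  rewrite (@near_pd _ _ (fun y => (y i 0 / rad y)%:C * rfun (rderiv h) y)); last first.
    apply: filterS (near_neq0 x0) => y y0.
    by rewrite pd_rfun//; [rewrite /rfun off0E|exact/d1/rad_gt0].
  rewrite pdM; [|exact: cdiff_dir|apply: cdiff_rfun => //; exact: d2].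
  rewrite pd_dir// pd_rfun//; last exact: d2.
  by rewrite /rfun off0E// mulrA addrC.
rewrite (eq_bigr _ (fun i _ => E i)) big_split/= -!mulr_suml sum_dir// mul1r.
(* Summed over the three coordinates, 1/r - x_i^2/r^3 gives 3/r - 1/r. *)
congr (_ + _ * _); rewrite -rmorph_sum/=; congr (_ %:C).
rewrite sumrB -mulr_suml -rad_sqr sumr_const card_ord.
by field; rewrite gt_eqF.
Qed.

End RadialFunctions.

(** * The Wronskian form on sufficiently regular functions *)

Section WronskianForm.
Variable R : realType.
Implicit Types (f g : fn R) (h : R -> R[i]) (x : 'cV[R]_3) (i : 'I_3).
Local Notation rd := (@radial_derivative R).

(** Enough regularity for the Wronskian integrand to be continuous on the sphere; the class contains
    [Cinf0] and the functions [regfn] with harmonic angular part. *)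
Definition nice f := (forall x, x != 0 -> cdiff f x) /\
  (forall x, x != 0 -> {for x, continuous (rd f)}).

Lemma rdZD (a : R[i]) f g x : cdiff f x -> cdiff g x ->
  rd (a *: f + g) x = a * rd f x + rd g x.
Proof.
move=> df dg; rewrite /radial_derivative mulr_sumr -big_split/=.
apply: eq_bigr => i _; rewrite pdD//; last exact: cdiffZ.
by rewrite pdZ// mulrDr mulrCA.
Qed.

Lemma rdM f g x : cdiff f x -> cdiff g x ->
  rd (fun y => f y * g y) x = rd f x * g x + f x * rd g x.
Proof.
move=> df dg; rewrite /radial_derivative mulr_sumr mulr_suml -big_split/=.
apply: eq_bigr => i _; rewrite pdM//.
have E (a b c d e : R[i]) : a * (b * c + d * e) = a * b * c + d * (a * e) by ring.
exact: E.
Qed.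

Lemma cont0_near (f g : fn R) : (forall x, x != 0 -> f x = g x) ->
  (forall x, x != 0 -> {for x, continuous f}) -> forall x, x != 0 -> {for x, continuous g}.
Proof.
move=> fg cf x x0; have fgn : {near x, f =1 g}.
  by near=> y; apply: fg; near: y; exact: near_neq0.
have := cf x x0; rewrite /prop_for /continuous_at -(fg x x0).
exact: cvg_trans (near_eq_cvg fgn).
Unshelve. all: by end_near. Qed.

Lemma nice0 : nice 0.
Proof.
have r0 x : rd 0 x = 0.
  by rewrite /radial_derivative big1// => i _; rewrite (pd_cst 0) mulr0.
split=> x x0; first exact: cdiff_cst.
have -> : rd 0 = 0 by apply/funext.
exact: (cdiff_continuous (cdiff_cst (0 : R[i]) x)).
Qed.

Lemma contM f g x : {for x, continuous f} -> {for x, continuous g} ->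
  {for x, continuous (fun y => f y * g y : R[i]^o)}.
Proof. by move=> cf cg; exact: (cvgCM cf cg). Qed.

Lemma contD f g x : {for x, continuous f} -> {for x, continuous g} ->
  {for x, continuous (fun y => f y + g y : R[i]^o)}.
Proof. by move=> cf cg; exact: (cvgCD cf cg). Qed.

Lemma contB f g x : {for x, continuous f} -> {for x, continuous g} ->
  {for x, continuous (fun y => f y - g y : R[i]^o)}.
Proof. by move=> cf cg; exact: (cvgCB cf cg). Qed.

Lemma cont_cst (a : R[i]) x : {for x, continuous ((fun=> a) : fn R)}.
Proof. exact: (cdiff_continuous (cdiff_cst a x)). Qed.

Lemma niceZD (a : R[i]) f g : nice f -> nice g -> nice (a *: f + g).
Proof.
move=> [df cf] [dg cg]; split=> x x0; first by apply: cdiffD; [exact/cdiffZ/df|exact: dg].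
apply: (@cont0_near (fun x => a * rd f x + rd g x)) x0 => {}x x0.
  by rewrite rdZD//; [exact: df|exact: dg].
apply: contD; last exact: cg.
by apply: contM; [exact: cont_cst|exact: cf].
Qed.

Lemma nice_rd_sum (I : Type) (r : seq I) (P : pred I) (c : I -> R[i]) (F : I -> fn R) :
  (forall k, P k -> nice (F k)) ->
  nice (\sum_(k <- r | P k) c k *: F k) /\
  forall x, x != 0 -> rd (\sum_(k <- r | P k) c k *: F k) x =
    \sum_(k <- r | P k) c k * rd (F k) x.
Proof.
move=> nF; elim: r => [|k r [ih1 ih2]].
  rewrite big_nil; split=> [|x x0]; first exact: nice0.
  by rewrite big_nil /radial_derivative big1// => i _; rewrite (pd_cst 0) mulr0.
rewrite big_cons; case: ifPn => [Pk|nPk].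
  split=> [|x x0]; first exact: (niceZD (c k) (nF k Pk) ih1).
  by rewrite big_cons Pk (rdZD (c k) ((nF k Pk).1 x x0) (ih1.1 x x0)) ih2.
by split=> // x x0; rewrite big_cons (negPf nPk) ih2.
Qed.

Lemma eq_smean f g : (forall x, x != 0 -> f x = g x) -> smean f = smean g.
Proof. by move=> fg; apply: eq_sint => t p; rewrite fg// sphere_neq0. Qed.

Definition wrint f g : fn R := fun x => rd f x * g x - f x * rd g x.

Lemma WrE f g : Wr f g = ((4 * pi)^-1)%:C * smean (wrint f g).
Proof.
have E : sint (fun t p => let x := 1 *: sphere_pt t p in
    (1 ^+ 2 * sin t)%:C * (rd f x * g x - f x * rd g x)) = smean (wrint f g).
  by apply: eq_sint => t p; rewrite /= scale1r expr1n mul1r.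
exact: (congr1 (fun u => ((4 * pi)^-1)%:C * u) E).
Qed.

Lemma wrint_cont f g : nice f -> nice g ->
  forall x, x != 0 -> {for x, continuous (wrint f g)}.
Proof.
move=> [df cf] [dg cg] x x0; apply: contB; apply: contM.
- exact: cf.
- exact: cdiff_continuous (dg x x0).
- exact: cdiff_continuous (df x x0).
- exact: cg.
Qed.

Lemma Wr_suml (I : Type) (r : seq I) (P : pred I) (c : I -> R[i]) (F : I -> fn R) g :
  (forall k, P k -> nice (F k)) -> nice g ->
  Wr (\sum_(k <- r | P k) c k *: F k) g = \sum_(k <- r | P k) c k * Wr (F k) g.
Proof.
move=> nF ng; have [nS rS] := nice_rd_sum r c nF.
rewrite WrE (@eq_smean _ (fun x => \sum_(k <- r | P k) c k * wrint (F k) g x)); last first.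
  move=> x x0; rewrite /wrint rS// fct_sumE !mulr_suml -sumrB; apply: eq_bigr => k _.
  by rewrite -!mulrA -mulrBr.
rewrite (@smean_sum R I r P c (fun k => wrint (F k) g)); last first.
  by move=> k Pk; exact: (wrint_cont (nF k Pk) ng).
by rewrite mulr_sumr; apply: eq_bigr => k _; rewrite WrE mulrCA.
Qed.

Lemma Wr_sumr (I : Type) (r : seq I) (P : pred I) (c : I -> R[i]) (F : I -> fn R) g :
  (forall k, P k -> nice (F k)) -> nice g ->
  Wr g (\sum_(k <- r | P k) c k *: F k) = \sum_(k <- r | P k) c k * Wr g (F k).
Proof.
move=> nF ng; have [nS rS] := nice_rd_sum r c nF.
rewrite WrE (@eq_smean _ (fun x => \sum_(k <- r | P k) c k * wrint g (F k) x)); last first.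
  move=> x x0; rewrite /wrint rS// fct_sumE !mulr_sumr -sumrB; apply: eq_bigr => k _.
  by rewrite mulrBr; congr (_ - _); rewrite mulrCA.
rewrite (@smean_sum R I r P c (fun k => wrint g (F k))); last first.
  by move=> k Pk; exact: (wrint_cont ng (nF k Pk)).
by rewrite mulr_sumr; apply: eq_bigr => k _; rewrite WrE mulrCA.
Qed.

Lemma Cinf0_nice f : Cinf0 f -> nice f.
Proof.
move=> [_ sf]; split=> x x0; first exact: sf [::] x x0.
apply: (@cont0_near (fun y =>
   ((y 0 0 / rad y)%:C * pd 0 f y) + ((y 1 0 / rad y)%:C * pd 1 f y) +
    ((y (1 + 1) 0 / rad y)%:C * pd (1 + 1) f y))) x0 => {}x x0; first by rewrite /radial_derivative sum3.
have c i : {for x, continuous (fun y : 'cV[R]_3 => (y i 0 / rad y)%:C * pd i f y : R[i]^o)}.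
  apply: (@contM (fun y => (y i 0 / rad y)%:C) (pd i f)); first exact: cdiff_continuous (cdiff_dir i x0).
  exact: cdiff_continuous (sf [:: i] x x0).
by apply: contD; [apply: contD|]; exact: c.
Qed.

Lemma smean_cst (k : R[i]) : smean (fun=> k) = (4 * pi)%:C * k.
Proof.
have E : smean (mon (fun=> 0%N)) = (4 * pi)%:C :> R[i].
  rewrite smean_mon; congr (_ %:C).
  have -> : polar_moment R (0 + 0).+1 0 = 2.
    have d (t : R) : is_derive t (1 : R) (fun t => - cos t) (sin t ^+ 1 * cos t ^+ 0).
      apply: is_derive_eq (is_deriveN (is_derive_cos t)) _.
      by rewrite opprK expr1 expr0 mulr1.
    apply: etrans (Rintegral_FTC (pi_gt0 R) (@continuous_sincos R 1 0) d) _.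
    by rewrite cospi cos0 opprK.
  have -> : azimuth_moment R 0 0 = 2 * pi.
    have d (t : R) : is_derive t (1 : R) id (cos t ^+ 0 * sin t ^+ 0).
      by apply: is_derive_eq (is_derive_id t (1 : R)) _; rewrite !expr0 mulr1.
    have pi2 : 0 < 2 * pi :> R by rewrite mulr_gt0// pi_gt0.
    by apply: etrans (Rintegral_FTC pi2 (@continuous_cossin R 0 0) d) _; rewrite subr0.
  by ring.
have m0 x : mon (fun=> 0%N) x = 1 :> R[i].
  by rewrite /mon big1.
rewrite -E mulrC -[RHS]/(k * _) /smean -sintZ; last first.
  by apply: smean_jcont => x _; exact: cdiff_continuous (cdiff_mon _ _).
by apply: eq_sint => t p; rewrite m0 mulr1 mulrC.
Qed.

Definition rsmooth2 h := forall r, 0 < r -> rderivable h r /\ rderivable (rderiv h) r.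

Lemma nice_rfun h : rsmooth2 h -> nice (rfun h).
Proof.
move=> sh; split=> x x0; first by apply: cdiff_rfun => //; exact: (sh _ (rad_gt0 x0)).1.
apply: (@cont0_near (rfun (rderiv h))) x0 => {}x x0.
  by rewrite rd_rfun ?/rfun ?off0E//; exact: (sh _ (rad_gt0 x0)).1.
by apply: cdiff_continuous; apply: cdiff_rfun => //; exact: (sh _ (rad_gt0 x0)).2.
Qed.

Definition wr1 h1 h2 : R[i] := rderiv h1 1 * h2 1 - h1 1 * rderiv h2 1.

Definition ang (P : fn R) : fn R := fun x => P ((rad x)^-1 *: x).

Lemma ang_hpolyE l c x : x != 0 ->
  ang (@hpoly R l c) x = (rad x ^- l)%:C * hpoly c x.
Proof. by move=> x0; rewrite /ang hpoly_homog exprVn. Qed.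

Lemma cdiff_ang l c x : x != 0 -> cdiff (ang (@hpoly R l c)) x.
Proof.
move=> x0; apply: (@near_cdiff _ (fun x => (rad x ^- l)%:C * hpoly c x)).
  by apply: filterS (near_neq0 x0) => y y0; rewrite ang_hpolyE.
apply: cdiffM; last exact: cdiff_hpoly.
have r0 : rad x != 0 by rewrite gt_eqF// rad_gt0.
apply: cdiff_real; apply: (@differentiableV _ _ (fun y => rad y ^+ l)); last by rewrite expf_neq0.
have -> : (fun y : 'cV[R]_3 => rad y ^+ l) = @rad R ^+ l.
  by apply/funext => y; rewrite exprfctE.
case: l {c} => [|n]; first by rewrite expr0; exact: differentiable_cst.
by apply: differentiableX; exact: differentiable_rad.
Qed.

(* Euler: the derivative of a function homogeneous of degree 0 along x vanishes. *)
Lemma rd_ang l c x : x != 0 -> rd (ang (@hpoly R l c)) x = 0.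
Proof.
move=> x0; have [d1 d2] := cdiff_ang c x0.
have angs (t : R) : 0 < t -> ang (hpoly c) (t *: x) = ang (hpoly c) x.
  move=> t0; rewrite /ang; congr (hpoly c _).
  have -> : rad (t *: x) = t * rad x.
    rewrite /rad; under eq_bigr do rewrite mxE exprMn.
    by rewrite -mulr_sumr sqrtrM ?sqr_ge0// sqrtr_sqr gtr0_norm.
  by rewrite scalerA invfM mulrAC mulVf ?gt_eqF// mul1r.
have key (u : 'cV[R]_3 -> R) : differentiable u x -> (forall t : R, 0 < t -> u (t *: x) = u x) ->
    \sum_i x i 0 / rad x * 'D_(delta_mx i 0) u x = 0.
  move=> du hu.
  have E : x = \sum_i x i 0 *: delta_mx i 0.
    rewrite {1}[x]matrix_sum_delta; apply: eq_bigr => i _.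
    by rewrite big_ord1.
  have -> : \sum_i x i 0 / rad x * 'D_(delta_mx i 0) u x = (rad x)^-1 * 'D_x u x.
    have L : 'd u x x = \sum_i x i 0 * 'd u x (delta_mx i 0) :> R.
      transitivity ('d u x (\sum_i x i 0 *: delta_mx i 0)); first by rewrite -E.
      by rewrite linear_sum; apply: eq_bigr => i _; rewrite linearZ.
    rewrite [in RHS](deriveE x du) L mulr_sumr; apply: eq_bigr => i _.
    by rewrite deriveE// mulrCA mulrA.
  suff -> : 'D_x u x = 0 by rewrite mulr0.
  rewrite derive_line (@near_eq_derive _ _ _ _ (fun=> u x)) ?derive_cst//.
  near=> t; rewrite -[X in _ *: x + X]scale1r -scalerDl hu//.
  rewrite -ltrBlDr sub0r; near: t; apply: lt_nbhsr.
  by rewrite oppr_lt0.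
apply: complex_eqP; rewrite /radial_derivative ?cRe_sum ?cIm_sum.
  rewrite -[RHS](key _ d1); last by move=> t t0; rewrite angs.
  by apply: eq_bigr => i _; rewrite cReM /= mul0r subr0.
rewrite -[RHS](key _ d2); last by move=> t t0; rewrite angs.
by apply: eq_bigr => i _; rewrite cImM /= mul0r addr0.
Unshelve. all: by end_near. Qed.

Lemma regfn_angE (gamma : R) l z (P : fn R) x :
  regfn gamma l z P x = rfun (Frad gamma l z) x * ang P x.
Proof.
rewrite /regfn /rfun; have [->|x0] := eqVneq x 0; first by rewrite !off0_0 mul0r.
by rewrite !off0E.
Qed.

Lemma rd_regfn (gamma : R) l z c x : rsmooth2 (Frad gamma l z) -> x != 0 ->
  rd (regfn gamma l z (@hpoly R l c)) x = rderiv (Frad gamma l z) (rad x) * ang (hpoly c) x.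
Proof.
set F := Frad gamma l z => sF x0; have [dF cF] := nice_rfun sF.
have -> : regfn gamma l z (hpoly c) = fun x => rfun F x * ang (hpoly c) x.
  by apply/funext => y; exact: regfn_angE.
rewrite rdM; [|exact: dF|exact: cdiff_ang].
by rewrite rd_ang// mulr0 addr0 rd_rfun//; exact: (sF _ (rad_gt0 x0)).1.
Qed.

Lemma nice_regfn (gamma : R) l z c : rsmooth2 (Frad gamma l z) ->
  nice (regfn gamma l z (@hpoly R l c)).
Proof.
move=> sF; have [dF cF] := nice_rfun sF.
split=> x x0.
  have -> : regfn gamma l z (hpoly c) = fun x => rfun (Frad gamma l z) x * ang (hpoly c) x.
    by apply/funext => y; exact: regfn_angE.
  by apply: cdiffM; [exact: dF|exact: cdiff_ang].
apply: (@cont0_near (fun x => rd (rfun (Frad gamma l z)) x * ang (hpoly c) x)) x0 => {}x x0.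
  by rewrite rd_regfn// rd_rfun//; exact: (sF _ (rad_gt0 x0)).1.
by apply: contM; [exact: cF|exact: cdiff_continuous (cdiff_ang _ x0)].
Qed.

Lemma smean_scaled (k : R[i]) f : (forall x, x != 0 -> {for x, continuous f}) ->
  smean (fun x => k * f x) = k * smean f.
Proof.
move=> cf; rewrite /smean -sintZ; last exact: smean_jcont.
by apply: eq_sint => t p; rewrite mulrCA.
Qed.

(** The angular factor has zero radial derivative, so on the unit sphere the integrand is the radial
    Wronskian at r = 1 times the polynomial. *)
Lemma Wr_regfn_rfun (gamma : R) l z c h : rsmooth2 (Frad gamma l z) -> rsmooth2 h ->
  Wr (regfn gamma l z (@hpoly R l c)) (rfun h) =
  ((4 * pi)^-1)%:C * (wr1 (Frad gamma l z) h * smean (@hpoly R l c)).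
Proof.
move=> sF sh; rewrite WrE; congr (_ * _).
rewrite -smean_scaled; last by move=> x _; exact: cdiff_continuous (cdiff_hpoly _ _).
apply: eq_sint => t p; congr (_ * _); have s0 := sphere_neq0 t p.
rewrite /wrint rd_regfn// rd_rfun//; last exact: (sh _ (rad_gt0 s0)).1.
rewrite regfn_angE /rfun !off0E// /ang rad_sphere invr1 scale1r /wr1.
have E (a b k d e : R[i]) : a * e * b - k * e * d = (a * b - k * d) * e by ring.
exact: E.
Qed.

Lemma Wr_rfun h1 h2 : rsmooth2 h1 -> rsmooth2 h2 ->
  Wr (rfun h1) (rfun h2) = wr1 h1 h2.
Proof.
move=> s1 s2; rewrite WrE.
have -> : smean (wrint (rfun h1) (rfun h2)) = smean (fun=> wr1 h1 h2).
  apply: eq_sint => t p; congr (_ * _); have s0 := sphere_neq0 t p.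
  rewrite /wrint !rd_rfun//; [|exact: (s2 _ (rad_gt0 s0)).1|exact: (s1 _ (rad_gt0 s0)).1].
  by rewrite /rfun !off0E// rad_sphere.
rewrite smean_cst mulrA -rmorphM/= mulVf ?mul1r//.
by rewrite mulf_neq0// gt_eqF// pi_gt0.
Qed.

End WronskianForm.

(** * The regular radial solution *)

Section EntireSeries.
Variable R : realType.
Implicit Types (c d : nat -> R) (x r : R).

Definition entire c := forall x, cvgn (pseries c x).
Definition psum c x : R := limn (pseries c x).
Definition shift_coef c : nat -> R := fun k => if k is k'.+1 then c k' else 0.

Lemma psumP c x : entire c -> pseries c x @ \oo --> psum c x.
Proof. by move=> ec; exact: ec. Qed.

(** The factor n + 1 of termwise differentiation is absorbed by 2^(n+1), so absolute convergence at
    a point at least twice as far out is enough. *)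
Lemma entire_diffs c : entire c -> entire (pseries_diffs c).
Proof.
move=> ec x.
(* The lower bound 1 on m gives |x|^n <= m^(n+1). Absolute convergence at y follows from convergence
   at y + 1. *)
pose m := Num.max `|x| 1; pose y := 2 * m.
have m0 : 0 <= m by rewrite le_max normr_ge0.
have m1 : 1 <= m by rewrite le_max lexx orbT.
have xm : `|x| <= m by rewrite le_max lexx.
have y0 : 0 <= y by rewrite mulr_ge0.
have yy : `|y| < `|y + 1|.
  by rewrite !ger0_norm ?addr_ge0// ltrDl.
have := is_cvg_pseries_inside_norm (ec (y + 1)) yy.
rewrite /pseries -(is_cvg_series_restrict 1) /=.
move=> /cvg_ex[/= l hl].
have hl' : [series `|c i.+1| * y ^+ i.+1]_i @ \oo --> l.
  move: hl; rewrite -cvg_shiftS /=.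
  rewrite (_ : (fun n => _) = [series `|c i.+1| * y ^+ i.+1]_i)//.
  by apply/funext => n; rewrite /series/= big_add1.
apply: normed_cvg.
apply: (@series_le_cvg _ _ (fun i => `|c i.+1| * y ^+ i.+1)) => [n|n|n|].
- exact: normr_ge0.
- by rewrite mulr_ge0// exprn_ge0.
- rewrite /= /pseries_diffs !normrM normr_nat [n.+1%:R * _]mulrC -mulrA.
  apply: ler_wpM2l => //; rewrite /y exprMn; apply: ler_pM => //.
    by rewrite -natrX ler_nat ltnW// ltn_expl.
  rewrite normrX (@le_trans _ _ (m ^+ n))//; first by rewrite lerXn2r// nnegrE.
  by rewrite exprS ler_peMl// exprn_ge0.
- by apply/cvg_ex; exists l.
Qed.

Lemma is_derive_psum c x : entire c -> is_derive x (1 : R) (psum c) (psum (pseries_diffs c) x).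
Proof.
move=> ec; apply: (@pseries_snd_diffs _ c (`|x| + 1)).
- exact: ec.
- exact: entire_diffs.
- exact/entire_diffs/entire_diffs.
- by rewrite [ltRHS]ger0_norm ?addr_ge0// ltrDl.
Qed.

Lemma psum_continuous c : entire c -> continuous (psum c).
Proof.
move=> ec x; apply: differentiable_continuous; apply/derivable1_diffP.
by apply: ex_derive; exact: is_derive_psum.
Qed.

Lemma pseries_add c d x : pseries (fun k => c k + d k) x = pseries c x + pseries d x.
Proof.
by apply/funext => n; rewrite fctE /pseries /series/= -big_split/=; apply: eq_bigr => k _; rewrite mulrDl.
Qed.

Lemma pseries_scale (k : R) c x : pseries (fun i => k * c i) x = (fun n => k * pseries c x n).
Proof.
by apply/funext => n; rewrite /pseries /series/= mulr_sumr; apply: eq_bigr => i _; rewrite mulrA.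
Qed.

Lemma entireD c d : entire c -> entire d -> entire (fun k => c k + d k).
Proof. by move=> ec ed x; rewrite pseries_add; apply: is_cvgD; [exact: ec|exact: ed]. Qed.

Lemma entireZ (k : R) c : entire c -> entire (fun i => k * c i).
Proof.
move=> ec x; rewrite pseries_scale; apply: is_cvgM; first exact: is_cvg_cst.
exact: ec.
Qed.

Lemma psumD c d x : entire c -> entire d ->
  psum (fun k => c k + d k) x = psum c x + psum d x.
Proof.
move=> ec ed; apply: cvg_lim => //; rewrite pseries_add.
by apply: cvgD; exact: psumP.
Qed.

Lemma psumZ (k : R) c x : entire c -> psum (fun i => k * c i) x = k * psum c x.
Proof.
move=> ec; apply: cvg_lim => //; rewrite pseries_scale.
by apply: cvgM; [exact: cvg_cst|exact: psumP].
Qed.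

Lemma psum_shift_cvg c x : entire c -> pseries (shift_coef c) x @ \oo --> x * psum c x.
Proof.
move=> ec; rewrite -cvg_shiftS /=.
have -> : (fun n => pseries (shift_coef c) x n.+1) = (fun n => x * pseries c x n).
  apply/funext => n; rewrite /pseries /series/= big_nat_recl// mul0r add0r mulr_sumr.
  by apply: eq_bigr => i _; rewrite exprS mulrCA.
by apply: cvgM; [exact: cvg_cst|exact: psumP].
Qed.

Lemma entire_shift c : entire c -> entire (shift_coef c).
Proof. by move=> ec x; apply: (cvgP (x * psum c x)); exact: psum_shift_cvg. Qed.

Lemma psum_shift c x : entire c -> psum (shift_coef c) x = x * psum c x.
Proof. by move=> ec; apply: cvg_lim => //; exact: psum_shift_cvg. Qed.

Lemma psum0 c : psum c 0 = c 0%N.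
Proof.
apply: cvg_lim => //; rewrite -cvg_shiftS.
have -> : (fun n => pseries c 0 n.+1) = (fun=> c 0%N).
  apply/funext => n; rewrite /pseries /series/= big_nat_recl// expr0 mulr1 big1 ?addr0//.
  by move=> i _; rewrite expr0n mulr0.
exact: cvg_cst.
Qed.

(** The coefficient c 0 is the limit of the sum at 0+, and the differentiated series vanishes on r >
    0 too, which lowers the index. *)
Lemma psum_eq0 c : entire c -> (forall r, 0 < r -> psum c r = 0) -> forall k, c k = 0.
Proof.
move=> ec c0 k; elim: k c ec c0 => [|k ih] c ec c0.
  rewrite -psum0; apply: (@cvg_unique _ (@Rhausdorff R) ((psum c x) @[x --> (0 : R)^'+])).
    by apply: cvg_at_right_filter; exact: psum_continuous.
  apply: (@cvg_trans _ ((fun=> 0 : R) @ ((0 : R)^'+))); last exact: cvg_cst.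
  apply: near_eq_cvg; near=> r.
  by rewrite c0//; near: r; exact: nbhs_right_gt.
have : pseries_diffs c k = 0.
  apply: ih; first exact: entire_diffs.
  move=> r r0; have [_ <-] := is_derive_psum r ec.
  rewrite (@near_eq_derive _ _ _ _ (fun=> 0)) ?derive_cst//.
  by near=> t; apply: c0; near: t; exact: lt_nbhsr.
by move=> /eqP; rewrite mulf_eq0 pnatr_eq0/= => /eqP.
Unshelve. all: by end_near. Qed.

(** The exponential series is the majorant. The value at 1 is bounded linearly in K, so a Lipschitz
    bound on coefficients becomes one on the sum. *)
Lemma psum_bound c (K M : R) : 0 <= M ->
  (forall k, `|c k| <= K * (M ^+ k / k`!%:R)) -> entire c /\ `|psum c 1| <= K * expR M.
Proof.
move=> M0 cb.
have K0 : 0 <= K.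
  by have := cb 0%N; rewrite expr0 fact0 divr1 mulr1; exact: le_trans.
have ec : entire c.
  move=> x; apply: normed_cvg.
  apply: (@series_le_cvg _ _ (fun k => K * exp_coeff (M * `|x|) k)) => [n|n|n|].
  - exact: normr_ge0.
  - by rewrite mulr_ge0// exp_coeff_ge0// mulr_ge0.
  - rewrite /= normrM normrX /exp_coeff/= exprMn mulrAC mulrA.
    by rewrite ler_wpM2r ?exprn_ge0// -mulrA.
  - have h : cvgn (series (K *: exp_coeff (M * `|x|))).
      by apply: is_cvg_seriesZ; exact: is_cvg_series_exp_coeff.
    exact: h.
split=> //.
have h : `|pseries c 1 n| @[n --> \oo] --> `|psum c 1|.
  by apply: cvg_norm; exact: (@psumP c 1 ec).
rewrite -(cvg_lim (@Rhausdorff R) h); apply: limr_le; first exact: cvgP h.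
near=> n; rewrite /pseries /series/=; apply: (le_trans (ler_norm_sum _ _ _)).
apply: (@le_trans _ _ (K * series (exp_coeff M) n)).
  rewrite /series/= mulr_sumr; apply: ler_sum => i _.
  by rewrite expr1n mulr1; exact: cb.
rewrite ler_wpM2l//; apply: nondecreasing_cvgn_le; last exact: is_cvg_series_exp_coeff.
by apply: nondecreasing_series => i _ _; exact: exp_coeff_ge0.
Unshelve. all: by end_near. Qed.

End EntireSeries.

(** * Power series with complex coefficients in a real variable *)

Section ComplexSeries.
Variable R : realType.
Implicit Types (a b : nat -> R[i]) (r : R).

(** The modulus as an element of [R], since the norm of a complex number lives in [R[i]]; real
    majorants can then be used. *)
Definition cabs (x : R[i]) : R := Num.sqrt (complex.Re x ^+ 2 + complex.Im x ^+ 2).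

Lemma cabsE (x : R[i]) : (cabs x)%:C = `|x|.
Proof. by rewrite normc_def. Qed.

Lemma cabs_ge0 x : 0 <= cabs x. Proof. exact: sqrtr_ge0. Qed.

Lemma cabsM x y : cabs (x * y) = cabs x * cabs y.
Proof. by apply: complexI; rewrite rmorphM/= !cabsE normrM. Qed.

Lemma cabsD x y : cabs (x + y) <= cabs x + cabs y.
Proof. by rewrite -lecR rmorphD/= !cabsE ler_normD. Qed.

Lemma cabsN x : cabs (- x) = cabs x.
Proof. by apply: complexI; rewrite !cabsE normrN. Qed.

Lemma cabsR r : cabs r%:C = `|r|.
Proof. by rewrite /cabs/= expr0n addr0 sqrtr_sqr. Qed.

Lemma cabsX x n : cabs (x ^+ n) = cabs x ^+ n.
Proof. by apply: complexI; rewrite rmorphXn/= !cabsE normrX. Qed.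

Lemma Re_le_cabs x : `|complex.Re x| <= cabs x.
Proof. by rewrite -lecR cabsE Re_le_norm. Qed.

Lemma Im_le_cabs x : `|complex.Im x| <= cabs x.
Proof. by rewrite -lecR cabsE Im_le_norm. Qed.

Lemma natC n : n%:R = (n%:R : R)%:C :> R[i].
Proof. by rewrite rmorph_nat. Qed.

Lemma cRe_scale r (x : R[i]) : complex.Re (r%:C * x) = r * complex.Re x.
Proof. by rewrite cReM /= mul0r subr0. Qed.

Lemma cIm_scale r (x : R[i]) : complex.Im (r%:C * x) = r * complex.Im x.
Proof. by rewrite cImM /= mul0r addr0. Qed.

Definition entireC a := entire (@complex.Re R \o a) /\ entire (@complex.Im R \o a).
Definition psumC a r : R[i] :=
  (psum (@complex.Re R \o a) r) +i* (psum (@complex.Im R \o a) r).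
Definition diffsC a : nat -> R[i] := fun k => k.+1%:R * a k.+1.
Definition shiftC a : nat -> R[i] := fun k => if k is k'.+1 then a k' else 0.

Lemma series_Re a (y : R[i]) :
  (@complex.Re R \o [series (a k * y ^+ k : R[i]^o)]_k) = [series complex.Re (a k * y ^+ k)]_k.
Proof. by apply/funext => n; rewrite /series/= cRe_sum. Qed.

Lemma series_Im a (y : R[i]) :
  (@complex.Im R \o [series (a k * y ^+ k : R[i]^o)]_k) = [series complex.Im (a k * y ^+ k)]_k.
Proof. by apply/funext => n; rewrite /series/= cIm_sum. Qed.

Lemma series_Re_real a r :
  [series complex.Re (a k * r%:C ^+ k)]_k = pseries (@complex.Re R \o a) r.
Proof.
by apply/funext => n; apply: eq_bigr => k _; rewrite /= mulrC -rmorphXn cRe_scale mulrC.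
Qed.

Lemma series_Im_real a r :
  [series complex.Im (a k * r%:C ^+ k)]_k = pseries (@complex.Im R \o a) r.
Proof.
by apply/funext => n; apply: eq_bigr => k _; rewrite /= mulrC -rmorphXn cIm_scale mulrC.
Qed.

Lemma entireC_cvg a : (forall y : R[i], cvgn [series (a k * y ^+ k : R[i]^o)]_k) -> entireC a.
Proof.
move=> ca; split=> x; have /cvg_seqC[h1 h2] := ca x%:C.
  by rewrite series_Re series_Re_real in h1.
by rewrite series_Im series_Im_real in h2.
Qed.

Lemma limC_psumC a r : entireC a -> limn [series (a k * r%:C ^+ k : R[i]^o)]_k = psumC a r.
Proof.
move=> [e1 e2]; apply: cvg_lim; first exact: norm_hausdorff.
apply/cvgC; split.
  rewrite -[X in X --> _]/((@complex.Re R \o [series (a k * r%:C ^+ k : R[i]^o)]_k) @ \oo).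
  by rewrite series_Re series_Re_real; exact: psumP.
rewrite -[X in X --> _]/((@complex.Im R \o [series (a k * r%:C ^+ k : R[i]^o)]_k) @ \oo).
by rewrite series_Im series_Im_real; exact: psumP.
Qed.

Lemma diffsC_Re a : @complex.Re R \o diffsC a = pseries_diffs (@complex.Re R \o a).
Proof. by apply/funext => k; rewrite /= /diffsC natC cRe_scale. Qed.

Lemma diffsC_Im a : @complex.Im R \o diffsC a = pseries_diffs (@complex.Im R \o a).
Proof. by apply/funext => k; rewrite /= /diffsC natC cIm_scale. Qed.

Lemma entireC_diffs a : entireC a -> entireC (diffsC a).
Proof. by move=> [e1 e2]; split; rewrite ?diffsC_Re ?diffsC_Im; exact: entire_diffs. Qed.

Lemma rderivable_psumC a r : entireC a -> rderivable (psumC a) r.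
Proof. by move=> [e1 e2]; split; apply: ex_derive; exact: is_derive_psum. Qed.

Lemma rderiv_psumC a : entireC a -> rderiv (psumC a) = psumC (diffsC a).
Proof.
move=> [e1 e2]; apply/funext => r; rewrite /rderiv /psumC diffsC_Re diffsC_Im !derive1E.
have [_ h1] := is_derive_psum r e1; have [_ h2] := is_derive_psum r e2.
by congr (_ +i* _).
Qed.

Lemma rsmooth2_psumC a : entireC a -> rsmooth2 (psumC a).
Proof.
move=> ea r _; split; first exact: rderivable_psumC.
by rewrite rderiv_psumC//; apply: rderivable_psumC; exact: entireC_diffs.
Qed.

Lemma ReD_comp a b : @complex.Re R \o (fun k => a k + b k) =
  fun k => (@complex.Re R \o a) k + (@complex.Re R \o b) k.
Proof. by apply/funext => k; rewrite /= cReD. Qed.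

Lemma ImD_comp a b : @complex.Im R \o (fun k => a k + b k) =
  fun k => (@complex.Im R \o a) k + (@complex.Im R \o b) k.
Proof. by apply/funext => k; rewrite /= cImD. Qed.

Lemma ReZ_comp (w : R[i]) a : @complex.Re R \o (fun k => w * a k) =
  fun k => complex.Re w * (@complex.Re R \o a) k + - complex.Im w * (@complex.Im R \o a) k.
Proof. by apply/funext => k; rewrite /= cReM mulNr. Qed.

Lemma ImZ_comp (w : R[i]) a : @complex.Im R \o (fun k => w * a k) =
  fun k => complex.Re w * (@complex.Im R \o a) k + complex.Im w * (@complex.Re R \o a) k.
Proof. by apply/funext => k; rewrite /= cImM. Qed.

Lemma shiftC_Re a : @complex.Re R \o shiftC a = shift_coef (@complex.Re R \o a).
Proof. by apply/funext => -[|k]. Qed.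

Lemma shiftC_Im a : @complex.Im R \o shiftC a = shift_coef (@complex.Im R \o a).
Proof. by apply/funext => -[|k]. Qed.

Lemma entireC_D a b : entireC a -> entireC b -> entireC (fun k => a k + b k).
Proof.
by move=> [a1 a2] [b1 b2]; split; rewrite ?ReD_comp ?ImD_comp; exact: entireD.
Qed.

Lemma entireC_Z (w : R[i]) a : entireC a -> entireC (fun k => w * a k).
Proof.
by move=> [a1 a2]; split; rewrite ?ReZ_comp ?ImZ_comp; apply: entireD; exact: entireZ.
Qed.

Lemma entireC_shift a : entireC a -> entireC (shiftC a).
Proof. by move=> [a1 a2]; split; rewrite ?shiftC_Re ?shiftC_Im; exact: entire_shift. Qed.

Lemma psumC_D a b r : entireC a -> entireC b ->
  psumC (fun k => a k + b k) r = psumC a r + psumC b r.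
Proof.
move=> [a1 a2] [b1 b2]; rewrite /psumC ReD_comp ImD_comp !psumD//.
Qed.

Lemma psumC_Z (w : R[i]) a r : entireC a -> psumC (fun k => w * a k) r = w * psumC a r.
Proof.
move=> [a1 a2]; rewrite /psumC ReZ_comp ImZ_comp.
rewrite !psumD ?psumZ//; try exact: entireZ.
by apply: complex_eqP; rewrite ?cReM ?cImM/= ?mulNr.
Qed.

Lemma psumC_shift a r : entireC a -> psumC (shiftC a) r = r%:C * psumC a r.
Proof.
move=> [a1 a2]; rewrite /psumC shiftC_Re shiftC_Im !psum_shift//.
by apply: complex_eqP; rewrite ?cRe_scale ?cIm_scale.
Qed.

Lemma psumC_eq0 a : entireC a -> (forall r, 0 < r -> psumC a r = 0) -> forall k, a k = 0.
Proof.
move=> [a1 a2] h k; apply: complex_eqP.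
  apply: (psum_eq0 a1) => r r0; exact: (congr1 (@complex.Re R) (h r r0)).
by apply: (psum_eq0 a2) => r r0; exact: (congr1 (@complex.Im R) (h r r0)).
Qed.

Lemma psumC_bound a (K M : R) : 0 <= M ->
  (forall k, cabs (a k) <= K * (M ^+ k / k`!%:R)) ->
  [/\ entireC a, `|complex.Re (psumC a 1)| <= K * expR M
    & `|complex.Im (psumC a 1)| <= K * expR M].
Proof.
move=> M0 ab.
have [e1 b1] := @psum_bound _ (@complex.Re R \o a) K M M0 (fun k => le_trans (Re_le_cabs _) (ab k)).
have [e2 b2] := @psum_bound _ (@complex.Im R \o a) K M M0 (fun k => le_trans (Im_le_cabs _) (ab k)).
by split.
Qed.

Lemma cvg_complex_series a (K M : R) (y : R[i]) : 0 <= M ->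
  (forall k, cabs (a k) <= K * (M ^+ k / k`!%:R)) ->
  cvgn [series (a k * y ^+ k : R[i]^o)]_k.
Proof.
move=> M0 ab.
have yb k : cabs (a k * y ^+ k) <= K * ((M * cabs y) ^+ k / k`!%:R).
  rewrite cabsM cabsX exprMn mulrAC mulrA; apply: ler_wpM2r; first by rewrite exprn_ge0// cabs_ge0.
  exact: ab.
have My : 0 <= M * cabs y by rewrite mulr_ge0// cabs_ge0.
have one (u : nat -> R) : [series u k]_k = pseries u 1.
  by apply/funext => n; apply: eq_bigr => k _; rewrite /= expr1n mulr1.
apply/cvg_seqC; rewrite series_Re series_Im !one; split.
  have [e _] := @psum_bound _ (fun k => complex.Re (a k * y ^+ k)) K _ My
    (fun k => le_trans (Re_le_cabs _) (yb k)).
  exact: e.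
have [e _] := @psum_bound _ (fun k => complex.Im (a k * y ^+ k)) K _ My
  (fun k => le_trans (Im_le_cabs _) (yb k)).
exact: e.
Qed.

End ComplexSeries.

(** * Frobenius coefficients and their dependence on the parameter *)

Section RegularSolution.
Variables (R : realType) (gamma : R).
Hypothesis gamma_gt0 : 0 < gamma.
Implicit Types (a : nat -> R[i]) (z w : R[i]) (r : R) (h : R -> R[i]).

Lemma cabs0 : @cabs R 0 = 0.
Proof. by rewrite /cabs /= expr0n addr0 sqrtr0. Qed.

Lemma cabs1 : @cabs R 1 = 1.
Proof. by rewrite /cabs /= expr0n addr0 expr1n sqrtr1. Qed.

Definition radial_ode z h := forall r, 0 < r ->
  (r ^+ 2)%:C * rderiv (rderiv h) r + (2 * r)%:C * rderiv h r
  + (2 * gamma * r)%:C * h r + z * (r ^+ 2)%:C * h r = 0.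

Lemma rsmooth2_cst0 : @rsmooth2 R (fun=> 0).
Proof.
have d0 : rderiv (fun=> 0) = (fun=> 0) :> (R -> R[i]).
  by apply/funext => r; rewrite /rderiv !derive1_cst.
by move=> r _; rewrite d0; split; split; exact: derivable_cst.
Qed.

Lemma is_radial_psumC l z h : is_radial gamma l z h ->
  exists a, [/\ entireC a, h = psumC a, a l = 1 & forall k, (k < l)%N -> a k = 0].
Proof.
move=> [[a [al a1 ca ha]] _]; have ea := entireC_cvg ca.
by exists a; split=> //; apply/funext => r; rewrite ha limC_psumC.
Qed.

(** Either [Frad] is an entire power series or it is the default value 0 of [xget]; both are smooth,
    which treats all degrees l at once. *)
Lemma rsmooth2_Frad l z : rsmooth2 (Frad gamma l z).
Proof.
have [[h hr]|nh] := pselect (exists h, is_radial gamma l z h).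
  have := @xgetPex _ (0 : R -> R[i]^o) [set h | is_radial gamma l z h] (ex_intro _ h hr).
  by move=> /is_radial_psumC[a [ea hE _ _]]; rewrite /Frad hE; exact: rsmooth2_psumC.
rewrite /Frad xgetPN; first exact: rsmooth2_cst0.
by move=> h hr; apply: nh; exists h.
Qed.

(* The pair (a_n, a_(n-1)) of Frobenius coefficients of F_{0,z}. *)
Fixpoint frob_pair z n : R[i] * R[i] :=
  if n is m.+1 then
    (- ((2 * gamma)%:C * (frob_pair z m).1 + z * (frob_pair z m).2) / (m.+1 * m.+2)%:R,
     (frob_pair z m).1)
  else (1, 0).

Definition frob z n := (frob_pair z n).1.

Lemma frob_shift z n : (frob_pair z n).2 = shiftC (frob z) n.
Proof. by case: n. Qed.

(** The coefficient of r^(k+1) when the radial operator for l = 0 is applied to the series with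
    coefficients [a]. *)
Definition ode_coef z a k := (k.+1 * k.+2)%:R * a k.+1 + (2 * gamma)%:C * a k + z * shiftC a k.

Lemma ode_psumC z a r : entireC a ->
  (r ^+ 2)%:C * rderiv (rderiv (psumC a)) r + (2 * r)%:C * rderiv (psumC a) r
  + (2 * gamma * r)%:C * psumC a r + z * (r ^+ 2)%:C * psumC a r =
  r%:C * psumC (ode_coef z a) r.
Proof.
move=> ea; have e1 := entireC_diffs ea; have e2 := entireC_diffs e1.
rewrite (rderiv_psumC ea) (rderiv_psumC e1).
have -> : ode_coef z a = fun k => shiftC (diffsC (diffsC a)) k +
    (2%:C * diffsC a k + ((2 * gamma)%:C * a k + z * shiftC a k)).
  apply/funext => k; rewrite /ode_coef -addrA [in RHS]addrA; congr (_ + _).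
  rewrite /diffsC; case: k => [|k]; rewrite /= ?add0r ?mul1r ?natrM.
    by rewrite natC mul1r natC.
  have -> : 2%:C = 2%:R :> R[i] by rewrite natC.
  by rewrite -!natr1; ring.
rewrite psumC_D; [|exact: entireC_shift|]; last first.
  by apply: entireC_D; [exact: entireC_Z|apply: entireC_D; apply: entireC_Z => //; exact: entireC_shift].
rewrite psumC_D; [|exact: entireC_Z|by apply: entireC_D; apply: entireC_Z => //; exact: entireC_shift].
rewrite psumC_D; [|exact: entireC_Z|by apply: entireC_Z; exact: entireC_shift].
rewrite !psumC_Z//; last exact: entireC_shift.
rewrite !psumC_shift//.
have q1 : (r ^+ 2)%:C = r%:C ^+ 2 :> R[i] by rewrite rmorphXn.
have q2 : (2 * r)%:C = 2%:C * r%:C :> R[i] by rewrite rmorphM.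
have q3 : (2 * gamma * r)%:C = (2 * gamma)%:C * r%:C :> R[i] by rewrite rmorphM.
rewrite q1 q2 q3.
have E (x u v s g k : R[i]) : x ^+ 2 * u + k * x * v + g * x * s + z * x ^+ 2 * s =
  x * (x * u + (k * v + (g * s + z * (x * s)))) by ring.
exact: E.
Qed.

Lemma ode_coef_frob z k : ode_coef z (frob z) k = 0.
Proof.
rewrite /ode_coef {1}/frob /= frob_shift -/(frob z k).
have n0 : (k.+1 * k.+2)%:R != 0 :> R[i] by rewrite pnatr_eq0.
have E (n u v : R[i]) : n != 0 -> n * (- (u + v) / n) + u + v = 0.
  by move=> ?; field.
exact: E.
Qed.

Lemma frob_uniq z a : a 0%N = 1 -> (forall k, ode_coef z a k = 0) -> forall k, a k = frob z k.
Proof.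
move=> a0 ha k.
suff : a k = frob z k /\ shiftC a k = shiftC (frob z) k by case.
elim: k => [|k [ih1 ih2]]; first by rewrite a0.
split=> //.
have n0 : (k.+1 * k.+2)%:R != 0 :> R[i] by rewrite pnatr_eq0.
have := ha k; have := ode_coef_frob z k; rewrite /ode_coef ih1 ih2 => <- /eqP.
rewrite (inj_eq (addIr _)) (inj_eq (addIr _)) => /eqP.
exact: mulfI.
Qed.

(** With p = D M^k / k!, the right side equals p M^2 + 2 p M^2 / (k+1). The second summand absorbs
    the term in [u], as gamma <= M; the first absorbs the other two, as S + 1 <= M^2. *)
Lemma frob_bound_step (D M S : R) (u v f : R) k : 0 <= D -> gamma <= M -> S + 1 <= M ^+ 2 ->
  0 <= S -> u <= D * (M ^+ k.+1 / (k.+1)`!%:R) -> v <= D * (M ^+ k / k`!%:R) ->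
  f <= D * (M ^+ k / k`!%:R) ->
  2 * gamma * u + S * v + f <= (k.+2 * k.+3)%:R * (D * (M ^+ k.+2 / (k.+2)`!%:R)).
Proof.
move=> D0 gM SM S0 hu hv hf.
have M0 : 0 <= M by rewrite (le_trans _ gM)// ltW.
set p := D * (M ^+ k / k`!%:R) in hv hf *.
have p0 : 0 <= p by rewrite mulr_ge0// divr_ge0// exprn_ge0.
have k1 : (k.+1)%:R != 0 :> R by rewrite pnatr_eq0.
have k2 : (k.+2)%:R != 0 :> R by rewrite pnatr_eq0.
have kf : (k`!)%:R != 0 :> R by rewrite pnatr_eq0 -lt0n fact_gt0.
have E1 : D * (M ^+ k.+1 / (k.+1)`!%:R) = p * M / k.+1%:R.
  rewrite factS natrM exprS /p.
  by move: ((k.+1)%:R : R) (k`!%:R : R) (M ^+ k) k1 kf => n m q n0 m0; field; rewrite n0 m0.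
have E2 : (k.+2 * k.+3)%:R * (D * (M ^+ k.+2 / (k.+2)`!%:R)) =
    k.+3%:R / k.+1%:R * (p * M ^+ 2).
  rewrite !factS !natrM !exprS /p.
  move: ((k.+1)%:R : R) ((k.+2)%:R : R) ((k.+3)%:R : R) (k`!%:R : R) (M ^+ k) k1 k2 kf.
  by move=> n n' n'' m q n0 n'0 m0; field; rewrite n0 n'0 m0.
rewrite E1 in hu; rewrite E2.
have H1 : 2 * gamma * u <= 2 * M * (p * M / k.+1%:R).
  apply: (le_trans (ler_wpM2l _ hu)); first by rewrite mulr_ge0// ltW.
  by apply: ler_wpM2r; [rewrite divr_ge0// mulr_ge0|rewrite ler_pM2l].
have H2 : S * v + f <= M ^+ 2 * p.
  have h1 := ler_wpM2l S0 hv; have h2 := ler_wpM2r p0 SM.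
  by move: h2; rewrite mulrDl mul1r; lra.
rewrite -addrA; apply: (le_trans (lerD H1 H2)).
have -> : k.+3%:R / k.+1%:R * (p * M ^+ 2) = 2 * M * (p * M / k.+1%:R) + M ^+ 2 * p.
  have -> : k.+3%:R = k.+1%:R + 2 :> R by rewrite -natrD addn2.
  by move: ((k.+1)%:R : R) k1 => n n0; field.
by [].
Qed.

(** The source term [f] serves two uses: f = 0 bounds the Frobenius coefficients, and f = (w - z)
    [frob w] bounds their difference at the parameters z and w, which solves the recursion with that
    source. *)
Lemma frob_rec_bound (D M S : R) (u : nat -> R[i]) z (f : nat -> R[i]) :
  0 <= D -> gamma <= M -> S + 1 <= M ^+ 2 -> cabs z <= S ->
  cabs (u 0%N) <= D ->
  (forall k, ode_coef z u k = shiftC f k) ->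
  (forall k, cabs (f k) <= D * (M ^+ k / k`!%:R)) ->
  forall k, cabs (u k) <= D * (M ^+ k / k`!%:R).
Proof.
move=> D0 gM SM zS u0 hu hf k.
have M0 : 0 <= M by rewrite (le_trans _ gM)// ltW.
have S0 : 0 <= S by apply: le_trans zS; exact: cabs_ge0.
(* The recursion has order two, so consecutive indices are bounded together. *)
suff : cabs (u k) <= D * (M ^+ k / k`!%:R) /\ cabs (u k.+1) <= D * (M ^+ k.+1 / (k.+1)`!%:R).
  by case.
have rec j : (j.+1 * j.+2)%:R * cabs (u j.+1) <=
    2 * gamma * cabs (u j) + cabs z * cabs (shiftC u j) + cabs (shiftC f j).
  have E : (j.+1 * j.+2)%:R * u j.+1 =
      - ((2 * gamma)%:C * u j + z * shiftC u j - shiftC f j).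
    by rewrite -(hu j) /ode_coef; ring.
  have := congr1 (@cabs R) E; rewrite cabsM natC cabsR cabsN => e.
  rewrite -[X in X * _]ger0_norm// e (le_trans (cabsD _ _))// cabsN lerD2r.
  rewrite (le_trans (cabsD _ _))// !cabsM cabsR ger0_norm// mulr_ge0//; exact: ltW.
elim: k => [|k [ih1 ih2]].
  rewrite expr0 fact0 divr1 mulr1; split=> //.
  have := rec 0%N; rewrite /= cabs0 mulr0 !addr0 mul1n => h.
  rewrite expr1 factS fact0 divr1.
  have := ler_wpM2l (ltW gamma_gt0) u0; have := ler_wpM2r D0 gM; move=> ? ?.
  have -> : cabs (u 1%N) = (2 * cabs (u 1%N)) / 2 by field.
  by lra.
split=> //.
have n0 : 0 < (k.+2 * k.+3)%:R :> R by rewrite ltr0n.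
rewrite -(ler_pM2l n0); apply: (le_trans (rec k.+1)).
apply: (@le_trans _ _ (2 * gamma * cabs (u k.+1) + S * cabs (u k) + cabs (f k))).
  by rewrite /= lerD2r lerD2l ler_wpM2r// cabs_ge0.
exact: frob_bound_step.
Qed.

(** A convenient M with gamma <= M and S + 1 <= M^2, the latter because S + 1 <= M and M >= 1. *)
Definition frob_rate S : R := gamma + S + 1.

Lemma frob_rateP S : 0 <= S -> [/\ gamma <= frob_rate S, S + 1 <= frob_rate S ^+ 2 & 0 <= frob_rate S].
Proof.
move=> S0; have g0 := gamma_gt0; rewrite /frob_rate; split; [lra| |lra].
have : 1 <= gamma + S + 1 by lra.
rewrite expr2 => h; apply: (@le_trans _ _ (gamma + S + 1)); first by lra.
by rewrite ler_peMl//; lra.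
Qed.

Lemma frob_bound S z k : cabs z <= S -> cabs (frob z k) <= 1 * (frob_rate S ^+ k / k`!%:R).
Proof.
move=> zS; have S0 : 0 <= S by apply: le_trans zS; exact: cabs_ge0.
have [h1 h2 h3] := frob_rateP S0.
apply: (@frob_rec_bound _ _ S _ z (fun=> 0)) => //.
- by rewrite /frob/= cabs1.
- by move=> j; rewrite ode_coef_frob; case: j.
- by move=> j; rewrite mul1r cabs0 divr_ge0// exprn_ge0.
Qed.

Lemma frob_lipschitz S z w k : cabs z <= S -> cabs w <= S ->
  cabs (frob z k - frob w k) <= cabs (z - w) * (frob_rate S ^+ k / k`!%:R).
Proof.
move=> zS wS; have S0 : 0 <= S by apply: le_trans zS; exact: cabs_ge0.
have [h1 h2 h3] := frob_rateP S0.
apply: (@frob_rec_bound _ _ S (fun k => frob z k - frob w k) z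
  (fun k => - ((z - w) * frob w k))) => //; first exact: cabs_ge0.
- by rewrite subrr cabs0 cabs_ge0.
- move=> j; have hz := ode_coef_frob z j; have hw := ode_coef_frob w j.
  have -> : shiftC (fun k => - ((z - w) * frob w k)) j = - ((z - w) * shiftC (frob w) j).
    by case: j {hz hw} => //=; rewrite mulr0 oppr0.
  move: hz hw; rewrite /ode_coef.
  have -> : shiftC (fun k => frob z k - frob w k) j = shiftC (frob z) j - shiftC (frob w) j.
    by case: j => //=; rewrite subrr.
  have E (n g a1 a0 a2 b1 b0 b2 : R[i]) : n * a1 + g * a0 + z * a2 = 0 ->
      n * b1 + g * b0 + w * b2 = 0 ->
      n * (a1 - b1) + g * (a0 - b0) + z * (a2 - b2) = - ((z - w) * b2).
    move=> ea eb; apply: etrans (_ : _ = (n * a1 + g * a0 + z * a2) - (n * b1 + g * b0 + w * b2) - (z - w) * b2) _; first by ring.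
    by rewrite ea eb subrr sub0r.
  exact: E.
- move=> j; rewrite cabsN cabsM ler_wpM2l ?cabs_ge0//.
  by have := frob_bound j wS; rewrite mul1r.
Qed.

End RegularSolution.

Lemma cvg_lipschitz (R : realType) (T : Type) (F : set_system T) {FF : ProperFilter F}
    (u g : T -> R) (l K : R) :
  (\forall t \near F, `|u t - l| <= g t * K) -> g @ F --> (0 : R) -> u @ F --> l.
Proof.
move=> h g0; have gK : (g t * K) @[t --> F] --> (0 : R).
  by rewrite -[X in _ --> X](mul0r K); apply: cvgM => //; exact: cvg_cst.
apply/cvgrPdist_lt => e e0; near=> t.
rewrite distrC (@le_lt_trans _ _ (g t * K))//; first by near: t.
rewrite (le_lt_trans (ler_norm _))//; near: t.
by move/cvgrPdist_lt : gK => /(_ e e0); apply: filterS => t; rewrite sub0r normrN.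
Unshelve. all: by end_near. Qed.

Section RegularSolution0.
Variables (R : realType) (gamma : R).
Hypothesis gamma_gt0 : 0 < gamma.
Implicit Types (a : nat -> R[i]) (z w : R[i]) (r : R) (h : R -> R[i]).
Local Notation frob := (frob gamma).
Local Notation F0 := (Frad gamma 0).

Lemma frob_entire z : entireC (frob z).
Proof.
have [_ _ h3] := frob_rateP gamma_gt0 (cabs_ge0 z).
by have [] := psumC_bound h3 (fun k => frob_bound gamma_gt0 k (lexx (cabs z))).
Qed.

Lemma ode_coef_entire z a : entireC a -> entireC (ode_coef gamma z a).
Proof.
move=> ea; have e1 := entireC_diffs ea; have e2 := entireC_diffs e1.
have -> : ode_coef gamma z a = fun k => (shiftC (diffsC (diffsC a)) k +
    2 * diffsC a k) + ((2 * gamma)%:C * a k + z * shiftC a k).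
  apply/funext => k; rewrite /ode_coef -addrA; congr (_ + _).
  rewrite /diffsC; case: k => [|k] /=; first by rewrite add0r mul1n mul1r.
  by rewrite !natrM -!natr1; ring.
apply: entireC_D; apply: entireC_D.
- exact: entireC_shift.
- exact: entireC_Z.
- exact: entireC_Z.
- by apply: entireC_Z; exact: entireC_shift.
Qed.

Lemma radial_ode_frob z : radial_ode gamma z (psumC (frob z)).
Proof.
move=> r r0; rewrite ode_psumC; last exact: frob_entire.
have -> : ode_coef gamma z (frob z) = fun=> 0 by apply/funext => k; exact: ode_coef_frob.
have -> : psumC (fun=> 0) r = 0 :> R[i]; last by rewrite mulr0.
have [_ _ h3] := frob_rateP gamma_gt0 (cabs_ge0 z).
have e0 := frob_entire z.
have h := psumC_Z 0 r e0; rewrite [RHS]mul0r in h.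
have zE : (fun=> 0) = (fun k => 0 * frob z k) by apply/funext => k; rewrite mul0r.
by rewrite zE.
Qed.

Lemma is_radial_frob z : is_radial gamma 0 z (psumC (frob z)).
Proof.
have [_ _ h3] := frob_rateP gamma_gt0 (cabs_ge0 z).
have cv (y : R[i]) : cvgn [series (frob z k * y ^+ k : R[i]^o)]_k.
  exact: cvg_complex_series h3 (fun k => frob_bound gamma_gt0 k (lexx (cabs z))).
split.
  exists (frob z); split=> // r; rewrite limC_psumC//; exact: frob_entire.
move=> r r0; have := radial_ode_frob z r0.
by rewrite mul0n mul0r subr0.
Qed.

(** The chosen solution is itself a power series; inserting it in the equation and comparing
    coefficients forces the Frobenius recursion with initial coefficient 1. *)
Lemma Frad0E z : F0 z = psumC (frob z).
Proof.
have := @xgetPex _ (0 : R -> R[i]^o) [set h | is_radial gamma 0 z h]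
  (ex_intro _ _ (is_radial_frob z)).
rewrite -/(F0 z) => hr; have [a [ea hE a0 _]] := is_radial_psumC hr.
rewrite hE; congr psumC; apply/funext => k; apply: (@frob_uniq _ gamma z a a0).
apply: psumC_eq0; first exact: ode_coef_entire.
move=> r r0; have [_ /(_ r r0)] := hr.
rewrite mul0n mul0r subr0 hE ode_psumC// => /eqP.
by rewrite mulf_eq0 => /orP[/eqP[/eqP]|/eqP//]; rewrite gt_eqF.
Qed.

Lemma Frad0_ode z : radial_ode gamma z (F0 z).
Proof. by rewrite Frad0E; exact: radial_ode_frob. Qed.

Lemma psumC_frobB z w : psumC (fun k => frob z k - frob w k) 1 = psumC (frob z) 1 - psumC (frob w) 1.
Proof.
have -> : (fun k => frob z k - frob w k) = fun k => frob z k + (-1) * frob w k.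
  by apply/funext => k; rewrite mulN1r.
have ez := frob_entire z; have ew := frob_entire w.
by rewrite psumC_D// ?psumC_Z ?mulN1r//; exact: entireC_Z.
Qed.

Lemma psumC_diffs_frobB z w : psumC (diffsC (fun k => frob z k - frob w k)) 1 =
  psumC (diffsC (frob z)) 1 - psumC (diffsC (frob w)) 1.
Proof.
have -> : diffsC (fun k => frob z k - frob w k) =
    fun k => diffsC (frob z) k + (-1) * diffsC (frob w) k.
  by apply/funext => k; rewrite /diffsC mulN1r mulrBr.
have ez := entireC_diffs (frob_entire z); have ew := entireC_diffs (frob_entire w).
by rewrite psumC_D// ?psumC_Z ?mulN1r//; exact: entireC_Z.
Qed.

Lemma Frad0_cvg (T : Type) (F : set_system T) {FF : ProperFilter F} (zf : T -> R[i]^o) (lam : R[i]) :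
  zf @ F --> (lam : R[i]^o) ->
  (F0 (zf t) 1 : R[i]^o) @[t --> F] --> (F0 lam 1 : R[i]^o) /\
  (rderiv (F0 (zf t)) 1 : R[i]^o) @[t --> F] --> (rderiv (F0 lam) 1 : R[i]^o).
Proof.
(* Eventually the parameter stays within this radius, which makes the Lipschitz bounds uniform along
   the filter. *)
move=> zl; pose S := cabs lam + 1.
have d0 : cabs (zf t - lam) @[t --> F] --> (0 : R).
  apply/cvgrPdist_lt => e e0; move/cvgrPdist_lt : zl => /(_ e%:C).
  rewrite ltcR => /(_ e0); apply: filterS => t.
  by move=> h; rewrite sub0r normrN ger0_norm ?cabs_ge0// -ltcR cabsE distrC.
have nS : \forall t \near F, cabs (zf t) <= S.
  move/cvgrPdist_lt : d0 => /(_ 1 ltr01); apply: filterS => t.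
  rewrite sub0r normrN ger0_norm ?cabs_ge0// => /ltW h.
  by rewrite -[zf t](subrK lam) /S addrC (le_trans (cabsD _ _))// lerD2l.
have lS : cabs lam <= S by rewrite lerDl.
have S0 : 0 <= S by rewrite addr_ge0 ?cabs_ge0.
have [_ _ M0] := frob_rateP gamma_gt0 S0.
set M := frob_rate gamma S in M0 *.
have b1 t : cabs (zf t) <= S -> [/\ entireC (fun k => frob (zf t) k - frob lam k),
   `|complex.Re (psumC (fun k => frob (zf t) k - frob lam k) 1)| <= cabs (zf t - lam) * expR M
   & `|complex.Im (psumC (fun k => frob (zf t) k - frob lam k) 1)| <= cabs (zf t - lam) * expR M].
  by move=> tS; apply: psumC_bound => // k; exact: frob_lipschitz.
have b2 t : cabs (zf t) <= S -> [/\ entireC (diffsC (fun k => frob (zf t) k - frob lam k)),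
   `|complex.Re (psumC (diffsC (fun k => frob (zf t) k - frob lam k)) 1)| <=
      cabs (zf t - lam) * (M * expR M)
   & `|complex.Im (psumC (diffsC (fun k => frob (zf t) k - frob lam k)) 1)| <=
      cabs (zf t - lam) * (M * expR M)].
  (* The factor k + 1 of differentiation cancels in (k+1)!, which keeps the majorant at the cost of
     one factor M. *)
  move=> tS; rewrite mulrA; apply: psumC_bound => // k.
  rewrite /diffsC cabsM natC cabsR normr_nat.
  have := @frob_lipschitz _ _ gamma_gt0 S (zf t) lam k.+1 tS lS; rewrite -/M => h.
  have n0 : (k.+1%:R : R) != 0 by rewrite pnatr_eq0.
  have f0 : (k`!%:R : R) != 0 by rewrite pnatr_eq0 -lt0n fact_gt0.
  apply: (le_trans (ler_wpM2l _ h)) => //; rewrite factS natrM exprS.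
  move: (k.+1%:R : R) (k`!%:R : R) n0 f0 (M ^+ k) (cabs _) => n f n0 f0 q c.
  have -> // : n * (c * (M * q / (n * f))) = c * M * (q / f) by field; rewrite n0 f0.
rewrite Frad0E (rderiv_psumC (frob_entire lam)).
have E1 : (fun t => F0 (zf t) 1) = (fun t => psumC (frob (zf t)) 1).
  by apply/funext => t; rewrite Frad0E.
have E2 : (fun t => rderiv (F0 (zf t)) 1) = (fun t => psumC (diffsC (frob (zf t))) 1).
  by apply/funext => t; rewrite Frad0E rderiv_psumC//; exact: frob_entire.
rewrite E1 E2; split; apply/cvgC; split; apply: (cvg_lipschitz _ d0);
  apply: filterS nS => t tS; [have [_ h _] := b1 t tS|have [_ _ h] := b1 t tS|
    have [_ h _] := b2 t tS|have [_ _ h] := b2 t tS].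
- by move: h; rewrite psumC_frobB cReD cReN; exact.
- by move: h; rewrite psumC_frobB cImD cImN; exact.
- by move: h; rewrite psumC_diffs_frobB cReD cReN; exact.
- by move: h; rewrite psumC_diffs_frobB cImD cImN; exact.
Qed.

End RegularSolution0.

(** * Solutions invariant under rotations *)

Section Rotations.
Variable R : realType.
Implicit Types (f : fn R) (x y v : 'cV[R]_3).

Lemma det3 (a : nat -> nat -> R) : \det (\matrix_(i < 3, j < 3) a i j) =
  a 0%N 0%N * (a 1%N 1%N * a 2%N 2%N - a 1%N 2%N * a 2%N 1%N)
  - a 0%N 1%N * (a 1%N 0%N * a 2%N 2%N - a 1%N 2%N * a 2%N 0%N)
  + a 0%N 2%N * (a 1%N 0%N * a 2%N 1%N - a 1%N 1%N * a 2%N 0%N).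
Proof.
rewrite (expand_det_row _ ord0) !big_ord_recl big_ord0 /cofactor.
rewrite !(expand_det_row _ ord0) !big_ord_recl !big_ord0 /cofactor !det_mx11 !mxE /=.
by rewrite /bump/= !expr0 !expr1 ?expr2; ring.
Qed.

(** The rotation by pi about the line of [v]. For nonzero [v] its determinant is 1, so the
    determinant factor in [kpt] disappears, and it is its own inverse. *)
Definition halfturn v : 'M[R]_3 := (2 / rad v ^+ 2) *: (v *m v^T) - 1%:M.

Lemma dotE x y : (x^T *m y) 0 0 = \sum_i x i 0 * y i 0.
Proof. by rewrite mxE; apply: eq_bigr => i _; rewrite mxE. Qed.

Lemma halfturn_mul v x : halfturn v *m x = (2 / rad v ^+ 2 * (\sum_i v i 0 * x i 0)) *: v - x.
Proof.
rewrite /halfturn mulmxBl mul1mx -scalemxAl -mulmxA; congr (_ - _).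
by rewrite [v^T *m x]mx11_scalar dotE mul_mx_scalar scalerA.
Qed.

Lemma halfturnT v : (halfturn v)^T = halfturn v.
Proof. by rewrite /halfturn linearB/= linearZ/= trmx_mul trmxK trmx1. Qed.

Lemma halfturn_sqr v : v != 0 -> halfturn v *m halfturn v = 1%:M.
Proof.
move=> v0; have r0 : rad v != 0 by rewrite gt_eqF// rad_gt0.
rewrite {1}/halfturn mulmxBl mul1mx -scalemxAl -mulmxA.
have -> : v^T *m halfturn v = v^T.
  apply: trmx_inj; rewrite trmx_mul trmxK halfturnT halfturn_mul.
  have -> : \sum_i v i 0 * v i 0 = rad v ^+ 2.
    by rewrite rad_sqr; apply: eq_bigr => i _; rewrite expr2.
  by rewrite divfK ?expf_neq0// scaler_nat mulr2n addrK.
by rewrite {1}/halfturn opprB addrC subrK.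
Qed.

Lemma halfturn_O3 v : v != 0 -> O3 (halfturn v).
Proof. by move=> v0; rewrite /O3/= halfturnT halfturn_sqr. Qed.

Lemma halfturn_inv v : v != 0 -> invmx (halfturn v) = halfturn v.
Proof.
move=> v0; have h := halfturn_sqr v0; have [u _] := mulmx1_unit h.
by rewrite -[LHS]mulmx1 -h mulmxA mulVmx// mul1mx.
Qed.

Lemma halfturn_det v : v != 0 -> \det (halfturn v) = 1.
Proof.
move=> v0; have r0 : rad v ^+ 2 != 0 by rewrite expf_neq0// gt_eqF// rad_gt0.
pose w (n : nat) := v (inord n) 0; pose c := 2 / rad v ^+ 2.
have -> : halfturn v = \matrix_(i < 3, j < 3)
    (fun n m => c * (w n * w m) - (n == m)%:R) (val i) (val j).
  apply/matrixP => i j; rewrite !mxE big_ord1 !mxE /w !inord_val.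
  by rewrite -val_eqE.
rewrite (det3 (fun n m => c * (w n * w m) - (n == m)%:R)) /=.
have cw : c * (w 0%N ^+ 2 + w 1%N ^+ 2 + w 2%N ^+ 2) = 2.
  rewrite /c -[RHS](divfK r0); congr (_ * _); rewrite rad_sqr sum3 /w.
  by congr (v _ _ ^+ 2 + v _ _ ^+ 2 + v _ _ ^+ 2); apply: val_inj; rewrite /= inordK.
(* In dimension three det(c w w^T - 1) = c |w|^2 - 1. *)
transitivity (c * (w 0%N ^+ 2 + w 1%N ^+ 2 + w 2%N ^+ 2) - 1); last by rewrite cw; ring.
by rewrite ?mulr1n ?mulr0n; ring.
Qed.

Definition Kinvariant f := forall A : 'M[R]_3, O3 A -> kact A f = f.

Lemma Kinvariant_halfturn f v x : Kinvariant f -> v != 0 -> f (halfturn v *m x) = f x.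
Proof.
move=> hf v0; rewrite -[in RHS](hf _ (halfturn_O3 v0)) /kact /kpt.
by rewrite halfturn_inv// halfturn_det// invr1 scale1r.
Qed.

Lemma rad_scale (t : R) x : 0 <= t -> rad (t *: x) = t * rad x.
Proof.
move=> t0; rewrite /rad; under eq_bigr do rewrite mxE exprMn.
by rewrite -mulr_sumr sqrtrM ?sqr_ge0// sqrtr_sqr ger0_norm.
Qed.

Lemma rad_delta i : rad (delta_mx i 0 : 'cV[R]_3) = 1.
Proof.
rewrite /rad (bigD1 i)//= big1 ?mxE ?eqxx ?expr1n ?addr0 ?sqrtr1//.
by move=> j /negPf ji; rewrite mxE ji expr0n.
Qed.

(* The half-turn about x + y exchanges x and y when they have the same norm. *)
Lemma Kinvariant_radial_aux f x y : Kinvariant f -> rad x = rad y -> x + y != 0 -> f x = f y.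
Proof.
move=> hf xy v0; rewrite -(Kinvariant_halfturn x hf v0); congr f.
rewrite halfturn_mul; set d := \sum_i _.
have rv : rad (x + y) ^+ 2 != 0 by rewrite expf_neq0// gt_eqF// rad_gt0.
have e : rad (x + y) ^+ 2 = 2 * d.
  have := congr1 (fun r => r ^+ 2) xy; rewrite !rad_sqr !sum3 /d sum3 !mxE.
  by move=> ?; lra.
rewrite -[2 / _ * d]mulrAC -e divff// scale1r addrC addKr//.
Qed.

(** No half-turn about x + y exists when y = -x; the two points are then linked through a third
    vector of the same norm, distinct from both. *)
Lemma Kinvariant_radial f x y : Kinvariant f -> x != 0 -> rad x = rad y -> f x = f y.
Proof.
move=> hf x0 xy; have [s0|] := eqVneq (x + y) 0; last exact: Kinvariant_radial_aux.
have r0 := rad_gt0 x0.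
have [u ru [u1 u2]] : exists2 u : 'cV[R]_3, rad u = rad x & x + u != 0 /\ u - x != 0.
  pose e i : 'cV[R]_3 := rad x *: delta_mx i 0.
  have re i : rad (e i) = rad x by rewrite /e rad_scale ?rad_delta ?mulr1// ltW.
  (* If [e 0] is x or -x, the second coordinate of x is 0 and [e 1] can be taken instead. *)
  have [h|h] := pselect (x + e 0 != 0 /\ e 0 - x != 0); first by exists (e 0).
  have x1 : x 1 0 = 0.
    have [/eqP h1|h1] := eqVneq (x + e 0) 0.
      have := congr1 (fun m : 'cV[R]_3 => m 1 0) (eqP h1); rewrite !mxE/= mulr0 addr0; exact.
    have [/eqP h2|h2] := eqVneq (e 0 - x) 0.
      have := congr1 (fun m : 'cV[R]_3 => m 1 0) (eqP h2); rewrite !mxE/= mulr0 sub0r.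
      by move/eqP; rewrite oppr_eq0 => /eqP.
    by case: h.
  exists (e 1) => //; split; apply/eqP => h2.
    have := congr1 (fun m : 'cV[R]_3 => m 1 0) h2; rewrite !mxE/= mulr1 x1 add0r => h3.
    by rewrite h3 ltxx in r0.
  have := congr1 (fun m : 'cV[R]_3 => m 1 0) h2; rewrite !mxE/= mulr1 x1 subr0 => h3.
  by rewrite h3 ltxx in r0.
have yx : y = - x by apply/eqP; rewrite -addr_eq0 addrC s0.
rewrite (@Kinvariant_radial_aux f x u)//; apply: Kinvariant_radial_aux => //.
  by rewrite ru.
by rewrite yx.
Qed.

End Rotations.

(** * Radial solutions and their Wronskians *)

Section RadialSolutions.
Variable R : realType.
Implicit Types (f : fn R) (h : R -> R[i]) (x : 'cV[R]_3) (r : R) (z : R[i]).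

Local Notation e0 := (delta_mx 0 0 : 'cV[R]_3).

Definition axis f : R -> R[i] := fun r => f (r *: e0).

Lemma axis_neq0 r : 0 < r -> r *: e0 != 0.
Proof.
move=> r0; apply/eqP => /(congr1 (fun m : 'cV[R]_3 => m 0 0)).
by rewrite !mxE/= mulr1 => h; rewrite h ltxx in r0.
Qed.

Lemma axis_quotient (k : 'cV[R]_3 -> R) r :
  (fun t : R => t^-1 *: (((fun t => k (t *: e0)) \o shift r) (t *: 1) - k (r *: e0))) =
  (fun t : R => t^-1 *: ((k \o shift (r *: e0)) (t *: e0) - k (r *: e0))).
Proof. by apply/funext => t /=; rewrite -scalerDl /GRing.scale/= mulr1. Qed.

Lemma derive1_axis (k : 'cV[R]_3 -> R) r :
  derive1 (fun t => k (t *: e0)) r = 'D_e0 k (r *: e0).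
Proof. by rewrite derive1E /derive axis_quotient. Qed.

Lemma derivable_axis (k : 'cV[R]_3 -> R) r :
  derivable k (r *: e0) e0 -> derivable (fun t : R => k (t *: e0)) r 1.
Proof. by rewrite /derivable axis_quotient. Qed.

Lemma rderiv_axis f : rderiv (axis f) = axis (pd 0 f).
Proof.
apply/funext => r; rewrite /rderiv /axis (derive1_axis (fun y => complex.Re (f y))).
by rewrite (derive1_axis (fun y => complex.Im (f y))).
Qed.

Lemma rderivable_axis f r : cdiff f (r *: e0) -> rderivable (axis f) r.
Proof. by move=> [f1 f2]; split;
  [apply: (@derivable_axis (fun y => complex.Re (f y)))|
   apply: (@derivable_axis (fun y => complex.Im (f y)))]; exact: diff_derivable. Qed.

Lemma rsmooth2_axis f : Cinf0 f -> rsmooth2 (axis f).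
Proof.
move=> [_ sf] r /axis_neq0 x0; rewrite rderiv_axis; split; apply: rderivable_axis.
  exact: (sf [::]).
exact: (sf [:: 0]).
Qed.

Lemma Kinvariant_axis f : f 0 = 0 -> Kinvariant f -> f = rfun (axis f).
Proof.
move=> f0 hf; apply/funext => x; have [->|x0] := eqVneq x 0; first by rewrite /rfun off0_0.
rewrite /rfun off0E// /axis; apply: Kinvariant_radial => //.
by rewrite rad_scale ?rad_delta ?mulr1// ltW// rad_gt0.
Qed.

Lemma Sol_axis_ode gamma z f : Sol gamma z f -> Kinvariant f -> radial_ode gamma z (axis f).
Proof.
move=> [sf _ tf] hf r r0; have x0 := axis_neq0 r0.
have s2 := rsmooth2_axis sf.
have rx : rad (r *: e0) = r by rewrite rad_scale ?rad_delta ?mulr1// ltW.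
have := congr1 (fun g : fn R => g (r *: e0)) tf.
rewrite /opT off0E// {1}(Kinvariant_axis sf.1 hf) laplacian_rfun//; last 2 first.
  by move=> t t0; have [] := s2 t t0.
  by move=> t t0; have [] := s2 t t0.
rewrite rx -[f (r *: e0)]/(axis f r).
rewrite -[(z *: f) (r *: e0)]/(z * axis f r).
have rr : (r%:C : R[i]) != 0 by rewrite eq_complex/= eqxx andbT gt_eqF.
rewrite !rmorphM/= !fmorphV/=.
move: (rderiv (rderiv (axis f)) r) (rderiv (axis f) r) (axis f r) (gamma%:C) (r%:C) rr.
move=> a b c g t t0 H.
have E : t * t * a + 2%:R * t * b + 2%:R * g * t * c + z * (t * t) * c =
  - (t * t) * (- (a + 2%:R / t * b) - 2%:R * g / t * c - z * c) by field.
have t2 : ((2 : R)%:C : R[i]) = 2%:R by rewrite rmorph_nat.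
by rewrite !t2 E; move: H; rewrite !t2 => ->; rewrite subrr mulr0.
Qed.

Lemma rderivM h k r : rderivable h r -> rderivable k r ->
  rderivable (fun t => h t * k t) r /\
  rderiv (fun t => h t * k t) r = rderiv h r * k r + h r * rderiv k r.
Proof.
move=> [h1 h2] [k1 k2].
have E1 : (fun t => complex.Re (h t * k t)) =
    (fun t => complex.Re (h t)) * (fun t => complex.Re (k t)) -
     (fun t => complex.Im (h t)) * (fun t => complex.Im (k t)).
  by apply/funext => t; exact: cReM.
have E2 : (fun t => complex.Im (h t * k t)) =
    (fun t => complex.Re (h t)) * (fun t => complex.Im (k t)) +
     (fun t => complex.Im (h t)) * (fun t => complex.Re (k t)).
  by apply/funext => t; exact: cImM.
have a1 := derivableM h1 k1; have a2 := derivableM h2 k2.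
have b1 := derivableM h1 k2; have b2 := derivableM h2 k1.
split.
  by rewrite /rderivable E1 E2; split; [exact: (derivableB a1 a2)|exact: (derivableD b1 b2)].
rewrite /rderiv E1 E2.
rewrite !derive1E (deriveB a1 a2) (deriveD b1 b2).
rewrite (deriveM h1 k1) (deriveM h2 k2) (deriveM h1 k2) (deriveM h2 k1).
rewrite /GRing.scale/=.
have D1 (a b c d p q u v : R) : a * p + b * q - (c * u + d * v) =
  q * b - v * d + (a * p - c * u) by ring.
have D2 (a b c d p q u v : R) : a * p + b * q + (c * u + d * v) =
  q * b + v * d + (a * p + c * u) by ring.
apply: complex_eqP; rewrite !ReIm/=; [exact: D1|exact: D2].
Qed.

Lemma rderivB h k r : rderivable h r -> rderivable k r ->
  rderivable (fun t => h t - k t) r /\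
  rderiv (fun t => h t - k t) r = rderiv h r - rderiv k r.
Proof.
move=> [h1 h2] [k1 k2].
have E1 : (fun t => complex.Re (h t - k t)) =
    (fun t => complex.Re (h t)) - (fun t => complex.Re (k t)).
  by apply/funext => t; rewrite cReD cReN.
have E2 : (fun t => complex.Im (h t - k t)) =
    (fun t => complex.Im (h t)) - (fun t => complex.Im (k t)).
  by apply/funext => t; rewrite cImD cImN.
split.
  by rewrite /rderivable E1 E2; split; [exact: (derivableB h1 k1)|exact: (derivableB h2 k2)].
rewrite /rderiv E1 E2 !derive1E (deriveB h1 k1) (deriveB h2 k2).
by apply: complex_eqP; rewrite !ReIm/=.
Qed.

Lemma rderiv_sqr r : rderivable (fun t => (t ^+ 2)%:C) r /\
  rderiv (fun t => (t ^+ 2)%:C) r = (2 * r)%:C.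
Proof.
have d : is_derive r (1 : R) (fun t : R => t ^+ 2) (2 * r).
  by apply: is_derive_eq; rewrite /GRing.scale/=; ring.
split; first by split => /=; [exact: ex_derive|exact: derivable_cst].
by rewrite /rderiv /= derive1_cst derive1E (@derive_val _ _ _ _ _ _ _ d).
Qed.

Lemma rderiv_eq0_cst h : (forall r, 0 < r -> rderivable h r /\ rderiv h r = 0) ->
  forall r, 0 < r -> h r = h 1.
Proof.
move=> dh.
have key (u : R -> R) : (forall r, 0 < r -> derivable u r 1 /\ derive1 u r = 0) ->
    forall r, 0 < r -> u r = u 1.
  (* The substitution r = exp x carries the half-line to the whole line, where a vanishing
     derivative means a constant function. *)
  move=> du r r0; rewrite -[r in LHS]lnK ?posrE// -[1 in RHS]expR0.
  apply: (@is_derive_0_is_cst _ (u \o (@expR R))) => x.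
  have [d e] := du _ (expR_gt0 x).
  have hu : is_derive (expR x) (1 : R) u 0 by rewrite -e derive1E; exact: derivableP.
  by have := is_derive1_comp hu (is_derive_expR x); rewrite ?mulr0 ?mul0r.
move=> r r0; apply: complex_eqP; apply: (key (fun t => _ (h t))) => // t t0.
  by have [[d _] e] := dh t t0; split => //; exact: (congr1 (@complex.Re R) e).
by have [[_ d] e] := dh t t0; split => //; exact: (congr1 (@complex.Im R) e).
Qed.

(** The derivative of r^2 (h' k - h k') is k times the equation of h minus h times the equation of
    k. *)
Lemma wronskian_cst gamma z h k : rsmooth2 h -> rsmooth2 k ->
  radial_ode gamma z h -> radial_ode gamma z k -> forall r, 0 < r ->
  (r ^+ 2)%:C * (rderiv h r * k r - h r * rderiv k r) = wr1 h k.
Proof.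
move=> sh sk oh ok.
set W := fun r : R => (r ^+ 2)%:C * (rderiv h r * k r - h r * rderiv k r).
move=> r r0; rewrite -/(W r).
have -> : wr1 h k = W 1 by rewrite /W expr1n mul1r.
apply: rderiv_eq0_cst (r0) => {r r0} t t0.
have [h1 h2] := sh t t0; have [k1 k2] := sk t t0; have [q1 q2] := rderiv_sqr t.
have [a1 a2] := rderivM h2 k1; have [b1 b2] := rderivM h1 k2.
have [c1 c2] := rderivB a1 b1; have [d1 d2] := rderivM q1 c1.
split=> //; rewrite {}d2 {}c2 {}a2 {}b2 {}q2.
move: (oh t t0) (ok t t0).
move: (rderiv (rderiv h) t) (rderiv (rderiv k) t) (rderiv h t) (rderiv k t) (h t) (k t).
move: (_ ^+ 2)%:C (2 * t)%:C (2 * gamma * t)%:C => q p g a b c d u v H1 H2.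
transitivity (v * (q * a + p * c + g * u + z * q * u) - u * (q * b + p * d + g * v + z * q * v)).
  by ring.
by rewrite H1 H2 !mulr0 subrr.
Qed.

(* Cramer's rule in the two-dimensional space of radial solutions. *)
Lemma radial_solution_span gamma z v h k : rsmooth2 v -> rsmooth2 h -> rsmooth2 k ->
  radial_ode gamma z v -> radial_ode gamma z h -> radial_ode gamma z k ->
  wr1 h k = 1 -> forall r, 0 < r -> v r = wr1 v k * h r - wr1 v h * k r.
Proof.
move=> sv sh sk ov oh ok hk r r0.
rewrite -[LHS]mulr1 -hk -(wronskian_cst sv sk ov ok r0) -(wronskian_cst sv sh ov oh r0).
rewrite -(wronskian_cst sh sk oh ok r0).
move: (rderiv v r) (rderiv h r) (rderiv k r) (v r) (h r) (k r) (_%:C) => a b c d e f q.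
by ring.
Qed.

Lemma regfn_rfun gamma l z : regfn gamma l z (fun=> 1) = rfun (Frad gamma l z).
Proof.
apply/funext => x; have [->|x0] := eqVneq x 0; first by rewrite /rfun /regfn !off0_0.
by rewrite /rfun /regfn !off0E// mulr1.
Qed.

Lemma Sol_Kinvariant_span gamma z f g : 0 < gamma -> Sol gamma z f -> Sol gamma z g ->
  Kinvariant f -> Kinvariant g ->
  Wr g (regfn gamma 0 z (fun=> 1)) = 1 ->
  f = Wr f (regfn gamma 0 z (fun=> 1)) *: g - Wr f g *: regfn gamma 0 z (fun=> 1).
Proof.
move=> gamma_gt0 sf sg hf hg.
have [cf _ _] := sf; have [cg _ _] := sg.
have ef := Kinvariant_axis cf.1 hf; have eg := Kinvariant_axis cg.1 hg.
have s1 := rsmooth2_axis cf; have s2 := rsmooth2_axis cg.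
have s3 := @rsmooth2_Frad R gamma 0 z.
rewrite regfn_rfun; set F := Frad gamma 0 z.
have W1 : Wr g (rfun F) = wr1 (axis g) F by rewrite {1}eg Wr_rfun.
have W2 : Wr f (rfun F) = wr1 (axis f) F by rewrite {1}ef Wr_rfun.
have W3 : Wr f g = wr1 (axis f) (axis g) by rewrite {1}ef {1}eg Wr_rfun.
rewrite W1 W2 W3 => w1.
have h := radial_solution_span s1 s2 s3 (Sol_axis_ode sf hf) (Sol_axis_ode sg hg)
  (Frad0_ode gamma_gt0 z) w1.
apply/funext => x; have [->|x0] := eqVneq x 0.
  by rewrite !fctE cf.1 cg.1 /rfun off0_0 !scaler0 subr0.
rewrite [f in LHS]ef [g in X in _ *: X]eg !fctE /rfun !off0E//.
exact: h (rad_gt0 x0).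
Qed.

End RadialSolutions.

(** * Boundary values *)

Section Limits.
Variable R : realType.
Implicit Types (f g l : fn R) (x : 'cV[R]_3) (z : R[i]) (V W : sect R).

Local Notation right0 := ((0 : R)^'+).

Lemma cvg_Cinf0_pds (u : R -> fn R) l s x : cvg_Cinf0 u l -> x != 0 ->
  (pds s (u t) x : R[i]^o) @[t --> right0] --> (pds s l x : R[i]^o).
Proof.
move=> [_ h] x0; have h1 (e : R) : 0 < e ->
    \forall t \near right0, `|pds s (u t) x - pds s l x| < e%:C.
  move=> e0; have := h s [set x] (@compact_set1 _ x) (fun E => negP x0 (introT eqP (esym E))) e e0.
  by apply: filterS => t; apply.
apply/cvgC; split; apply/cvgrPdist_lt => e /h1; apply: filterS => t; rewrite distrC.
  by rewrite -cReN -cReD -ltcR; apply: le_lt_trans; exact: Re_le_norm.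
by rewrite -cImN -cImD -ltcR; apply: le_lt_trans; exact: Im_le_norm.
Qed.

Lemma cvg_Cinf0_pt (u : R -> fn R) l x : (forall t, Cinf0 (u t)) -> cvg_Cinf0 u l ->
  (u t x : R[i]^o) @[t --> right0] --> (l x : R[i]^o).
Proof.
move=> cu h; have [->|x0] := eqVneq x 0; last exact: (@cvg_Cinf0_pds u l [::] x h x0).
rewrite h.1.1 (_ : (fun t => u t 0) = (fun=> 0)); first exact: cvgC_cst.
by apply/funext => t; exact: (cu t).1.
Qed.

(* The common form of V^+ and V^-: the limit of V along a path of parameters. *)
Definition pathlim (zeta : R -> R[i]) V : fn R :=
  fun x => lim ((V (zeta t) x : R[i]^o) @[t --> right0]).

Lemma pathlimE zeta V l :
  (forall x, (V (zeta t) x : R[i]^o) @[t --> right0] --> (l x : R[i]^o)) -> pathlim zeta V = l.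
Proof. by move=> h; apply/funext => x; apply: cvg_lim (h x); exact: norm_hausdorff. Qed.

(** Convergence in [Cinf0] only concerns compact sets that avoid the origin; the first clause
    supplies the value 0 there. *)
Definition path_cvg zeta V := (forall z, Cinf0 (V z)) /\
  cvg_Cinf0 (fun t => V (zeta t)) (pathlim zeta V).

Lemma path_cvg_pt zeta V x : path_cvg zeta V ->
  (V (zeta t) x : R[i]^o) @[t --> right0] --> (pathlim zeta V x : R[i]^o).
Proof. by move=> [cV h]; exact: cvg_Cinf0_pt (fun t => cV (zeta t)) h. Qed.

Lemma pathlimD zeta V W : path_cvg zeta V -> path_cvg zeta W ->
  pathlim zeta (V + W) = pathlim zeta V + pathlim zeta W.
Proof. by move=> hV hW; apply: pathlimE => x; 
exact: (cvgCD (path_cvg_pt (x := x) hV) (path_cvg_pt (x := x) hW)). Qed.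

Lemma cvg_horner (p : {poly R[i]}) (zeta : R -> R[i]) (lam : R[i]) :
  (zeta t : R[i]^o) @[t --> right0] --> (lam : R[i]^o) ->
  (p.[zeta t] : R[i]^o) @[t --> right0] --> (p.[lam] : R[i]^o).
Proof.
move=> hz; elim/poly_ind: p => [|p c ih].
  rewrite horner0 (_ : (fun t => _) = (fun=> 0)); first exact: cvgC_cst.
  by apply/funext => t; rewrite horner0.
have h := cvgCD (cvgCM ih hz) (@cvgC_cst R R right0 _ c).
rewrite hornerMXaddC (_ : (fun t => _) = (fun t => p.[zeta t] * zeta t + c)); first exact: h.
by apply/funext => t; rewrite hornerMXaddC.
Qed.

Lemma pathlim_Oscale zeta (lam : R[i]) p V :
  (zeta t : R[i]^o) @[t --> right0] --> (lam : R[i]^o) -> path_cvg zeta V ->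
  pathlim zeta (Oscale p V) = p.[lam] *: pathlim zeta V.
Proof.
move=> hz hV; apply: pathlimE => x.
exact: (cvgCM (cvg_horner (p := p) hz) (path_cvg_pt (x := x) hV)).
Qed.

Lemma pathlim_opL zeta V i : path_cvg zeta V ->
  pathlim zeta (gactS (opL i) V) = opL i (pathlim zeta V).
Proof.
move=> [cV hV]; apply: pathlimE => x; have [->|x0] := eqVneq x 0.
  rewrite /opL off0_0 (_ : (fun t => _) = (fun=> 0)); first exact: cvgC_cst.
  by apply/funext => t; rewrite /gactS /opL off0_0.
have dV s := cvg_Cinf0_pds (s := s) hV x0; have cst (k : R[i]^o) : (fun=> k) @ right0 --> k by exact: cvgC_cst.
rewrite opLE// (_ : (fun t => _) = (fun t => (x (i + 1) 0)%:C * pds [:: i + 2] (V (zeta t)) x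
    - (x (i + 2) 0)%:C * pds [:: i + 1] (V (zeta t)) x)).
  exact: (cvgCB (cvgCM (cst _) (dV [:: i + 2])) (cvgCM (cst _) (dV [:: i + 1]))).
by apply/funext => t; rewrite /gactS opLE.
Qed.

Lemma pathlim_opRL gamma zeta V i : path_cvg zeta V ->
  pathlim zeta (gactS (opRL gamma i) V) = opRL gamma i (pathlim zeta V).
Proof.
move=> [cV hV]; apply: pathlimE => x; have [->|x0] := eqVneq x 0.
  rewrite /opRL off0_0 (_ : (fun t => _) = (fun=> 0)); first exact: cvgC_cst.
  by apply/funext => t; rewrite /gactS /opRL off0_0.
have E t := opRLE gamma i (V (zeta t)) x0.
rewrite opRLE// (funext E : (fun t => gactS (opRL gamma i) V (zeta t) x) = _).
have dV s := cvg_Cinf0_pds (s := s) hV x0.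
have cst (k : R[i]^o) : (fun=> k) @ right0 --> k by exact: cvgC_cst.
have m (k : R[i]^o) s : (k * pds s (V (zeta t)) x : R[i]^o) @[t --> right0] -->
    (k * pds s (pathlim zeta V) x : R[i]^o) by exact: (cvgCM (cst k) (dV s)).
exact: (cvgCM (cst _) (cvgCD (cvgCB (cvgCB (cvgCB (m _ _) (m _ _)) (cvgCB (m _ _) (m _ _)))
  (dV [:: i])) (m _ [::]))).
Qed.

End Limits.

(** * The two families and the jump map *)

Section Torsion.
Variable R : realType.
Implicit Types (p q : {poly R[i]}) (V W : sect R) (z : R[i]).

Lemma cspan_sub (E : lmodType R[i]) (G : set E) v : G v -> cspan G v.
Proof.
by move=> Gv; exists 1%N, (fun=> 1), (fun=> v); split => //; rewrite big_ord1 scale1r.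
Qed.

Lemma sect_sumE (I : Type) (r : seq I) (P : pred I) (F : I -> sect R) z :
  (\sum_(k <- r | P k) F k) z = \sum_(k <- r | P k) F k z.
Proof. by elim/big_rec2: _ => // k f V _ <-. Qed.

Lemma OscaleDl p q V : Oscale (p + q) V = Oscale p V + Oscale q V.
Proof. by apply/funext => z; rewrite /Oscale hornerD scalerDl. Qed.

Lemma OscaleDr p V W : Oscale p (V + W) = Oscale p V + Oscale p W.
Proof. by apply/funext => z; rewrite /Oscale scalerDr. Qed.

Lemma Oscale0 V : Oscale 0 V = 0.
Proof. by apply/funext => z; rewrite /Oscale horner0 scale0r. Qed.

Lemma Oscale0r p : Oscale p (0 : sect R) = 0.
Proof. by apply/funext => z; rewrite /Oscale scaler0. Qed.

Lemma OscaleA p q V : Oscale p (Oscale q V) = Oscale (p * q) V.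
Proof. by apply/funext => z; rewrite /Oscale hornerM scalerA. Qed.

Lemma OscaleN p V : Oscale (- p) V = - Oscale p V.
Proof. by apply/funext => z; rewrite /Oscale hornerN scaleNr. Qed.

Lemma Oscale_suml (I : Type) (r : seq I) (P : pred I) (p : I -> {poly R[i]}) V :
  Oscale (\sum_(k <- r | P k) p k) V = \sum_(k <- r | P k) Oscale (p k) V.
Proof. exact: (big_morph (fun p => Oscale p V) (fun p q => OscaleDl p q V) (Oscale0 V)). Qed.

Lemma Oscale_sumr (I : Type) (r : seq I) (P : pred I) p (F : I -> sect R) :
  Oscale p (\sum_(k <- r | P k) F k) = \sum_(k <- r | P k) Oscale p (F k).
Proof. exact: (big_morph (Oscale p) (OscaleDr p) (Oscale0r p)). Qed.

Lemma torsion_free (M : set (sect R)) p V : free_Omodule M -> M V -> p != 0 ->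
  Oscale p V = 0 -> V = 0.
Proof.
move=> [B [_ gen fr]] MV p0; have [n [a [b [Bb ->]]]] := gen V MV.
(* Freeness speaks of injective families, whereas the [b i] may repeat; the coefficients of equal
   generators are collected first. *)
pose s := undup [seq b i | i : 'I_n].
have bs i : b i \in s by rewrite mem_undup; apply: map_f; rewrite mem_enum.
pose h (i : 'I_n) : 'I_(size s) := Ordinal (etrans (index_mem (b i) s) (bs i)).
pose b' (j : 'I_(size s)) := nth 0 s j.
have bh i : b i = b' (h i) by rewrite /b' /h /= nth_index.
have -> : \sum_i Oscale (a i) (b i) =
    \sum_j Oscale (\sum_(i | h i == j) a i) (b' j).
  rewrite (@partition_big _ _ _ _ _ _ _ h xpredT)//; apply: eq_bigr => j _.
  by rewrite Oscale_suml; apply: eq_bigr => i /eqP <-; rewrite -bh.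
rewrite Oscale_sumr; under eq_bigr do rewrite OscaleA.
move=> H; have inj_b : injective b'.
  by move=> i j /eqP; rewrite nth_uniq ?undup_uniq// => /eqP/val_inj.
have Bb' j : B (b' j).
  have : b' j \in s by exact: mem_nth.
  by rewrite mem_undup => /mapP[i _ ->].
rewrite big1// => j _; have /eqP := fr _ _ _ inj_b Bb' H j.
by rewrite mulf_eq0 (negPf p0)/= => /eqP ->; rewrite Oscale0.
Qed.

End Torsion.

Section Families.
Variables (R : realType) (gamma : R).
Implicit Types (p q : {poly R[i]}) (V W F : sect R) (z : R[i]) (f g : fn R)
  (A : 'M[R]_3) (x : 'cV[R]_3).

Definition reg0 : sect R := fun z => regfn gamma 0 z (fun=> 1).

Lemma reg0E z : reg0 z = rfun (Frad gamma 0 z).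
Proof. exact: regfn_rfun. Qed.

Lemma harmonic1 : harmonic_poly 0 ((fun=> 1) : fn R).
Proof.
have D (i : 'I_3) : pd i ((fun=> 1) : fn R) = (fun=> 0).
  by apply/funext => y; exact: (pd_cst 1).
split; last by move=> x; apply: big1 => i _; rewrite D; exact: (pd_cst 0).
exists (fun=> 1) => x.
rewrite (big_pred1 [ffun=> ord0]); last first.
  move=> m /=; have -> : m = [ffun=> ord0] by apply/ffunP => j; rewrite ffunE ord1.
  by rewrite eqxx big1// => j _; rewrite ffunE.
by rewrite mul1r big1 // => j _; rewrite ffunE expr0.
Qed.

Lemma reg0_Rfam : Rfam gamma reg0.
Proof.
apply: cspan_sub; exists 1, 0%N, (fun=> 1); split; first exact: harmonic1.
by apply/funext => z; rewrite hornerC scale1r.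
Qed.

Lemma nice_reg0 z : nice (reg0 z).
Proof. rewrite reg0E; apply: nice_rfun; exact: rsmooth2_Frad. Qed.

Lemma niceZ (a : R[i]) f : nice f -> nice (a *: f).
Proof. by move=> nf; rewrite -[_ *: _]addr0; exact: niceZD nf (nice0 R). Qed.

Lemma nice_Rgen l z (P : fn R) : harmonic_poly l P -> nice (regfn gamma l z P).
Proof.
by move=> /harmonic_polyP[c [-> _]]; apply: nice_regfn; exact: rsmooth2_Frad.
Qed.

Lemma WrZl (a : R[i]) f g : nice f -> nice g -> Wr (a *: f) g = a * Wr f g.
Proof.
move=> nf ng.
have := @Wr_suml R _ [:: tt] xpredT (fun=> a) (fun=> f) g (fun _ _ => nf) ng.
by rewrite !big_seq1.
Qed.

Lemma WrZr (a : R[i]) f g : nice f -> nice g -> Wr g (a *: f) = a * Wr g f.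
Proof.
move=> nf ng.
have := @Wr_sumr R _ [:: tt] xpredT (fun=> a) (fun=> f) g (fun _ _ => nf) ng.
by rewrite !big_seq1.
Qed.

Lemma Wr0l g : nice g -> Wr 0 g = 0.
Proof. by move=> ng; rewrite -(scale0r (0 : fn R)) (WrZl 0 (nice0 R) ng) mul0r. Qed.

Lemma Wr0r g : nice g -> Wr g 0 = 0.
Proof. by move=> ng; rewrite -(scale0r (0 : fn R)) (WrZr 0 (nice0 R) ng) mul0r. Qed.

Lemma Rfam_nice F z : Rfam gamma F -> nice (F z).
Proof.
move=> [n [c [G [hG ->]]]]; rewrite sect_sumE.
have nG k : nice (G k z).
  by have [p [l [P [hP ->]]]] := hG k; apply/niceZ/nice_Rgen.
exact: (@nice_rd_sum R _ (index_enum 'I_n) xpredT c (fun k => G k z) (fun k _ => nG k)).1.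
Qed.

(* Distinct harmonics are orthogonal, and F_0 has vanishing Wronskian with itself. *)
Lemma Wr_Rfam_reg0 F z : Rfam gamma F -> Wr (F z) (reg0 z) = 0.
Proof.
move=> [n [c [G [hG ->]]]]; rewrite sect_sumE.
have nG k : nice (G k z).
  by have [p [l [P [hP ->]]]] := hG k; apply/niceZ/nice_Rgen.
have -> : \sum_(k < n) (c k *: G k) z = \sum_(k < n) c k *: G k z by [].
rewrite (Wr_suml _ c (fun k _ => nG k) (nice_reg0 z)) big1// => k _.
have [p [l [P [hP ->]]]] := hG k.
rewrite (WrZl p.[z] (nice_Rgen z hP) (nice_reg0 z)).
have sF := @rsmooth2_Frad R gamma; rewrite reg0E.
have [d [Pd _]] := harmonic_polyP hP; rewrite {1}Pd Wr_regfn_rfun// -Pd.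
case: l hP d Pd => [|l] hP d Pd; last by rewrite (smean_harmonic hP)// !mulr0.
by rewrite /wr1 [X in X - _]mulrC subrr mul0r !mulr0.
Qed.

Lemma Kod_Spec V z : Kod gamma V -> SpecT gamma z -> V z = 0.
Proof.
move=> [n [c [G [hG ->]]]] sz; rewrite sect_sumE big1// => k _.
have [h _ _] := hG k; have -> : (c k *: G k) z = c k *: G k z by [].
by rewrite h// scaler0.
Qed.

Lemma Kod_Sol V z : Kod gamma V -> ~ SpecT gamma z -> Sol gamma z (V z).
Proof.
move=> [n [c [G [hG ->]]]] sz; rewrite sect_sumE.
elim/big_rec: _ => [|k f _ sf]; first exact: Sol0.
by apply: SolZD sf; have [_ h _] := hG k; have [] := h z sz.
Qed.

Lemma Kod_Cinf0 V z : Kod gamma V -> Cinf0 (V z).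
Proof.
move=> hV; have [sz|sz] := pselect (SpecT gamma z).
  by rewrite (Kod_Spec hV sz); exact: Cinf0_0.
by have [] := Kod_Sol hV sz.
Qed.

(** A nonzero value comes from a nonempty combination, as [Sol_infty_sum] requires. *)
Lemma Kod_Sol_infty V z : Kod gamma V -> ~ SpecT gamma z -> V z != 0 ->
  Sol_infty gamma z (V z).
Proof.
move=> [n [c [G [hG ->]]]] sz; rewrite sect_sumE => nz.
apply: (@Sol_infty_sum R gamma z n c (fun k => G k z)); last first.
  by move=> k; have [_ h _] := hG k; exact: h.
by case: n c G hG nz => // c G hG; rewrite big_ord0 eqxx.
Qed.

(** Writing 0 as f - f lets it inherit a cutoff. *)
Lemma Sol_infty_0 f z : Sol_infty gamma z f -> Sol_infty gamma z 0.
Proof.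
by move=> sf; rewrite -(subrr f) addrC -scaleN1r; exact: Sol_inftyZD.
Qed.

Lemma Kod_Wr V F : Kod gamma V -> Rfam gamma F ->
  exists p, forall z, ~ SpecT gamma z -> Wr (F z) (V z) = p.[z].
Proof.
move=> [n [c [G [hG ->]]]] hF.
have cG k z : ~ SpecT gamma z -> nice (G k z).
  by move=> sz; have [_ h _] := hG k; apply: Cinf0_nice; have [[]] := h z sz.
have /choice[p hp] k : exists p, forall z, ~ SpecT gamma z -> Wr (F z) (G k z) = p.[z].
  by have [_ _ h] := hG k; exact: h.
exists (\sum_k (c k) *: p k) => z sz; rewrite sect_sumE.
have -> : \sum_(k < n) (c k *: G k) z = \sum_(k < n) c k *: G k z by [].
rewrite (Wr_sumr _ c (fun k _ => cG k z sz) (Rfam_nice z hF)) horner_sum.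
by apply: eq_bigr => k _; rewrite hornerZ hp.
Qed.

Lemma Kfixed_Kinvariant (M : set (sect R)) V z : Kfixed M V -> Kinvariant (V z).
Proof. by move=> [_ h] A /h hA; rewrite -[in RHS]hA. Qed.

Lemma Oscale_Kfixed (M : set (sect R)) p V : M (Oscale p V) -> Kfixed M V ->
  Kfixed M (Oscale p V).
Proof.
move=> h [_ fV]; split=> // A hA; apply/funext => z.
by rewrite /Oscale -{2}(fV A hA).
Qed.

(* Averaging over spheres kills the harmonics of positive degree. *)
Lemma Rfam_Kfixed F : Kfixed (Rfam gamma) F -> exists q, F = Oscale q reg0.
Proof.
move=> hF; have [[n [c [G [hG FE]]]] _] := hF.
have /choice[t ht] k : exists t : {poly R[i]} * nat * fn R, harmonic_poly t.1.2 t.2 /\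
    G k = fun z => t.1.1.[z] *: regfn gamma t.1.2 z t.2.
  by have [p [l [P h]]] := hG k; exists (p, l, P).
pose p k := (t k).1.1; pose l k := (t k).1.2; pose P k := (t k).2.
(* The mean value of [P k] over the sphere. It is 0 in positive degree, so only the terms of degree
   0 contribute to the polynomial given below. *)
pose m k := ((4 * pi)^-1)%:C * smean (P k).
have pi4 : ((4 * pi)^-1)%:C * (4 * pi)%:C = 1 :> R[i].
  by rewrite -rmorphM/= mulVf// mulf_neq0// ?pnatr_eq0// gt_eqF// pi_gt0.
exists (\sum_k (c k * m k) *: p k); apply/funext => z; apply/funext => x.
have [->|x0] := eqVneq x 0.
  rewrite FE sect_sumE fct_sumE /Oscale reg0E /= !fctE /rfun off0_0 scaler0 big1// => k _.
  rewrite (ht k).2 !fctE /regfn off0_0 !scaler0//.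
have r0 := rad_gt0 x0; set r := rad x.
(* By invariance x may be replaced by r y for every unit vector y; the left side does not depend on
   y, so both sides can be averaged over y. *)
have Fr y : rad y = 1 -> F z x = \sum_k (c k * (p k).[z] * Frad gamma (l k) z r) * P k y.
  move=> y1; have y0 : y != 0 by apply: contraPneq y1 => ->; rewrite rad0 => /eqP; rewrite eq_sym oner_eq0.
  have ry : rad (r *: y) = r by rewrite rad_scale ?y1 ?mulr1// ltW.
  rewrite (@Kinvariant_radial R (F z) x (r *: y))//; last exact: Kfixed_Kinvariant hF.
  rewrite FE sect_sumE fct_sumE; apply: eq_bigr => k _.
  have -> : (c k *: G k) z (r *: y) = c k * (G k z (r *: y)) by [].
  rewrite (ht k).2; have -> : ((t k).1.1.[z] *: regfn gamma (t k).1.2 z (t k).2) (r *: y) =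
    (p k).[z] * regfn gamma (l k) z (P k) (r *: y) by [].
  rewrite /regfn off0E; last by rewrite scaler_eq0 negb_or y0 gt_eqF.
  by rewrite ry scalerA mulVf ?scale1r ?gt_eqF// !mulrA.
have cP k : forall y, y != 0 -> {for y, continuous (P k)}.
  move=> y _; have [d [e _]] := harmonic_polyP (ht k).1; rewrite /P e.
  exact: cdiff_continuous (cdiff_hpoly _ _).
have H : (4 * pi)%:C * F z x = \sum_k (c k * (p k).[z] * Frad gamma (l k) z r) * smean (P k).
  rewrite -smean_cst -(smean_sum _ _ (fun k _ => cP k)).
  by apply: eq_sint => a b; rewrite -Fr ?rad_sphere.
rewrite -[LHS]mul1r -pi4 -mulrA H mulr_sumr /Oscale horner_sum.
have -> : ((\sum_(k < n) (c k * m k *: p k).[z]) *: reg0 z) x =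
  (\sum_(k < n) (c k * m k *: p k).[z]) * reg0 z x by [].
rewrite reg0E /rfun off0E// -/r mulr_suml; apply: eq_bigr => k _; rewrite hornerZ /m.
have hk := (ht k).1; rewrite -/(l k) -/(P k) in hk *.
case: (l k) hk => [|j] hk; last by rewrite (smean_harmonic hk)// !(mulr0, mul0r).
have E (e1 e2 e3 e4 e5 : R[i]) : e2 * (e4 * e5 * e1 * e3) = e4 * (e2 * e3) * e5 * e1 by ring.
exact: E.
Qed.

End Families.

(** * Equivariance of the jump and its restriction to invariants *)

Section JumpMap.
Variables (R : realType) (gamma : R) (V0 : sect R).
Hypothesis gamma_gt0 : 0 < gamma.
Hypothesis R_family : algebraic_family gamma (Rfam gamma).
Hypothesis K_family : algebraic_family gamma (Kod gamma).
Hypothesis V0_fixed : Kfixed (Kod gamma) V0.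
Hypothesis V0_normalized : forall z : R[i], ~ SpecT gamma z ->
  Wr (V0 z) (regfn gamma 0 z (fun=> 1)) = 1.
Hypothesis w_neq0 : forall lam : R, 0 < lam -> wronskian_factor V0 lam != 0.
Hypothesis boundary_values : forall V : sect R, Kod gamma V ->
  forall lam : R, 0 < lam ->
    cvg_Cinf0 (fun eps => V (lam +i* eps)) (Vplus V lam) /\
    cvg_Cinf0 (fun eps => V (lam -i* eps)) (Vminus V lam).
Hypothesis jump : forall V : sect R, Kod gamma V ->
  exists! F : sect R, Rfam gamma F /\
    forall lam : R, 0 < lam ->
      Vplus V lam - Vminus V lam = wronskian_factor V0 lam *: F lam%:C.

Implicit Types (p q : {poly R[i]}) (V W F : sect R) (z : R[i]) (f g : fn R) (lam : R).
Local Notation w := (wronskian_factor V0).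
Local Notation reg0 := (reg0 gamma).
Local Notation h := (jump_map gamma V0).

Lemma is_jumpP V F : is_jump gamma V0 V F <-> Rfam gamma F /\ forall lam : R, 0 < lam ->
  Vplus V lam - Vminus V lam = w lam *: F lam%:C.
Proof.
split=> -[hF e]; split=> // lam l0; rewrite e// scalerA.
  by rewrite divff ?w_neq0// scale1r.
by rewrite mulVf ?w_neq0// scale1r.
Qed.

Lemma jump_unique V : Kod gamma V -> unique (is_jump gamma V0 V) (h V).
Proof.
move=> hV; have [F [/is_jumpP hF uF]] := jump hV.
have hh : is_jump gamma V0 V (h V).
  exact: (@xgetPex _ (0 : sect R) [set F | is_jump gamma V0 V F] (ex_intro _ F hF)).
split=> // F' /is_jumpP hF'; rewrite -(uF _ hF').
by apply/esym/uF/is_jumpP.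
Qed.

Lemma is_jump_eq V F : Kod gamma V -> is_jump gamma V0 V F -> h V = F.
Proof. by move=> hV; exact: (jump_unique hV).2. Qed.

Lemma jump_mapP V : Kod gamma V -> is_jump gamma V0 V (h V).
Proof. by move=> hV; exact: (jump_unique hV).1. Qed.

Lemma path_plus V lam : Kod gamma V -> 0 < lam -> path_cvg (fun t => lam +i* t) V.
Proof.
by move=> hV l0; split; [move=> z; exact: Kod_Cinf0 hV|exact: (boundary_values hV l0).1].
Qed.

Lemma path_minus V lam : Kod gamma V -> 0 < lam -> path_cvg (fun t => lam -i* t) V.
Proof.
by move=> hV l0; split; [move=> z; exact: Kod_Cinf0 hV|exact: (boundary_values hV l0).2].
Qed.

Lemma path_plus0 lam : ((lam +i* t : R[i]^o) @[t --> (0 : R)^'+] --> (lam%:C : R[i]^o)).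
Proof.
apply/cvgC; split=> /=; first exact: cvg_cst.
by apply: cvg_at_right_filter; exact: cvg_id.
Qed.

Lemma path_minus0 lam : ((lam -i* t : R[i]^o) @[t --> (0 : R)^'+] --> (lam%:C : R[i]^o)).
Proof.
apply/cvgC; split=> /=; first exact: cvg_cst.
rewrite -[X in _ --> X]oppr0; apply: cvgN; apply: cvg_at_right_filter; exact: cvg_id.
Qed.

Lemma VplusE V lam : Vplus V lam = pathlim (fun t => lam +i* t) V.
Proof. by []. Qed.

Lemma VminusE V lam : Vminus V lam = pathlim (fun t => lam -i* t) V.
Proof. by []. Qed.

Lemma jump_mapD V W : Kod gamma V -> Kod gamma W -> h (V + W) = h V + h W.
Proof.
move=> hV hW; apply: is_jump_eq; first exact: familyD K_family _ _ hV hW.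
have [rV eV] := jump_mapP hV; have [rW eW] := jump_mapP hW.
split=> [|lam l0]; first exact: familyD R_family _ _ rV rW.
rewrite !VplusE !VminusE (pathlimD (path_plus hV l0) (path_plus hW l0)).
rewrite (pathlimD (path_minus hV l0) (path_minus hW l0)).
have -> : (h V + h W) lam%:C = h V lam%:C + h W lam%:C by [].
by rewrite eV// eW// -scalerDr opprD addrACA.
Qed.

Lemma jump_mapZ p V : Kod gamma V -> h (Oscale p V) = Oscale p (h V).
Proof.
move=> hV; apply: is_jump_eq; first exact: familyZ K_family p _ hV.
have [rV eV] := jump_mapP hV.
split=> [|lam l0]; first exact: familyZ R_family p _ rV.
rewrite VplusE VminusE (pathlim_Oscale p (@path_plus0 lam) (path_plus hV l0)).
rewrite (pathlim_Oscale p (@path_minus0 lam) (path_minus hV l0)).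
by rewrite /Oscale eV// -scalerBr !scalerA mulrC.
Qed.

(** The action of [A] only moves the argument of a function, so it commutes with the pointwise
    limits [Vplus] and [Vminus] by computation. *)
Lemma jump_mapK A V : O3 A -> Kod gamma V -> h (kactS A V) = kactS A (h V).
Proof.
move=> hA hV; apply: is_jump_eq; first exact: familyK K_family A _ hA hV.
have [rV eV] := jump_mapP hV.
split=> [|lam l0]; first exact: familyK R_family A _ hA rV.
by rewrite /kactS eV.
Qed.

(** Linearity of [X] is asked on [Cinf0] only; both boundary values lie there, because membership of
    the limit is part of [cvg_Cinf0]. *)
Lemma jump_map_op (X : fn R -> fn R) V : gLie gamma X ->
  (forall (a : R[i]) f g, Cinf0 f -> Cinf0 g -> X (a *: f + g) = a *: X f + X g) ->
  (forall zeta W, path_cvg zeta W -> pathlim zeta (gactS X W) = X (pathlim zeta W)) ->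
  Kod gamma V -> h (gactS X V) = gactS X (h V).
Proof.
move=> gX XZD Xlim hV; apply: is_jump_eq; first exact: familyg K_family X _ gX hV.
have [rV eV] := jump_mapP hV.
split=> [|lam l0]; first exact: familyg R_family X _ gX rV.
have cp := (boundary_values hV l0).1.1; have cm := (boundary_values hV l0).2.1.
rewrite VplusE VminusE (Xlim _ _ (path_plus hV l0)) (Xlim _ _ (path_minus hV l0)).
have X0 : X 0 = 0.
  have := XZD 1 0 0 (@Cinf0_0 R) (@Cinf0_0 R).
  by rewrite !scale1r addr0 => /eqP; rewrite -subr_eq subrr => /eqP.
rewrite /gactS eV// -VplusE -VminusE.
have -> : (w lam)^-1 *: (Vplus V lam - Vminus V lam) =
  (w lam)^-1 *: (-1 *: Vminus V lam + Vplus V lam) + 0.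
  by rewrite addr0 scaleN1r addrC.
rewrite XZD//; [|exact: Cinf0ZD|exact: Cinf0_0].
by rewrite XZD// X0 addr0 scaleN1r addrC.
Qed.

Lemma polyT1 f : polyT gamma 1 f = f.
Proof. by rewrite /polyT size_poly1 big_ord1 coefC scale1r. Qed.

Lemma polyT0 f : polyT gamma 0 f = 0.
Proof. by rewrite /polyT size_poly0 big_ord0. Qed.

Lemma gLie_opL i : gLie gamma (@opL R i).
Proof.
exists (fun j => (j == i)%:R), (fun=> 0); apply/funext => f.
rewrite (bigD1 i)//= eqxx polyT1 polyT0 addr0 big1 ?addr0// => j /negPf ->.
by rewrite !polyT0 addr0.
Qed.

Lemma gLie_opRL i : gLie gamma (opRL gamma i).
Proof.
exists (fun=> 0), (fun j => (j == i)%:R); apply/funext => f.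
rewrite (bigD1 i)//= big1 ?addr0 ?eqxx.
  exact: esym (etrans (congr2 +%R (polyT0 _) (polyT1 _)) (add0r _)).
by move=> j /negPf ->; rewrite !polyT0 addr0.
Qed.

(* By O-linearity it is enough to treat the generators L_i and R_i of g. *)
Lemma gactS_gen (M : set (sect R)) (p q : 'I_3 -> {poly R[i]}) V :
  algebraic_family gamma M -> M V ->
  gactS (fun f => \sum_i (polyT gamma (p i) (opL i f) + polyT gamma (q i) (opRL gamma i f))) V =
  \sum_i (Oscale (p i) (gactS (@opL R i) V) + Oscale (q i) (gactS (opRL gamma i) V)).
Proof.
move=> fM hV.
transitivity (\sum_i (gactS (polyT gamma (p i) \o @opL R i) V +
    gactS (polyT gamma (q i) \o opRL gamma i) V)).
  by apply/funext => z; rewrite sect_sumE.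
apply: eq_bigr => i _.
rewrite (familyg_Olinear fM (p i) (gLie_opL i) hV).
by rewrite (familyg_Olinear fM (q i) (gLie_opRL i) hV).
Qed.

Lemma jump_map_sum (I : Type) (r : seq I) (V : I -> sect R) :
  (forall i, Kod gamma (V i)) ->
  Kod gamma (\sum_(i <- r) V i) /\ h (\sum_(i <- r) V i) = \sum_(i <- r) h (V i).
Proof.
move=> hV; elim: r => [|i r [ih1 ih2]].
  rewrite !big_nil; split; first exact: family0 K_family.
  rewrite -[X in h X](Oscale0 0) jump_mapZ ?Oscale0//; exact: family0 K_family.
rewrite !big_cons; split; first exact: familyD K_family _ _ (hV i) ih1.
by rewrite jump_mapD// ih2.
Qed.

Lemma jump_mapg X V : gLie gamma X -> Kod gamma V -> h (gactS X V) = gactS X (h V).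
Proof.
move=> [p [q ->]] hV; rewrite (gactS_gen p q K_family hV).
rewrite (gactS_gen p q R_family (jump_mapP hV).1).
have kL i := familyg K_family (gLie_opL i) hV.
have kR i := familyg K_family (gLie_opRL i) hV.
have kp i := familyZ K_family (p i) (kL i).
have kq i := familyZ K_family (q i) (kR i).
rewrite (jump_map_sum (index_enum 'I_3) (fun i => familyD K_family (kp i) (kq i))).2.
apply: eq_bigr => i _.
rewrite (jump_mapD (kp i) (kq i)) (jump_mapZ (p i) (kL i)) (jump_mapZ (q i) (kR i)).
rewrite (jump_map_op (gLie_opL i) (opLZD i) (fun zeta W => @pathlim_opL R zeta W i) hV).
by rewrite (jump_map_op (gLie_opRL i) (opRLZD gamma i)
  (fun zeta W => @pathlim_opRL R gamma zeta W i) hV).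
Qed.

Lemma jump_map_morphism : family_morphism gamma (Kod gamma) (Rfam gamma) h.
Proof.
split; [by move=> V /jump_mapP[]|exact: jump_mapD|exact: jump_mapZ|exact: jump_mapK|exact: jump_mapg].
Qed.

Lemma Wr_antisym f g : nice f -> nice g -> Wr f g = - Wr g f.
Proof.
move=> nf ng; have E (a b c d : R[i]) : a * b - c * d = -1 * (d * c - b * a) by ring.
have wE : wrint f g = fun x => -1 * wrint g f x by apply/funext => x; exact: E.
by rewrite !WrE wE (smean_scaled _ (wrint_cont ng nf)) mulN1r mulrN.
Qed.

Lemma not_SpecT (a b : R) : b != 0 -> ~ SpecT gamma (a +i* b).
Proof.
move=> b0 [[n _ [_ e]]|]; first by rewrite e eqxx in b0.
by rewrite /= lecE /= (negPf b0).
Qed.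

Lemma V0_neq0 z : ~ SpecT gamma z -> V0 z != 0.
Proof.
move=> sz; apply/eqP => v0; have := V0_normalized sz.
by rewrite v0 (Wr0l (nice_reg0 gamma z)) => /eqP; rewrite eq_sym oner_eq0.
Qed.

(* Supported at the single parameter z1, the section D is Kodaira-type because its
   Wronskian with every regular family vanishes; it is killed by 'X - z1. *)
Lemma Kod_proportional_reg0 V : Kod gamma V ->
  (forall z, ~ SpecT gamma z -> exists k : R[i], V z = k *: reg0 z) -> V = 0.
Proof.
move=> hV prop; apply/funext => z1; apply: contrapT => V1.
have s1 : ~ SpecT gamma z1 by move=> s; apply: V1; exact: Kod_Spec hV s.
have nV : V z1 != 0 by apply/eqP.
pose D : sect R := fun z => if z == z1 then V z1 else 0.
have hD : Kod gamma D.
  apply: cspan_sub; split=> [z sz|z sz|F hF]; rewrite /D.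
  - by have [e|//] := eqVneq z z1; move: s1; rewrite -e.
  - have [->|_] := eqVneq z z1; first exact: Kod_Sol_infty.
    (* Away from z1 the value 0 still needs a cutoff at the parameter z; the normalized family is
       nonzero there and provides it. *)
    exact: Sol_infty_0 (Kod_Sol_infty V0_fixed.1 sz (V0_neq0 sz)).
  - exists 0 => z sz; rewrite horner0; have nF := Rfam_nice z hF.
    have [->|_] := eqVneq z z1; last exact: Wr0r.
    have [k ->] := prop z1 s1.
    by rewrite (WrZr k (nice_reg0 gamma z1) (Rfam_nice z1 hF)) (Wr_Rfam_reg0 z1 hF) mulr0.
have XD : Oscale ('X - z1%:P) D = 0.
  apply/funext => z; rewrite /Oscale /D !hornerE; have [->|_] := eqVneq z z1; last exact: scaler0.
  by rewrite subrr scale0r.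
have D0 := torsion_free (family_free K_family) hD (negbT (polyXsubC_eq0 z1)) XD.
have := congr1 (fun S : sect R => S z1) D0; rewrite /D eqxx => /eqP; exact/negP.
Qed.

Lemma Kod_Kfixed V : Kfixed (Kod gamma) V -> exists q, V = Oscale q V0.
Proof.
move=> hV; have [kV _] := hV; have [kV0 _] := V0_fixed.
have [p hp] := Kod_Wr kV (reg0_Rfam gamma).
have kD : Kod gamma (V + Oscale p V0).
  by apply: (familyD K_family) => //; exact: (familyZ K_family).
(* The polynomial p is Wr(F_0, V), with the regular family on the left as in [Kod]; by antisymmetry
   the coefficient of V0 is - p. *)
exists (- p); rewrite OscaleN; apply/eqP; rewrite -addr_eq0; apply/eqP.
apply: (Kod_proportional_reg0 kD) => z sz; exists (- Wr (V z) (V0 z)).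
have -> : (V + Oscale p V0) z = V z + p.[z] *: V0 z by [].
have nV := Cinf0_nice (Kod_Cinf0 z kV).
rewrite {1}(Sol_Kinvariant_span gamma_gt0 (Kod_Sol kV sz) (Kod_Sol kV0 sz)
  (Kfixed_Kinvariant z hV) (Kfixed_Kinvariant z V0_fixed) (V0_normalized sz)).
rewrite -/(reg0 z) (Wr_antisym nV (nice_reg0 gamma z)) hp//.
by rewrite scaleNr addrAC addNr add0r scaleNr.
Qed.

(** For t > 0 the normalization is a relation between values and first derivatives at r = 1 on one
    axis, and each of these four quantities converges. *)
Lemma wr1_pathlim zeta (z0 : R[i]) : path_cvg zeta V0 ->
  (zeta t : R[i]^o) @[t --> (0 : R)^'+] --> (z0 : R[i]^o) ->
  (forall t, 0 < t -> ~ SpecT gamma (zeta t)) ->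
  wr1 (axis (pathlim zeta V0)) (Frad gamma 0 z0) = 1.
Proof.
move=> [cV hV] hz sz; have x0 := @axis_neq0 R 1 ltr01.
pose u t : R[i]^o := wr1 (axis (V0 (zeta t))) (Frad gamma 0 (zeta t)).
have u1 t : 0 < t -> u t = 1.
  move=> t0; rewrite -(V0_normalized (sz t t0)) -/(reg0 (zeta t)) reg0E.
  rewrite {1}(Kinvariant_axis (cV (zeta t)).1 (Kfixed_Kinvariant (zeta t) V0_fixed)).
  by rewrite Wr_rfun//; [exact: rsmooth2_axis|exact: rsmooth2_Frad].
have [f1 f2] := Frad0_cvg gamma_gt0 hz.
have d0 := cvg_Cinf0_pds (s := [::]) hV x0.
have d1 := cvg_Cinf0_pds (s := [:: 0]) hV x0.
have cu : u t @[t --> (0 : R)^'+] -->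
    (wr1 (axis (pathlim zeta V0)) (Frad gamma 0 z0) : R[i]^o).
  rewrite (_ : u = fun t => pds [:: 0] (V0 (zeta t)) (1 *: delta_mx 0 0) * Frad gamma 0 (zeta t) 1
      - pds [::] (V0 (zeta t)) (1 *: delta_mx 0 0) * rderiv (Frad gamma 0 (zeta t)) 1); last first.
    by apply/funext => t; rewrite /u /wr1 rderiv_axis.
  rewrite /wr1 rderiv_axis; exact: (cvgCB (cvgCM d1 f1) (cvgCM d0 f2)).
have c1 : u t @[t --> (0 : R)^'+] --> (1 : R[i]^o).
  apply: cvg_near_cst; near=> t; apply: u1; near: t; exact: nbhs_right_gt.
exact: (cvg_unique (@norm_hausdorff _ _) cu c1).
Unshelve. all: by end_near.
Qed.

Lemma pathlim_Kinvariant zeta : Kinvariant (pathlim zeta V0).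
Proof.
move=> A hA; rewrite -[in RHS](V0_fixed.2 A hA) //.
Qed.

Lemma poly_eq_positive p q : (forall lam : R, 0 < lam -> p.[lam%:C] = q.[lam%:C]) -> p = q.
Proof.
move=> pq; apply/eqP; rewrite -subr_eq0; apply/negPn/negP => n0.
(* The positive integers up to the size of p - q are more roots than its degree allows. *)
pose rs := [seq (k.+1%:R : R)%:C | k <- iota 0 (size (p - q))].
have := @max_poly_roots _ (p - q) rs n0; rewrite size_map size_iota ltnn; move=> H.
suff : false by []; apply: H.
  by apply/allP => _ /mapP[k _ ->]; rewrite rootE !hornerE pq ?subrr.
rewrite map_inj_uniq ?iota_uniq// => k1 k2 /complexI/eqP.
by rewrite eqr_nat => /eqP[].
Qed.

Lemma jump_map_V0 : h V0 = Oscale (-1) reg0.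
Proof.
have [kV0 fV0] := V0_fixed; have [rF eF] := jump_mapP kV0.
have hF : Kfixed (Rfam gamma) (h V0).
  by split=> // A hA; rewrite -jump_mapK// fV0.
have [p Fp] := Rfam_Kfixed hF; rewrite Fp; congr Oscale.
apply: poly_eq_positive => lam l0; rewrite hornerN hornerC.
have := eF lam l0; rewrite Fp /Oscale reg0E => e.
have cp := (boundary_values kV0 l0).1.1; have cm := (boundary_values kV0 l0).2.1.
have w1 : wr1 (axis (Vplus V0 lam)) (Frad gamma 0 lam%:C) = 1.
  apply: (wr1_pathlim (path_plus kV0 l0) (@path_plus0 lam)) => t t0.
  by apply: not_SpecT; rewrite gt_eqF.
have wE : w lam = wr1 (axis (Vplus V0 lam)) (axis (Vminus V0 lam)).
  rewrite /wronskian_factor.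
  rewrite {1}(Kinvariant_axis cp.1 (@pathlim_Kinvariant (fun t => lam +i* t))).
  rewrite {1}(Kinvariant_axis cm.1 (@pathlim_Kinvariant (fun t => lam -i* t))).
  by rewrite Wr_rfun//; exact: rsmooth2_axis.
pose k := w lam * p.[lam%:C]; set F0 := Frad gamma 0 lam%:C in e w1.
have Vm : Vminus V0 lam = - k *: rfun F0 + Vplus V0 lam.
  rewrite scaleNr /k -scalerA e scalerA divff ?w_neq0// scale1r opprB.
  by rewrite subrK.
have x0 := @axis_neq0 R 1 ltr01; have sF := @rsmooth2_Frad R gamma 0 lam%:C.
have rx : rad (1 *: delta_mx 0 0 : 'cV[R]_3) = 1 by rewrite scale1r rad_delta.
have dF : cdiff (rfun F0) (1 *: delta_mx 0 0) by apply: cdiff_rfun => //; rewrite rx; exact: (sF 1 ltr01).1.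
have v0 : axis (Vminus V0 lam) 1 = - k * F0 1 + axis (Vplus V0 lam) 1.
  rewrite Vm /axis.
  have -> : (- k *: rfun F0 + Vplus V0 lam) (1 *: delta_mx 0 0) =
    - k * rfun F0 (1 *: delta_mx 0 0) + Vplus V0 lam (1 *: delta_mx 0 0) by [].
  by rewrite {1}/rfun off0E// rx.
have v1 : rderiv (axis (Vminus V0 lam)) 1 = - k * rderiv F0 1 + rderiv (axis (Vplus V0 lam)) 1.
  rewrite !rderiv_axis {1}Vm /axis pdD; [|exact: cdiffZ|exact: (cp.2 [::])].
  have dF1 : rderivable F0 (rad (1 *: delta_mx 0 0 : 'cV[R]_3)).
    by rewrite rx; exact: (sF 1 ltr01).1.
  rewrite (pdZ (- k) 0 dF) (pd_rfun 0 x0 dF1).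
  by rewrite rx !mxE/= !mulr1 divr1 mul1r.
(* In the Wronskian of V0^+ with V0^- = V0^+ - c F_0 the part of V0^+ against itself cancels. *)
have E (a a' b b' c : R[i]) : a' * (- c * b + a) - a * (- c * b' + a') = - c * (a' * b - a * b').
  by ring.
have wk : w lam = - k.
  by rewrite wE /wr1 v0 v1 E -[X in - k * X]/(wr1 (axis (Vplus V0 lam)) F0) w1 mulr1.
apply: (mulfI (w_neq0 l0)); rewrite mulrN1 [in RHS]wk opprK //.
Qed.

(** On invariants the map becomes multiplication of the polynomial coefficient by -1; injectivity is
    the absence of torsion in the regular family. *)
Lemma jump_map_bij : set_bij (Kfixed (Kod gamma)) (Kfixed (Rfam gamma)) h.
Proof.
have [kV0 fV0] := V0_fixed.
have hq q : h (Oscale q V0) = Oscale (- q) reg0.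
  by rewrite jump_mapZ// jump_map_V0 OscaleA mulrN1.
have reg0_neq0 : reg0 <> 0.
  (* The imaginary unit is off the spectrum, and if F_0 were 0 the normalization there would read 0
     = 1. *)
  move=> e; have := V0_normalized (@not_SpecT 0 1 (oner_neq0 _)).
  rewrite -/(reg0 _) e Wr0r; last exact: Cinf0_nice (Kod_Cinf0 _ kV0).
  by move/eqP; rewrite eq_sym oner_eq0.
split.
- move=> V [kV fV]; split; first exact: (jump_mapP kV).1.
  by move=> A hA; rewrite -jump_mapK// fV.
- move=> V W /set_mem/Kod_Kfixed[p ->] /set_mem/Kod_Kfixed[q ->]; rewrite !hq => e.
  congr Oscale; apply/eqP; rewrite -subr_eq0; apply/negPn/negP => n0.
  apply: reg0_neq0; apply: (torsion_free (family_free R_family) (reg0_Rfam gamma) n0).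
  by rewrite OscaleDl -e OscaleN subrr.
- move=> F /Rfam_Kfixed[q ->]; exists (Oscale (- q) V0); last by rewrite hq opprK.
  by apply: Oscale_Kfixed => //; exact: familyZ K_family (- q) _ kV0.
Qed.

End JumpMap.

Theorem theorem8p3p11 (R : realType) (gamma : R) (V0 : sect R)
  (gamma_gt0 : 0 < gamma)
  (R_family : algebraic_family gamma (Rfam gamma))
  (K_family : algebraic_family gamma (Kod gamma))
  (V0_fixed : Kfixed (Kod gamma) V0)
  (V0_normalized : forall z : R[i], ~ SpecT gamma z ->
     Wr (V0 z) (regfn gamma 0 z (fun=> 1)) = 1)
  (w_neq0 : forall lam : R, 0 < lam -> wronskian_factor V0 lam != 0)
  (boundary_values : forall V : sect R, Kod gamma V ->
     forall lam : R, 0 < lam ->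
       cvg_Cinf0 (fun eps => V (lam +i* eps)) (Vplus V lam) /\
       cvg_Cinf0 (fun eps => V (lam -i* eps)) (Vminus V lam))
  (jump : forall V : sect R, Kod gamma V ->
     exists! F : sect R, Rfam gamma F /\
       forall lam : R, 0 < lam ->
         Vplus V lam - Vminus V lam = wronskian_factor V0 lam *: F lam%:C) :
  [/\ forall V : sect R, Kod gamma V ->
        unique (is_jump gamma V0 V) (jump_map gamma V0 V),
      family_morphism gamma (Kod gamma) (Rfam gamma) (jump_map gamma V0)
    & set_bij (Kfixed (Kod gamma)) (Kfixed (Rfam gamma))
        (jump_map gamma V0)].
Proof.
split; [exact: jump_unique w_neq0 jump|exact: jump_map_morphism|exact: jump_map_bij].
Qed.
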